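(* Let $\delta t>0$, and let $\phi^n\in V$ and $U^n\in L^2(\Omega)$ be given. Set $H^n=H(\phi^n)$ and $$P_1(\phi)=-\epsilon^2\Delta\phi+\tfrac12 H^nH^n\phi,\qquad g_1^n=H^nU^n-\tfrac12H^nH^n\phi^n .$$ Then the linear system for $(\phi^{n+1},\mu^{n+1})$ $$\frac{\phi^{n+1}-\phi^n}{\delta t}=\nabla\cdot(M(\phi^n)\nabla\mu^{n+1}),\qquad \mu^{n+1}=P_1(\phi^{n+1})+g_1^n,$$ with either periodic boundary conditions for $\phi^{n+1},\mu^{n+1}$, or $\partial_{\mathbf n}\phi^{n+1}|_{\partial\Omega}=\nabla\mu^{n+1}\cdot\mathbf n|_{\partial\Omega}=0$, admits a unique solution $\phi^{n+1},\mu^{n+1}$ in $H^1(\Omega)$ (i.e. a unique weak solution in $V\times V$). Moreover, the linear operator $\mathbb A$ of the system (defined in the context on mean-zero functions) is symmetric (self-adjoint) and positive definite: $(\mathbb A\psi,\chi)=(\psi,\mathbb A\chi)$ for all $\psi,\chi\in V_0$, and $(\mathbb A\psi,\psi)\ge 0$ for all $\psi\in V_0$, with equality if and only if $\psi=0$.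
   Context: Setting. $\Omega\subset\mathbb R^d$ is a bounded connected Lipschitz domain (a rectangular box in the periodic case), $\mathbf n$ is its outward normal, $(\cdot,\cdot)$ and $\|\cdot\|$ are the $L^2(\Omega)$ inner product and norm. $V=H^1(\Omega)$ in the case of Neumann boundary conditions, and $V$ is the space of periodic $H^1(\Omega)$ functions in the periodic case; $V_0=\{v\in V:\int_\Omega v\,d\boldsymbol x=0\}$. Equations are understood in the usual weak sense (tested with functions in $V$, integrating by parts using the boundary conditions): here, $\frac1{\delta t}(\phi^{n+1}-\phi^n,\chi)=-(M(\phi^n)\nabla\mu^{n+1},\nabla\chi)$ and $(\mu^{n+1},\chi)=\epsilon^2(\nabla\phi^{n+1},\nabla\chi)+\frac12(H^n\phi^{n+1},H^n\chi)+(g_1^n,\chi)$ for all $\chi\in V$. Parameters and functions. $\epsilon>0$, $\theta>1$, and $0<\sigma\ll1$ (in particular $\sigma<1/2$) are fixed constants. The mobility is $$M(\phi)=\begin{cases}\frac14\left(1-(1-\sigma)(2\phi-1)^2\right),&0\le\phi\le1,\\ \frac18\sigma\left(1+e^{-2(1-\sigma)((2\phi-1)^2-1)/\sigma}\right),&\text{otherwise.}\end{cases}$$ The (regularized) logarithmic Flory-Huggins potential $F:\mathbb R\to\mathbb R$ is $$F(\phi)=\begin{cases}\phi\ln\phi+\frac{(1-\phi)^2}{2\sigma}+(1-\phi)\ln\sigma-\frac\sigma2+\theta(\phi-\phi^2),&\phi\ge1-\sigma,\\ \phi\ln\phi+(1-\phi)\ln(1-\phi)+\theta(\phi-\phi^2),&\sigma\le\phi\le1-\sigma,\\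 (1-\phi)\ln(1-\phi)+\frac{\phi^2}{2\sigma}+\phi\ln\sigma-\frac\sigma2+\theta(\phi-\phi^2),&\phi\le\sigma,\end{cases}$$ $\sigma$ is small enough that $F$ is bounded below, $B$ is a constant with $F(x)+B>0$ for all $x\in\mathbb R$, $f=F'$, and $H(\phi)=f(\phi)/\sqrt{F(\phi)+B}$. The linear operator. For $u$ with $\int_\Omega u\,d\boldsymbol x=0$, let $v=\Delta^{-1}u$ denote the solution of $\nabla\cdot(M(\phi^n)\nabla v)=u$, $\int_\Omega v\,d\boldsymbol x=0$, with periodic or homogeneous Neumann ($\partial_{\mathbf n}v|_{\partial\Omega}=0$) boundary conditions. Subtracting the spatial means of $\phi^{n+1}$ and $\mu^{n+1}$ and eliminating $\mu^{n+1}$, the system becomes an equation $\mathbb A\psi=b$ for the mean-zero unknown $\psi=\phi^{n+1}-\frac{1}{|\Omega|}\int_\Omega\phi^{n+1}d\boldsymbol x\in V_0$, where $\mathbb A\psi=-\frac1{\delta t}\Delta^{-1}\psi+P_1(\psi)$ modulo additive constants; that is, $\mathbb A$ is determined by $$(\mathbb A\psi,\chi)=-\frac1{\delta t}(\Delta^{-1}\psi,\chi)+\epsilon^2(\nabla\psi,\nabla\chi)+\frac12(H^n\psi,H^n\chi),\qquad \psi,\chi\in V_0 .$$ *)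

(* Defs.v *)
From HB Require Import structures.
From mathcomp Require Import all_boot all_order all_algebra.
From mathcomp Require Import all_classical all_reals all_analysis.
Set Implicit Arguments.
Unset Strict Implicit.
Unset Printing Implicit Defensive.
Import Order.TTheory GRing.Theory Num.Theory.
Import numFieldNormedType.Exports.
Local Open Scope classical_set_scope.
Local Open Scope ring_scope.

Section measurable_row.
Context {R : realType}.
Variable n : nat.

(* The sigma-algebra generated by the coordinates, as for n-tuples: these are
   the Borel sets of R^n. *)
Let coords : 'I_n -> 'rV[R]_n -> measurableTypeR R := fun i x => x ord0 i.

Let row_set0 : g_sigma_preimage coords set0.
Proof. exact: sigma_algebra0. Qed.

Let row_setC A : g_sigma_preimage coords A -> g_sigma_preimage coords (~` A).
Proof. exact: sigma_algebraC. Qed.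

Let row_bigcup (F : (set 'rV[R]_n)^nat) :
  (forall i, g_sigma_preimage coords (F i)) ->
  g_sigma_preimage coords (\bigcup_i (F i)).
Proof. exact: sigma_algebra_bigcup. Qed.

HB.instance Definition _ := @isMeasurable.Build
  (measure_tuple_display default_measure_display)
  'rV[R]_n (g_sigma_preimage coords) row_set0 row_setC row_bigcup.

Lemma measurable_coord (i : 'I_n) :
  measurable_fun [set: 'rV[R]_n] (fun x => x ord0 i : measurableTypeR R).
Proof.
move=> _ Y mY; rewrite setTI; apply: sub_sigma_algebra => /=.
rewrite -bigcup_seq/=; exists i => /=; first by rewrite mem_index_enum.
by exists Y => //; rewrite setTI.
Qed.

Lemma measurable_fun_coordP d (T : measurableType d) (f : T -> 'rV[R]_n) :
  (forall i, measurable_fun [set: T] (fun x => f x ord0 i : measurableTypeR R))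
  -> measurable_fun [set: T] f.
Proof.
move=> mf _ A mA; rewrite setTI.
have : image_set_system setT f measurable A.
  move: A mA; apply: smallest_sub.
    by apply: sigma_algebra_image; exact: sigma_algebra_measurable.
  rewrite -bigcup_seq/=; apply: bigcup_sub => i _ _ [B mB <-].
  rewrite /image_set_system /= setTI; have := mf i measurableT B mB.
  by rewrite !setTI.
by rewrite /image_set_system /= setTI.
Qed.

End measurable_row.

Section lebesgue_measure_row.
Context {R : realType}.

Definition consrow n (p : measurableTypeR R * 'rV[R]_n) : 'rV[R]_n.+1 :=
  \row_i if unlift ord0 i is Some j then p.2 ord0 j else p.1.

Lemma measurable_consrow n : measurable_fun setT (@consrow n).
Proof.
apply: measurable_fun_coordP => i.
have -> : (fun p => consrow p ord0 i : measurableTypeR R) =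
    if unlift ord0 i is Some j then (fun p => p.2 ord0 j) else fst.
  by apply/funext => p; rewrite mxE; case: unlift.
case: unliftP => [j _|_]; last exact: measurable_fst.
exact: (measurableT_comp (measurable_coord j) measurable_snd).
Qed.

Definition unconsrow n (x : 'rV[R]_n.+1) : measurableTypeR R * 'rV[R]_n :=
  (x ord0 ord0, \row_j x ord0 (lift ord0 j)).

Lemma measurable_unconsrow n : measurable_fun setT (@unconsrow n).
Proof.
apply: measurable_fun_pair; first exact: measurable_coord.
apply: measurable_fun_coordP => i.
rewrite (_ : (fun _ => _) = fun x : 'rV[R]_n.+1 => x ord0 (lift ord0 i)).
  exact: measurable_coord.
by apply/funext => x; rewrite mxE.
Qed.

Lemma unconsrowK n : cancel (@unconsrow n) (@consrow n).
Proof.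
move=> x; apply/rowP => i; rewrite mxE; case: unliftP => [j ->|->] //=.
by rewrite mxE.
Qed.

Lemma consrowK n : cancel (@consrow n) (@unconsrow n).
Proof.
move=> [x y]; congr pair; first by rewrite mxE unlift_none.
by apply/rowP => j; rewrite !mxE liftK.
Qed.

Section step.
Variables (n : nat) (mu : {sigma_finite_measure set 'rV[R]_n -> \bar R}).

Definition lebesgue_step : set 'rV[R]_n.+1 -> \bar R :=
  pushforward (lebesgue_measure \x mu)%E (@consrow n).

HB.instance Definition _ := Measure.copy lebesgue_step
  (measure_function_pushforward__canonical__measure_function_Measure
    (lebesgue_measure \x mu)%E (@measurable_consrow n)).

Let lebesgue_step_sigma_finite : sigma_finite setT lebesgue_step.
Proof.
have /sigma_finiteP[F [FT ndF Foo]] :=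
  @sigma_finiteT _ _ _ (@lebesgue_measure R).
have /sigma_finiteP[G [GT ndG Goo]] := sigma_finiteT mu.
exists (fun k => @unconsrow n @^-1` (F k `*` G k)).
  apply/esym/seteqP; split=> // x _.
  have [i _ Fi] : (\bigcup_k F k) (x ord0 ord0) by rewrite -FT.
  have [j _ Gj] : (\bigcup_k G k) (unconsrow x).2 by rewrite -GT.
  exists (maxn i j) => //; split => /=.
    by move: Fi; apply/subsetPset/ndF/leq_maxl.
  by move: Gj; apply/subsetPset/ndG/leq_maxr.
move=> k; have [mF Fk] := Foo k; have [mG Gk] := Goo k; split.
  rewrite -[X in measurable X]setTI; apply: measurable_unconsrow => //.
  exact: measurableX.
rewrite /lebesgue_step /pushforward -comp_preimage.
rewrite (_ : _ \o _ = idfun); last by apply/funext => p; exact: consrowK.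
rewrite preimage_id (product_measure1E lebesgue_measure mu mF mG).
by rewrite lte_mul_pinfty// ge0_fin_numE.
Qed.

HB.instance Definition _ := Measure_isSigmaFinite.Build _ _ _ lebesgue_step
  lebesgue_step_sigma_finite.

End step.

Fixpoint lebesgue n : {sigma_finite_measure set 'rV[R]_n -> \bar R} :=
  if n is n'.+1 then lebesgue_step (lebesgue n') else \d_(0 : 'rV[R]_0).

Lemma lebesgue_prod n (A : 'I_n -> set R) : (forall i, measurable (A i)) ->
  lebesgue n [set x | forall i, A i (x ord0 i)]
    = (\prod_(i < n) lebesgue_measure (A i))%E.
Proof.
elim: n A => [|n IH] A mA.
  by rewrite big_ord0 /= diracE mem_set//= => -[i lti].
have mB : measurable [set y : 'rV[R]_n | forall i, A (lift ord0 i) (y ord0 i)].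
  rewrite (_ : [set _ | _] =
      \bigcap_(i in setT) ((fun y : 'rV[R]_n => y ord0 i) @^-1` A (lift ord0 i))).
    apply: fin_bigcap_measurable => // i _.
    by have := measurable_coord i measurableT (mA (lift ord0 i)); rewrite setTI.
  by apply/seteqP; split=> y h i => [_|]; [exact: h|exact: (h i)].
rewrite big_ord_recl -IH// /= /lebesgue_step /pushforward.
rewrite -(product_measure1E lebesgue_measure (lebesgue n) (mA ord0) mB).
congr (_ _); apply/seteqP; split => [[x y] /= h|[x y] /= [hx hy] i].
  split=> [|i]; first by have := h ord0; rewrite mxE unlift_none.
  by have := h (lift ord0 i); rewrite mxE liftK.
by rewrite mxE; case: unliftP => [j ->|->].
Qed.

End lebesgue_measure_row.

Section sobolev.
Context {R : realType} {d : nat}.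
Implicit Types (Omega : set 'rV[R]_d) (u v w : 'rV[R]_d -> R).
Implicit Types (a b : 'rV[R]_d) (g h : 'I_d -> 'rV[R]_d -> R).

Definition partial (i : 'I_d) u : 'rV[R]_d -> R :=
  fun x => 'D_(delta_mx 0 i) u x.

(* C^infinity: every iterated partial derivative is differentiable (hence
   continuous) everywhere. *)
Definition smooth u : Prop :=
  forall (s : seq 'I_d) (x : 'rV[R]_d), differentiable (foldr partial u s) x.

Definition test_function Omega u : Prop :=
  [/\ smooth u, compact (closure [set x | u x != 0])
    & closure [set x | u x != 0] `<=` Omega].

Definition L2 Omega u : Prop :=
  measurable_fun Omega u /\
  (\int[lebesgue d]_(x in Omega) ((u x) ^+ 2)%:E < +oo)%E.

Definition mean_zero Omega u : Prop := \int[lebesgue d]_(x in Omega) u x = 0.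

Definition ae_eq_on Omega u v : Prop :=
  {ae lebesgue d, forall x, Omega x -> u x = v x}.

Definition inner Omega u v : R := \int[lebesgue d]_(x in Omega) (u x * v x).

Definition innerv Omega g h : R := \sum_(i < d) inner Omega (g i) (h i).

Definition weak_gradient Omega u g : Prop :=
  forall i, L2 Omega (g i) /\
    forall w, test_function Omega w ->
      inner Omega u (partial i w) = - inner Omega (g i) w.

Definition H1 Omega u : Prop :=
  L2 Omega u /\ exists g, weak_gradient Omega u g.

(* A representative of the weak gradient, which is unique up to a.e. equality
   on Omega; it is only meaningful on Omega, and for u in H1 Omega. *)
Definition grad Omega u : 'I_d -> 'rV[R]_d -> R :=
  xget (fun _ _ => 0) [set g | weak_gradient Omega u g].

Definition H1_sqnorm Omega u : R :=
  inner Omega u u + innerv Omega (grad Omega u) (grad Omega u).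

Definition box a b : set 'rV[R]_d :=
  [set x | forall i, a 0 i < x 0 i < b 0 i].

Definition periodic a b u : Prop :=
  forall i x, u (x + (b 0 i - a 0 i) *: delta_mx 0 i) = u x.

(* The closure in H1 (box a b) of the smooth periodic functions on R^d. *)
Definition H1_periodic a b u : Prop :=
  H1 (box a b) u /\
  forall e : R, 0 < e -> exists w,
    [/\ smooth w, periodic a b w & H1_sqnorm (box a b) (u \- w) < e].

End sobolev.

(* Near each boundary point, in suitable orthonormal coordinates, Omega is the
   set of points lying strictly above the graph of a Lipschitz function of the
   first n coordinates. *)
Definition lipschitz_boundary {R : realType} {n : nat}
    (Omega : set 'rV[R]_n.+1) : Prop :=
  forall x, (closure Omega `\` Omega°) x ->
  exists (Q : 'M[R]_n.+1) (gamma : 'rV[R]_n -> R),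
    [/\ Q *m Q^T = 1%:M, lipschitz gamma
      & \forall y \near x,
          Omega y <-> gamma (col' ord_max (y *m Q)) < (y *m Q) 0 ord_max].

Definition lipschitz_domain {R : realType} {n : nat}
    (Omega : set 'rV[R]_n.+1) : Prop :=
  [/\ Omega !=set0, open Omega, connected Omega, bounded_set Omega
    & lipschitz_boundary Omega].

Variant bc_domain (R : realType) (n : nat) :=
  | Neumann of set 'rV[R]_n.+1
  | Periodic of 'rV[R]_n.+1 & 'rV[R]_n.+1.

Section spaces.
Context {R : realType} {n : nat} (D : bc_domain R n).

Definition dom : set 'rV[R]_n.+1 :=
  match D with Neumann Omega => Omega | Periodic a b => box a b end.

Definition admissible : Prop :=
  match D with
  | Neumann Omega => lipschitz_domain Omega
  | Periodic a b => forall i, a 0 i < b 0 i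
  end.

Definition V (u : 'rV[R]_n.+1 -> R) : Prop :=
  match D with
  | Neumann Omega => H1 Omega u
  | Periodic a b => H1_periodic a b u
  end.

Definition V0 (u : 'rV[R]_n.+1 -> R) : Prop := V u /\ mean_zero dom u.

End spaces.

Section constitutive.
Context {R : realType} (theta sigma B : R).

Definition mobility (x : R) : R :=
  if 0 <= x <= 1 then (1 - (1 - sigma) * (2 * x - 1) ^+ 2) / 4
  else sigma / 8
    * (1 + expR (- (2 * (1 - sigma) * ((2 * x - 1) ^+ 2 - 1)) / sigma)).

Definition potential (x : R) : R :=
  (if 1 - sigma <= x then
     x * ln x + (1 - x) ^+ 2 / (2 * sigma) + (1 - x) * ln sigma - sigma / 2
   else if sigma <= x then
     x * ln x + (1 - x) * ln (1 - x)
   else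
     (1 - x) * ln (1 - x) + x ^+ 2 / (2 * sigma) + x * ln sigma - sigma / 2)
  + theta * (x - x ^+ 2).

Definition Hfun (x : R) : R :=
  derive1 potential x / Num.sqrt (potential x + B).

End constitutive.

Section scheme.
Context {R : realType} {n : nat} (D : bc_domain R n).
Variables (eps theta sigma B dt : R) (phin Un : 'rV[R]_n.+1 -> R).

Local Notation Omega := (dom D).

Definition Hn (x : 'rV[R]_n.+1) : R := Hfun theta sigma B (phin x).

Definition g1n (x : 'rV[R]_n.+1) : R :=
  Hn x * Un x - 2^-1 * (Hn x * Hn x * phin x).

Definition flux (v : 'rV[R]_n.+1 -> R) : 'I_n.+1 -> 'rV[R]_n.+1 -> R :=
  fun i x => mobility sigma (phin x) * grad Omega v i x.

(* The weak form of P_1 u = - eps^2 Lap u + (Hn Hn u) / 2: the boundary term is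
   dropped by the (natural) Neumann or the periodic boundary conditions. *)
Definition P1_form (u chi : 'rV[R]_n.+1 -> R) : R :=
  eps ^+ 2 * innerv Omega (grad Omega u) (grad Omega chi)
  + 2^-1 * inner Omega (Hn \* u) (Hn \* chi).

Definition weak_solution (phi mu : 'rV[R]_n.+1 -> R) : Prop :=
  [/\ V D phi, V D mu,
      forall chi, V D chi ->
        dt^-1 * inner Omega (phi \- phin) chi
        = - innerv Omega (flux mu) (grad Omega chi)
    & forall chi, V D chi ->
        inner Omega mu chi = P1_form phi chi + inner Omega g1n chi].

Definition is_inv_laplacian (u v : 'rV[R]_n.+1 -> R) : Prop :=
  V0 D v /\ forall chi, V D chi ->
    innerv Omega (flux v) (grad Omega chi) = - inner Omega u chi.

(* The mean-zero weak solution v of div (M(phin) grad v) = u; the default value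
   is only taken if there is none. *)
Definition inv_laplacian (u : 'rV[R]_n.+1 -> R) : 'rV[R]_n.+1 -> R :=
  xget (fun _ => 0) [set v | is_inv_laplacian u v].

(* For psi in V0, opA psi is an element of the dual of V0, and opA psi chi is
   the duality pairing written (A psi, chi). *)
Definition opA (psi chi : 'rV[R]_n.+1 -> R) : R :=
  - (dt^-1 * inner Omega (inv_laplacian psi) chi) + P1_form psi chi.

End scheme.

(* Main.v *)
Require Import Defs.
From mathcomp Require Import all_boot all_order all_algebra.
From mathcomp Require finmap.
From mathcomp Require Import all_classical all_reals all_analysis.
From mathcomp Require Import ring lra measurable_realfun.
Set Implicit Arguments.
Unset Strict Implicit.
Unset Printing Implicit Defensive.
Import Order.TTheory GRing.Theory Num.Theory.
Import numFieldNormedType.Exports.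
Local Open Scope classical_set_scope.
Local Open Scope ring_scope.

(** The forms of the scheme are symmetric, bounded in the H1 norm and, on the
    mean-zero space V0, bounded below by a positive multiple of the squared L2
    norm of the gradient. All the solutions are therefore Riesz representatives.

    Bounded coefficients. The mobility lies between sigma / 8 and 1 / 2
    (mobility_bounds). The function H is bounded although phin is not: the
    potential F has the upper quadratic remainder 2 t^2 / sigma at each point
    (potential_remainder), so the positivity of F + B at x + t for all t makes
    a quadratic polynomial in t positive and bounds f^2 by a multiple of F + B
    (Hfun_bounded). Hence the multiplication by H(phin) preserves L2, and the
    form of P_1 is bounded on H1.

    Coercivity. This is Poincare's inequality on a connected bounded domain
    (V0_poincare), and the core of the proof. If u has the weak gradient g and
    the segments from A in the direction e stay in Omega, then the L2 norm over
    A of u(. + e) - u is at most that of the derivative of u along e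
    (translation_estimate): paired with a test function w supported in A, the
    difference is the increment of the integral of u against the translates of
    w, whose derivative is controlled by the weak gradient; the fundamental
    lemma (du_bois_reymond) turns this into a norm estimate. Averaging over all
    translations gives the inequality on boxes (poincare_box). The inequality is
    inherited by a set that can be pushed into a good set by a translation
    inside Omega (poincare_translate), which applies near a boundary point since
    Omega lies there above a Lipschitz graph, and by the union of two
    overlapping good sets (poincare_setU). Compactness of the closure and
    connectedness then give it on all of Omega (poincare_of_local).

    Completeness. L2 is complete (L2_complete) and weak differentiation is a
    closed operation, so H1 is complete (H1_complete); V and V0 are closed in
    H1. So V0 is complete for each form that is comparable to the H1 norm
    (V0_complete), and riesz_representation applies to it.

    Conclusion. With the form (M grad u, grad v) one obtains the inverse
    Laplacian, which is symmetric and nonpositive, and so A is symmetric, with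
    (A psi, psi) >= eps^2 |grad psi|^2, hence definite by Poincare's inequality.
    Testing the first equation with 1 shows that phi^{n+1} has the mean m of
    phin, so phi^{n+1} = m + psi, where psi in V0 solves A psi = b; from it, mu
    is dt^-1 times the inverse Laplacian of phi^{n+1} - phin, up to a constant
    that is fixed by testing the second equation with 1
    (weak_solution_exists). For uniqueness, the differences p and q of two
    solutions satisfy P_1(p, p) + dt (M grad q, grad q) = 0, which forces p = 0,
    and then q = 0 by the second equation (weak_solution_unique). *)

(** * Nonnegative forms and the Riesz representation theorem *)

Section forms.
Context {R : realType} {X : lmodType R}.
Implicit Types (S : X -> Prop) (a : X -> X -> R) (x y z : X).

Definition subspace S : Prop :=
  S 0 /\ forall (c : R) x y, S x -> S y -> S (c *: x + y).

(** The forms live on function spaces where functions that agree almost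
    everywhere are not identified, so a form may vanish on nonzero vectors;
    this is why definiteness is not part of the notion. *)
Definition psd_form S a : Prop :=
  [/\ forall x y, S x -> S y -> a x y = a y x,
      forall (c : R) x y z, S x -> S y -> S z ->
        a (c *: x + y) z = c * a x z + a y z
    & forall x, S x -> 0 <= a x x].

(** The geometric rate is met by a maximizing sequence in the proof of the
    Riesz representation theorem, and it makes the almost everywhere
    convergence in the Riesz-Fischer theorem a matter of summing a series,
    without extracting a subsequence. *)
Definition fast_cauchy a (u : nat -> X) : Prop :=
  exists C : R, forall i j, (i <= j)%N -> a (u j - u i) (u j - u i) <= C / 4 ^+ i.

Definition converges a (u : nat -> X) x : Prop :=
  forall e : R, 0 < e -> exists N, forall k, (N <= k)%N ->
    a (u k - x) (u k - x) < e.

Definition complete_form S a : Prop :=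
  forall u, (forall k, S (u k)) -> fast_cauchy a u ->
    exists2 x, S x & converges a u x.

Section basic.
Variables (S : X -> Prop) (a : X -> X -> R).
Hypotheses (hS : subspace S) (ha : psd_form S a).

Lemma subspaceD x y : S x -> S y -> S (x + y).
Proof. by move=> Sx Sy; have := hS.2 1 _ _ Sx Sy; rewrite scale1r. Qed.

Lemma subspaceZ c x : S x -> S (c *: x).
Proof. by move=> Sx; have := hS.2 c _ _ Sx hS.1; rewrite addr0. Qed.

Lemma subspaceB x y : S x -> S y -> S (x - y).
Proof.
by move=> Sx Sy; have := hS.2 (-1) _ _ Sy Sx; rewrite scaleN1r addrC.
Qed.

Lemma form0l z : S z -> a 0 z = 0.
Proof.
move=> Sz; case: ha => _ lin _; have := lin 1 0 0 z hS.1 hS.1 Sz.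
by rewrite scaler0 addr0 mul1r => h; lra.
Qed.

Lemma formDl x y z : S x -> S y -> S z -> a (x + y) z = a x z + a y z.
Proof.
by move=> Sx Sy Sz; case: ha => _ lin _; have := lin 1 _ _ _ Sx Sy Sz;
  rewrite scale1r mul1r.
Qed.

Lemma formZl c x z : S x -> S z -> a (c *: x) z = c * a x z.
Proof.
move=> Sx Sz; case: ha => _ lin _; have := lin c _ _ _ Sx hS.1 Sz.
by rewrite addr0 form0l// addr0.
Qed.

Lemma formBl x y z : S x -> S y -> S z -> a (x - y) z = a x z - a y z.
Proof.
move=> Sx Sy Sz; rewrite -scaleN1r formDl ?formZl ?mulN1r//.
exact: subspaceZ.
Qed.

Lemma formDr x y z : S x -> S y -> S z -> a z (x + y) = a z x + a z y.
Proof.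
move=> Sx Sy Sz; case: (ha) => sym _ _; rewrite sym ?formDl ?(sym z)//.
exact: subspaceD.
Qed.

Lemma formZr c x z : S x -> S z -> a z (c *: x) = c * a z x.
Proof.
move=> Sx Sz; case: (ha) => sym _ _; rewrite sym ?formZl ?(sym z)//.
exact: subspaceZ.
Qed.

Lemma formBr x y z : S x -> S y -> S z -> a z (x - y) = a z x - a z y.
Proof.
move=> Sx Sy Sz; case: (ha) => sym _ _; rewrite sym ?formBl ?(sym z)//.
exact: subspaceB.
Qed.

Lemma form_sqrD t x y : S x -> S y ->
  a (x + t *: y) (x + t *: y) = a x x + 2 * t * a x y + t ^+ 2 * a y y.
Proof.
move=> Sx Sy; have Sty := subspaceZ t Sy; have SD := subspaceD Sx Sty.
case: (ha) => sym _ _; rewrite formDl// !formDr// !(formZl, formZr)//.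
by rewrite (sym y x)//; ring.
Qed.

(** The discriminant of the nonnegative polynomial t |-> a (x + t y) (x + t
    y); when a y y = 0 this polynomial is affine and has to be constant. *)
Lemma form_cauchy_schwarz x y : S x -> S y -> a x y ^+ 2 <= a x x * a y y.
Proof.
move=> Sx Sy; case: (ha) => sym lin pos.
have key t : 0 <= a x x + 2 * t * a x y + t ^+ 2 * a y y.
  by rewrite -form_sqrD//; apply/pos/subspaceD => //; apply: subspaceZ.
have xx := pos _ Sx; have [yy0|yy0] := eqVneq (a y y) 0.
  rewrite yy0 mulr0; move: key; rewrite yy0 => key.
  have [->|xy0] := eqVneq (a x y) 0; first by rewrite expr0n.
  (* at this t the affine polynomial takes the value -1 *)
  have := key (- (a x x + 1) / (2 * a x y)).
  rewrite mulr0 addr0.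
  have -> : 2 * (- (a x x + 1) / (2 * a x y)) * a x y = - (a x x + 1) by field.
  by move=> ?; exfalso; lra.
have yyp : 0 < a y y by rewrite lt_def yy0 pos.
have := key (- a x y / a y y).
have -> : a x x + 2 * (- a x y / a y y) * a x y + (- a x y / a y y) ^+ 2 * a y y
  = (a x x * a y y - a x y ^+ 2) / a y y by field.
by rewrite pmulr_lge0 ?invr_gt0// subr_ge0.
Qed.

Lemma form_sqrD_le x y : S x -> S y ->
  a (x + y) (x + y) <= 2 * a x x + 2 * a y y.
Proof.
move=> Sx Sy; case: (ha) => sym lin pos.
have := form_sqrD 1 Sx Sy; rewrite scale1r => ->.
have := pos _ (subspaceD Sx (subspaceZ (-1) Sy)).
by rewrite form_sqrD// => ?; lra.
Qed.

Lemma form_sqrB_le x y : S x -> S y ->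
  a (x - y) (x - y) <= 2 * a x x + 2 * a y y.
Proof.
move=> Sx Sy; have := form_sqrD_le Sx (subspaceZ (-1) Sy).
by rewrite scaleN1r => h; move: h; rewrite -scaleN1r !(formZl,formZr)//;
  [lra| exact: subspaceZ].
Qed.

End basic.

Lemma geometric_lt (C e : R) : 0 <= C -> 0 < e ->
  exists N, forall k, (N <= k)%N -> C / 4 ^+ k < e.
Proof.
move=> C0 e0.
exists (Num.truncn (C / e)).+1 => k Nk.
rewrite ltr_pdivrMr ?exprn_gt0// mulrC -ltr_pdivrMr//.
apply: lt_le_trans (truncnS_gt _) _.
apply: (@le_trans _ _ k%:R); first by rewrite ler_nat.
elim: k {Nk} => [|k IH]; first by rewrite expr0.
rewrite exprS -natr1; have : (1 : R) <= 4 ^+ k by rewrite exprn_ege1// ler1n.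
by lra.
Qed.

Lemma le0_of_small (x K : R) : (forall e : R, 0 < e -> x <= K * e) -> x <= 0.
Proof.
move=> h; rewrite leNgt; apply/negP => x0.
have K0 : 0 < `|K| + 1 by have := normr_ge0 K; lra.
have e0 : 0 < x / (2 * (`|K| + 1)) by rewrite divr_gt0// mulr_gt0.
have := h _ e0.
have -> : K * (x / (2 * (`|K| + 1))) = K / (`|K| + 1) * (x / 2).
  by field; rewrite gt_eqF//.
have : K / (`|K| + 1) <= 1.
  by rewrite ler_pdivrMr// mul1r; have := ler_norm K; lra.
by nra.
Qed.

(** The representative is a maximizer of the concave functional q x = 2 l x
    - a x x, which is bounded above by C. By the parallelogram law, two
    points where q is within delta of its supremum are within a multiple of
    delta of each other for a, so a maximizing sequence converges; at the
    limit, comparing q at u k and at u k + t x for the best t gives the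
    first-order condition l x = a v x. No quotient by the null vectors of a
    is formed. *)
Theorem riesz_representation S a (l : X -> R) (C : R) :
  subspace S -> psd_form S a -> complete_form S a ->
  (forall (c : R) x y, S x -> S y -> l (c *: x + y) = c * l x + l y) ->
  (forall x, S x -> l x ^+ 2 <= C * a x x) ->
  exists2 v, S v & forall x, S x -> a v x = l x.
Proof.
move=> hS ha compl llin lbnd; case: (ha) => sym lin pos.
wlog C0 : C lbnd / 0 <= C.
  move=> H; apply: (H `|C|) => // x Sx; apply: le_trans (lbnd _ Sx) _.
  by rewrite ler_wpM2r ?pos// ler_norm.
have lD x y : S x -> S y -> l (x + y) = l x + l y.
  by move=> Sx Sy; have := llin 1 _ _ Sx Sy; rewrite scale1r mul1r.
have l0 : l 0 = 0.
  by have := lD _ _ hS.1 hS.1; rewrite addr0; lra.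
have lZ c x : S x -> l (c *: x) = c * l x.
  by move=> Sx; have := llin c _ _ Sx hS.1; rewrite addr0 l0 addr0.
pose q x := 2 * l x - a x x.
have qub x : S x -> q x <= C.
  move=> Sx; have := lbnd _ Sx; have := pos _ Sx; rewrite /q => ax lx.
  rewrite leNgt; apply/negP => h.
  have : 0 <= (C - a x x) ^+ 2 by apply: sqr_ge0.
  have : (C + a x x) ^+ 2 < (2 * l x) ^+ 2.
    by rewrite ltr_pXn2r// ?nnegrE; lra.
  by nra.
pose T := [set q x | x in S].
have hT : has_sup T.
  split; first by exists (q 0), 0 => //; exact: hS.1.
  by exists C => _ [x Sx <-]; exact: qub.
have qs x : S x -> q x <= sup T.
  by move=> Sx; apply: ub_le_sup; [case: hT|exists x].
pose delta k : R := (4 ^+ k)^-1.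
have delta0 k : 0 < delta k by rewrite invr_gt0 exprn_gt0.
have /choice[u hu] k : exists x, S x /\ sup T - delta k < q x.
  by have [_ [x Sx <-] ?] := sup_adherent (delta0 k) hT; exists x.
have Su k : S (u k) by case: (hu k).
have [|v Sv uv] := compl u Su.
  exists 4 => i j ij; set x := u i; set y := u j.
  have Sx : S x := Su _; have Sy : S y := Su _.
  have [_ qx] := hu i; have [_ qy] := hu j.
  have dij : delta j <= delta i.
    by rewrite lef_pV2 ?posrE ?exprn_gt0// ler_weXn2l// ler1n.
  have := qs _ (subspaceZ hS 2^-1 (subspaceD hS Sx Sy)).
  rewrite /q lZ ?lD//; last exact: (subspaceD hS).
  have Sxy := subspaceD hS Sx Sy; have Sxy2 := subspaceZ hS 2^-1 Sxy.
  rewrite !(formZl hS ha, formZr hS ha)//.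
  have := form_sqrD hS ha 1 Sx Sy; rewrite scale1r => ->.
  have := form_sqrD hS ha (-1) Sy Sx; rewrite scaleN1r => ->.
  rewrite (sym y x)//; move: qx qy; rewrite /q -/x -/y -/(delta i).
  by lra.
exists v => // x Sx; apply/eqP; rewrite eq_sym -subr_eq0 -sqrf_eq0 eq_le sqr_ge0
  andbT.
pose A := a x x; have A0 : 0 <= A := pos _ Sx.
apply: (@le0_of_small _ (2 * (A + 1) + 2 * A)) => e e0.
have [N hN] := uv _ e0; have [M hM] := geometric_lt ler01 e0.
pose k := maxn N M.
have hk : a (u k - v) (u k - v) < e by apply: hN; rewrite leq_maxl.
have dk : delta k < e by rewrite /delta -div1r; apply: hM; rewrite leq_maxr.
have Sk : S (u k) := Su k.
pose r := l x - a (u k) x.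
have r1 : r ^+ 2 <= delta k * (A + 1).
  (* the optimal t would be r / A; the shift by 1 makes it meaningful when A
     = 0 *)
  pose t := r / (A + 1).
  have := qs _ (subspaceD hS Sk (subspaceZ hS t Sx)).
  rewrite /q lD ?lZ ?(form_sqrD hS ha)//; last exact: (subspaceZ hS).
  have [_] := hu k; rewrite /q => h1 h2.
  have : 2 * t * r - t ^+ 2 * A <= delta k by rewrite /r /A; lra.
  have -> : 2 * t * r - t ^+ 2 * A = r ^+ 2 * ((A + 2) / (A + 1) ^+ 2).
    by rewrite /t; field; rewrite gt_eqF//; lra.
  move=> h; rewrite -ler_pdivrMr; last lra.
  apply: le_trans h; rewrite ler_wpM2l ?sqr_ge0//.
  rewrite ler_pdivlMr ?exprn_gt0//; last lra.
  by rewrite expr2 mulrA mulVf ?gt_eqF//; lra.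
have r2 : a (u k - v) x ^+ 2 <= e * A.
  apply: le_trans (form_cauchy_schwarz hS ha (subspaceB hS Sk Sv) Sx) _.
  by rewrite ler_wpM2r// ltW.
have -> : l x - a v x = r + a (u k - v) x by rewrite /r (formBl hS ha)//; ring.
have : 0 <= (r - a (u k - v) x) ^+ 2 by exact: sqr_ge0.
have : delta k * (A + 1) <= e * (A + 1) by rewrite ler_wpM2r// ?ltW//; lra.
by nra.
Qed.

End forms.

Section form_constructions.
Context {R : realType} {X : lmodType R}.
Implicit Types (S W : X -> Prop) (a b : X -> X -> R) (x y z : X).

Lemma psd_formD S a b : psd_form S a -> psd_form S b ->
  psd_form S (fun x y => a x y + b x y).
Proof.
move=> [as_ al ap] [bs bl bp]; split.
- by move=> x y Sx Sy; rewrite (as_ x y)// (bs x y).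
- by move=> c x y z Sx Sy Sz; rewrite al ?bl//; ring.
- by move=> x Sx; rewrite addr_ge0 ?ap ?bp.
Qed.

Lemma psd_formZ S a (k : R) : 0 <= k -> psd_form S a ->
  psd_form S (fun x y => k * a x y).
Proof.
move=> k0 [as_ al ap]; split.
- by move=> x y Sx Sy; rewrite as_.
- by move=> c x y z Sx Sy Sz; rewrite al//; ring.
- by move=> x Sx; rewrite mulr_ge0 ?ap.
Qed.

Lemma psd_form_sub S W a : (forall x, W x -> S x) -> psd_form S a -> psd_form W a.
Proof.
move=> WS [as_ al ap]; split.
- by move=> x y /WS Sx /WS Sy; exact: as_.
- by move=> c x y z /WS Sx /WS Sy /WS Sz; exact: al.
- by move=> x /WS; exact: ap.
Qed.

Definition form_closure S W a x : Prop :=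
  S x /\ forall e : R, 0 < e -> exists2 w, W w & a (x - w) (x - w) < e.

Section closure.
Variables (S W : X -> Prop) (a : X -> X -> R).
Hypotheses (hS : subspace S) (ha : psd_form S a) (hW : subspace W)
  (WS : forall x, W x -> S x).

Lemma form_closureW x : W x -> form_closure S W a x.
Proof.
move=> Wx; split=> [|e e0]; first exact: WS.
by exists x => //; rewrite subrr (form0l hS ha)//; exact: hS.1.
Qed.

Lemma form_closure_subspace : subspace (form_closure S W a).
Proof.
split; first exact: form_closureW hW.1.
move=> c p q [Sp hp] [Sq hq]; split; first exact: hS.2.
move=> e e0.
have c0 : 0 < 4 * (c ^+ 2 + 1) by rewrite mulr_gt0// ltr_wpDl// sqr_ge0.
have [w Ww hw] := hp (e / (4 * (c ^+ 2 + 1))) (divr_gt0 e0 c0).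
have [w' Ww' hw'] := hq (e / 4) (divr_gt0 e0 (ltr0n _ 4)).
exists (c *: w + w'); first exact: hW.2.
have S1 := subspaceB hS Sp (WS Ww); have S2 := subspaceB hS Sq (WS Ww').
rewrite (_ : c *: p + q - (c *: w + w') = c *: (p - w) + (q - w')); last first.
  by rewrite scalerBr opprD addrACA.
apply: le_lt_trans (form_sqrD_le hS ha (subspaceZ hS c S1) S2) _.
rewrite (formZl hS ha) ?(formZr hS ha)//; last exact: (subspaceZ hS).
move: hw; rewrite ltr_pdivlMr//.
have := sqr_ge0 c; have : 0 <= a (p - w) (p - w) by case: ha => _ _; apply.
by move=> *; lra.
Qed.

(** A diagonal argument: an approximation of u N by W also approximates x. *)
Lemma form_closure_closed u x : (forall k, form_closure S W a (u k)) -> S x ->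
  converges a u x -> form_closure S W a x.
Proof.
move=> Su Sx ux; split => // e e0; have e4 := divr_gt0 e0 (ltr0n _ 4).
have [N /(_ N (leqnn N)) hN] := ux _ e4.
have [SN /(_ _ e4)[w Ww hw]] := Su N.
exists w => //.
rewrite (_ : x - w = (u N - w) - (u N - x)); last first.
  by rewrite opprB [RHS]addrC addrA subrK.
have S1 := subspaceB hS SN (WS Ww); have S2 := subspaceB hS SN Sx.
by apply: le_lt_trans (form_sqrB_le hS ha S1 S2) _; lra.
Qed.

End closure.

(** Only vectors of the smaller space W have to satisfy the comparison of
    the two forms; this is what lets a form that is coercive on mean-zero
    functions alone be complete there. *)
Lemma complete_of_equiv S W a b (c1 c2 : R) : subspace W ->
  (forall x, W x -> S x) ->
  psd_form S a -> complete_form S a ->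
  (forall u x, (forall k, W (u k)) -> S x -> converges a u x -> W x) ->
  0 <= c1 -> 0 <= c2 ->
  (forall x, W x -> a x x <= c1 * b x x) ->
    (forall x, W x -> b x x <= c2 * a x x) ->
  complete_form W b.
Proof.
move=> hW WS ha ca clW c10 c20 ab ba u Wu [C hC].
have [|x Sx ux] := ca u (fun k => WS _ (Wu k)).
  exists (c1 * C) => i j ij; have WB := subspaceB hW (Wu j) (Wu i).
  by apply: le_trans (ab _ WB) _; rewrite -mulrA ler_wpM2l// hC.
have Wx := clW u x Wu Sx ux.
exists x => // e e0.
have e1 : 0 < e / (c2 + 1) by rewrite divr_gt0//; lra.
have [N hN] := ux _ e1; exists N => k Nk.
have WB := subspaceB hW (Wu k) Wx.
apply: le_lt_trans (ba _ WB) _; have := hN k Nk; rewrite ltr_pdivlMr; last lra.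
have : 0 <= a (u k - x) (u k - x) by case: ha => _ _; apply; exact: WS.
by move=> ? ?; lra.
Qed.

End form_constructions.

Section form_sums.
Context {R : realType} {X : lmodType R} (S : X -> Prop) (a : X -> X -> R).
Hypotheses (hS : subspace S) (ha : psd_form S a).

Lemma subspace_sum (I : Type) (r : seq I) (x : I -> X) :
  (forall i, S (x i)) -> S (\sum_(i <- r) x i).
Proof.
move=> Sx; elim: r => [|i r IH]; first by rewrite big_nil; exact: hS.1.
by rewrite big_cons; exact: subspaceD.
Qed.

Lemma form_suml (I : Type) (r : seq I) (x : I -> X) y : (forall i, S (x i)) ->
  S y ->
  a (\sum_(i <- r) x i) y = \sum_(i <- r) a (x i) y.
Proof.
move=> Sx Sy; elim: r => [|i r IH]; first by rewrite !big_nil;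
  exact: (form0l hS ha).
by rewrite !big_cons (formDl ha) ?IH//; exact: subspace_sum.
Qed.

Lemma form_sumr (I : Type) (r : seq I) (x : I -> X) y : (forall i, S (x i)) ->
  S y ->
  a y (\sum_(i <- r) x i) = \sum_(i <- r) a y (x i).
Proof.
move=> Sx Sy; case: (ha) => sym _ _; rewrite sym//; last exact: subspace_sum.
by rewrite form_suml//; apply: eq_bigr => i _; exact: sym.
Qed.

(** A crude constant, obtained by adding the terms one by one. *)
Lemma form_sqr_sum_le (I : Type) (r : seq I) (x : I -> X) : (forall i, S (x i)) ->
  a (\sum_(i <- r) x i) (\sum_(i <- r) x i) <= 2 ^+ size r * \sum_(i <- r) a
    (x i) (x i).
Proof.
move=> Sx; case: (ha) => _ _ pos; elim: r => [|i r IH].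
  by rewrite !big_nil (form0l hS ha) ?mulr0//; exact: hS.1.
rewrite !big_cons; apply: le_trans
  (form_sqrD_le hS ha (Sx i) (subspace_sum r Sx)) _.
rewrite /= exprS; have e1 : 1 <= 2 ^+ size r :> R by rewrite exprn_ege1// ler1n.
have h1 : a (x i) (x i) <= 2 ^+ size r * a (x i) (x i) by rewrite ler_peMl// pos.
rewrite -mulrA [2 ^+ size r * (_ + _)]mulrDr.
by move: IH h1; lra.
Qed.

End form_sums.

(** * Bounds on the potential and the mobility *)

Section constitutive_bounds.
Context {R : realType}.
Implicit Types (sigma x y : R).

(** The regularization of x ln x below sigma by its second-order Taylor
    polynomial at sigma. Up to theta (x - x^2), the three branches of the
    potential are the sums of the values of this function at x and at 1 - x. *)
Definition entropy sigma x : R :=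
  if sigma <= x then x * ln x else x ^+ 2 / (2 * sigma) + x * ln sigma - sigma / 2.

Definition dentropy sigma x : R :=
  if sigma <= x then ln x + 1 else x / sigma + ln sigma.

(** Concavity of the logarithm: its graph is below the tangent at x. *)
Lemma ln_sub_le x y : 0 < x -> 0 < y -> ln y - ln x <= (y - x) / x.
Proof.
move=> x0 y0; rewrite -ln_div ?posrE//.
have -> : y / x = 1 + (y - x) / x by field; rewrite gt_eqF.
apply: le_ln1Dx; have -> : (y - x) / x = y / x - 1 by field; rewrite gt_eqF.
have : 0 < y / x by rewrite divr_gt0.
by lra.
Qed.

(** The regularized entropy is convex with a derivative that is Lipschitz
    with a constant of order 1 / sigma. The four cases place x and y on
    either side of sigma; in the mixed ones the remainder is split at sigma. *)
Lemma entropy_tangent_remainder sigma x y : 0 < sigma ->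
  0 <= entropy sigma y - entropy sigma x - dentropy sigma x * (y - x)
    <= (y - x) ^+ 2 / sigma.
Proof.
move=> s0; have iv0 : 0 < sigma^-1 by rewrite invr_gt0.
have up u v : sigma <= u -> sigma <= v ->
    0 <= v * ln v - u * ln u - (ln u + 1) * (v - u) <= (v - u) ^+ 2 / sigma.
  move=> su sv; have u0 : 0 < u by lra.
  have v0 : 0 < v by lra.
  have h1 := ln_sub_le u0 v0; have h2 := ln_sub_le v0 u0.
  apply/andP; split.
    have : v * (ln u - ln v) <= v * ((u - v) / v) by rewrite ler_wpM2l// ltW.
    by rewrite [v * (_ / _)]mulrC divfK ?gt_eqF//; lra.
  have : v * (ln v - ln u) <= v * ((v - u) / u) by rewrite ler_wpM2l// ltW.
  have -> : v * ((v - u) / u) = (v - u) + (v - u) ^+ 2 / u by field; rewrite gt_eqF.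
  have : (v - u) ^+ 2 / u <= (v - u) ^+ 2 / sigma.
    by rewrite ler_wpM2l ?sqr_ge0// lef_pV2.
  by lra.
have lns u : sigma <= u -> 0 <= ln u - ln sigma <= (u - sigma) / sigma.
  move=> su; have u0 : 0 < u by lra.
  by rewrite ln_sub_le// andbT subr_ge0 ler_ln.
have ssig : sigma * ln sigma = sigma ^+ 2 / (2 * sigma) + sigma * ln sigma -
  sigma / 2.
  by field; rewrite gt_eqF.
set i := sigma^-1; have i0 : 0 <= i by rewrite ltW.
rewrite /entropy /dentropy; case: (lerP sigma x) => sx; case: (lerP sigma y) => sy.
- exact: up.
- have /andP[u1 u2] := up _ _ sx (lexx sigma).
  have /andP[l1 l2] := lns _ sx.
  have -> : y ^+ 2 / (2 * sigma) + y * ln sigma - sigma / 2 - x * ln x -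
    (ln x + 1) * (y - x)
     = (sigma * ln sigma - x * ln x - (ln x + 1) * (sigma - x))
       + (ln x - ln sigma) * (sigma - y) + (y - sigma) ^+ 2 * i / 2.
    by rewrite /i; field; rewrite gt_eqF.
  have p1 : 0 <= (y - sigma) ^+ 2 * i by rewrite mulr_ge0 ?sqr_ge0.
  have p2 : 0 <= (ln x - ln sigma) * (sigma - y) by rewrite mulr_ge0//; lra.
  have p3 : (ln x - ln sigma) * (sigma - y) <= (x - sigma) * i * (sigma - y).
    by rewrite ler_wpM2r//; lra.
  have p4 : 0 <= (x - sigma) * i * (sigma - y).
    by rewrite mulr_ge0 ?mulr_ge0//; lra.
  apply/andP; split; first by lra.
  move: u2; rewrite -/i.
  by nra.
- have /andP[u1 u2] := up _ _ (lexx sigma) sy.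
  have -> : y * ln y - (x ^+ 2 / (2 * sigma) + x * ln sigma - sigma / 2) -
    (x / sigma + ln sigma) * (y - x)
     = (y * ln y - sigma * ln sigma - (ln sigma + 1) * (y - sigma))
       + (y - sigma) * (sigma - x) * i + (sigma - x) ^+ 2 * i / 2.
    by rewrite /i; field; rewrite gt_eqF.
  have p1 : 0 <= (sigma - x) ^+ 2 * i by rewrite mulr_ge0 ?sqr_ge0.
  have p2 : 0 <= (y - sigma) * (sigma - x) * i by rewrite mulr_ge0 ?mulr_ge0//; lra.
  apply/andP; split; first by lra.
  move: u2; rewrite -/i; by nra.
- have -> : y ^+ 2 / (2 * sigma) + y * ln sigma - sigma / 2 -
    (x ^+ 2 / (2 * sigma) + x * ln sigma - sigma / 2)
    - (x / sigma + ln sigma) * (y - x) = (y - x) ^+ 2 * i / 2.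
    by rewrite /i; field; rewrite gt_eqF.
  have p1 : 0 <= (y - x) ^+ 2 * i by rewrite mulr_ge0 ?sqr_ge0.
  by apply/andP; split; lra.
Qed.

(** A quadratic remainder estimate determines the derivative; used to
    differentiate functions defined by cases without looking at the
    one-sided limits. *)
Lemma is_derive_of_quadratic_remainder (F : R -> R) (x f K : R) :
  0 <= K -> (forall t, `|F (x + t) - F x - f * t| <= K * t ^+ 2) ->
  is_derive x (1 : R) F f.
Proof.
move=> K0 h.
have cF : (fun t : R => t^-1 *: ((F \o shift x) (t *: (1 : R)) - F x)) @ 0^' --> f.
  apply/cvgrPdist_le => e e0; near=> t.
  have t0 : t != 0 by near: t; exact: nbhs_dnbhs_neq.
  have -> : f - t^-1 *: ((F \o shift x) (t *: (1 : R)) - F x)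
      = - (t^-1 * (F (x + t) - F x - f * t)).
    by rewrite /GRing.scale/= mulr1 (addrC t x); field.
  have nt : 0 < `|t| by rewrite normr_gt0.
  rewrite normrN normrM normfV mulrC ler_pdivrMr//.
  apply: le_trans (h t) _; rewrite -normr_id -real_normK ?num_real// normr_id
    expr2 mulrA.
  rewrite ler_wpM2r ?ltW//.
  have : `|t| < e / (K + 1).
    near: t; apply/nbhs_dnbhs.
    have := @nbhs0_lt _ R^o (e / (K + 1)).
    by apply; rewrite divr_gt0//; lra.
  rewrite ltr_pdivlMr; last lra.
  by rewrite mulrDr mulr1 mulrC => ?; lra.
by apply: DeriveDef; [apply: cvgP cF|exact: cvg_lim cF].
Unshelve. all: by end_near.
Qed.

Definition dpotential theta sigma x : R :=
  dentropy sigma x - dentropy sigma (1 - x) + theta * (1 - 2 * x).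

Lemma potentialE theta sigma x : 0 < sigma < 2^-1 ->
  potential theta sigma x
  = entropy sigma x + entropy sigma (1 - x) + theta * (x - x ^+ 2).
Proof.
move=> /andP[s0 s1]; rewrite /potential /entropy.
have s2 : sigma < 1 / 2 by rewrite div1r.
case: (lerP (1 - sigma) x) => h1.
  rewrite (_ : sigma <= x); last by lra.
  case: (lerP sigma (1 - x)) => h2; last by rewrite !addrA.
  have -> : x = 1 - sigma by lra.
  have -> : 1 - (1 - sigma) = sigma by ring.
  by congr (_ + _); field; rewrite gt_eqF.
case: (lerP sigma x) => h2; first by rewrite ifT//; lra.
by rewrite ifT; lra.
Qed.

(** The two entropies contribute the convex part, with an upper bound t^2 /
    sigma each, and the concave quadratic contributes - theta t^2. *)
Lemma potential_remainder theta sigma x t : 0 < sigma < 2^-1 -> 0 < theta ->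
  - theta * t ^+ 2
  <= potential theta sigma (x + t) - potential theta sigma x - dpotential theta
    sigma x * t
  <= 2 / sigma * t ^+ 2.
Proof.
move=> hs th; have /andP[s0 s1] := hs; rewrite !potentialE//.
have /andP[] := entropy_tangent_remainder x (x + t) s0.
have /andP[] := entropy_tangent_remainder (1 - x) (1 - (x + t)) s0.
have -> : 1 - (x + t) - (1 - x) = - t by ring.
have -> : x + t - x = t by ring.
rewrite sqrrN /dpotential => a1 a2 a3 a4.
have : 0 <= theta * t ^+ 2 by rewrite mulr_ge0 ?sqr_ge0// ltW.
by move: a1 a2 a3 a4; nra.
Qed.

Lemma derive1_potential theta sigma x : 0 < sigma < 2^-1 -> 0 < theta ->
  derive1 (potential theta sigma) x = dpotential theta sigma x.
Proof.
move=> hs th; have /andP[s0 s1] := hs.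
have p : 0 < 2 / sigma by rewrite divr_gt0.
rewrite derive1E; suff h : is_derive x (1 : R) (potential theta sigma)
  (dpotential theta sigma x).
  exact: derive_val.
apply: (@is_derive_of_quadratic_remainder _ _ _ (2 / sigma + theta)) => [|t].
  by lra.
have /andP[h1 h2] := potential_remainder x t hs th.
have h3 := sqr_ge0 t; have h4 : 0 <= theta * t ^+ 2 by rewrite mulr_ge0// ltW.
have h5 : 0 <= 2 / sigma * t ^+ 2 by rewrite mulr_ge0// ltW.
by rewrite ler_norml; apply/andP; split; lra.
Qed.

(** For G = F + B > 0 and f = F', the upper quadratic remainder gives 0 < G
    x + f t + 2 t^2 / sigma for every t. Taking the minimizer of the right
    side in t bounds f^2 / G, which is H^2. *)
Lemma Hfun_bounded theta sigma B x : 0 < sigma < 2^-1 -> 0 < theta ->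
  (forall y, 0 < potential theta sigma y + B) ->
  Hfun theta sigma B x ^+ 2 <= 8 / sigma.
Proof.
move=> hs th hB; have /andP[s0 s1] := hs; rewrite /Hfun derive1_potential//.
have Gx : 0 <= potential theta sigma x + B by rewrite ltW.
rewrite exprMn exprVn sqr_sqrtr// ler_pdivrMr//.
set f := dpotential _ _ _; set G := potential _ _ x + B.
(* the minimizer of f t + 2 t^2 / sigma *)
pose t := - f * sigma / 4.
have /andP[_] := potential_remainder x t hs th; rewrite -/f => h.
have h2 := hB (x + t).
have : 0 < G + (f * t + 2 / sigma * t ^+ 2) by rewrite /G; lra.
have -> : f * t + 2 / sigma * t ^+ 2 = - (f ^+ 2 * sigma / 8).
  by rewrite /t; field; rewrite gt_eqF.
move=> h3; rewrite mulrAC ler_pdivlMr//; lra.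
Qed.

(** On [0, 1] the square (2 x - 1)^2 is at most 1; outside it is at least 1,
    so that the exponential lies in (0, 1]. *)
Lemma mobility_bounds sigma x : 0 < sigma < 2^-1 ->
  sigma / 8 <= mobility sigma x <= 2^-1.
Proof.
move=> /andP[s0 s1]; rewrite /mobility.
have s2 : sigma < 1 / 2 by rewrite div1r.
case: ifP => [/andP[x0 x1]|/negP hx].
  have h1 : (2 * x - 1) ^+ 2 <= 1 by nra.
  have h2 := sqr_ge0 (2 * x - 1).
  by apply/andP; split; nra.
have h1 : 1 <= (2 * x - 1) ^+ 2.
  case: (lerP 0 x) => x0; last by nra.
  case: (lerP x 1) => x1; last by nra.
  by exfalso; apply: hx; rewrite x0.
set E := expR _; have E0 : 0 < E := expR_gt0 _.
have E1 : E <= 1.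
  rewrite /E -[leRHS]expR0 ler_expR ler_pdivrMr// mul0r oppr_le0.
  by rewrite mulr_ge0//; nra.
by apply/andP; split; nra.
Qed.

Lemma measurable_entropy sigma : measurable_fun setT (entropy sigma).
Proof.
apply: measurable_fun_ifT; first exact: measurable_fun_ler.
  by apply: measurable_funM => //; exact: measurable_ln.
by apply: measurable_funB => //; apply: measurable_funD => //;
  apply: measurable_funM => //; exact: measurable_funX.
Qed.

Lemma measurable_dentropy sigma : measurable_fun setT (dentropy sigma).
Proof.
apply: measurable_fun_ifT; first exact: measurable_fun_ler.
  by apply: measurable_funD => //; exact: measurable_ln.
by apply: measurable_funD => //; exact: measurable_funM.
Qed.

Lemma measurable_comp1B (f : R -> R) : measurable_fun setT f ->
  measurable_fun setT (fun x => f (1 - x)).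
Proof. by move=> mf; apply: measurableT_comp => //; exact: measurable_funB. Qed.

Lemma measurable_potential theta sigma : 0 < sigma < 2^-1 ->
  measurable_fun setT (potential theta sigma).
Proof.
move=> hs; rewrite (_ : potential _ _ = fun x => entropy sigma x +
  entropy sigma (1 - x) + theta * (x - x ^+ 2)).
  apply: measurable_funD; last first.
    by apply: measurable_funM => //; apply: measurable_funB => //;
      exact: measurable_funX.
  by apply: measurable_funD; [|apply: measurable_comp1B]; exact: measurable_entropy.
by apply/funext => x; exact: potentialE.
Qed.

Lemma measurable_Hfun theta sigma B : 0 < sigma < 2^-1 -> 0 < theta ->
  measurable_fun setT (Hfun theta sigma B).
Proof.
move=> hs th; apply: measurable_funM.
  rewrite (_ : derive1 _ = dpotential theta sigma); last first.
    by apply/funext => x; exact: derive1_potential.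
  apply: measurable_funD; last by apply: measurable_funM => //;
    apply: measurable_funB => //; exact: measurable_funM.
  by apply: measurable_funB; [|apply: measurable_comp1B];
    exact: measurable_dentropy.
rewrite (_ : (fun _ => _) = fun x => Num.sqrt (potential theta sigma x + B) `^
  (-1)); last first.
  by apply/funext => x; rewrite powR_inv1// sqrtr_ge0.
apply: (measurableT_comp (measurable_powR _)).
apply: (measurableT_comp (f := @Num.sqrt R)).
  apply: nondecreasing_measurable => // x y xy; exact: ler_wsqrtr.
by apply: measurable_funD => //; exact: measurable_potential.
Qed.

Lemma measurable_mobility sigma : measurable_fun setT (mobility sigma).
Proof.
have m1 : measurable_fun setT (fun x : R => (2 * x - 1) ^+ 2).
  by apply: measurable_funX; apply: measurable_funB => //; exact: measurable_funM.
apply: measurable_fun_ifT.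
- by apply: measurable_and; exact: measurable_fun_ler.
- apply: measurable_funM => //; apply: measurable_funB => //.
  exact: measurable_funM.
- apply: measurable_funM => //; apply: measurable_funD => //.
  apply: measurableT_comp => //; apply: measurable_funM => //.
  apply: measurable_funN; apply: measurable_funM => //.
  exact: measurable_funB.
Qed.

End constitutive_bounds.

(** * Smooth functions *)

Section smoothness.
Context {R : realType} {d : nat}.
Implicit Types (u v w : 'rV[R]_d -> R) (e x a : 'rV[R]_d) (i j : 'I_d).

(** Coinduction: a class of differentiable functions that is stable under
    partial derivatives consists of smooth functions. *)
Lemma smooth_invariant (P : ('rV[R]_d -> R) -> Prop) :
  (forall u, P u -> forall x, differentiable u x) ->
  (forall u i, P u -> P (partial i u)) ->
  forall u, P u -> smooth u.
Proof.
move=> dP pP u Pu s x; apply: dP.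
by elim: s => //= i s IH; exact: pP.
Qed.

Lemma smooth_differentiable u x : smooth u -> differentiable u x.
Proof. by move/(_ [::]); apply. Qed.

Lemma smooth_derivable u x e : smooth u -> derivable u x e.
Proof. by move=> su; apply: diff_derivable; exact: smooth_differentiable. Qed.

Lemma smooth_continuous u : smooth u -> continuous u.
Proof. by move=> su x; exact/differentiable_continuous/smooth_differentiable. Qed.

Lemma smooth_partial i u : smooth u -> smooth (partial i u).
Proof. by move=> su s x; have := su (rcons s i) x; rewrite foldr_rcons. Qed.

Lemma partialD i u v : smooth u -> smooth v ->
  partial i (u \+ v) = partial i u \+ partial i v.
Proof. by move=> su sv; apply/funext => x; rewrite /partial deriveD//;
  exact: smooth_derivable. Qed.

Lemma partialM i u v : smooth u -> smooth v ->
  partial i (u \* v) = (u \* partial i v) \+ (v \* partial i u).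
Proof. by move=> su sv; apply/funext => x; rewrite /partial deriveM//;
  exact: smooth_derivable. Qed.

Lemma partial_cst i (c : R) : partial i (fun _ => c) = fun _ => 0.
Proof. by apply/funext => x; rewrite /partial derive_cst. Qed.

Lemma smooth_cst (c : R) : smooth (fun _ : 'rV[R]_d => c).
Proof.
apply: (@smooth_invariant (fun u => exists c, u = fun _ => c)); last by exists c.
  by move=> _ [{}c ->] x; exact: differentiable_cst.
by move=> _ i [{}c ->]; exists 0; rewrite partial_cst.
Qed.

Lemma smoothD u v : smooth u -> smooth v -> smooth (u \+ v).
Proof.
move=> su sv.
apply: (@smooth_invariant
  (fun w => exists u v, [/\ smooth u, smooth v & w = u \+ v])).
- move=> _ [u' [v' [su' sv' ->]]] x.
  by apply: differentiableD; exact: smooth_differentiable.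
- move=> _ i [u' [v' [su' sv' ->]]]; rewrite partialD//.
  by exists (partial i u'), (partial i v'); split => //; exact: smooth_partial.
- by exists u, v.
Qed.

(** The sums of products of smooth functions: by the Leibniz rule, this
    class is stable under partial derivatives. *)
Inductive smooth_products : ('rV[R]_d -> R) -> Prop :=
| smooth_products_mul u v of smooth u & smooth v : smooth_products (u \* v)
| smooth_products_add u v of smooth_products u & smooth_products v :
    smooth_products (u \+ v).

Lemma smoothM u v : smooth u -> smooth v -> smooth (u \* v).
Proof.
move=> su sv; apply: (@smooth_invariant smooth_products);
  last exact: smooth_products_mul.
  move=> w; elim=> [u' v' su' sv' x|u' v' _ du _ dv x].
    by apply: differentiableM; exact: smooth_differentiable.
  exact: differentiableD.
move=> w i pw; suff [] : smooth_products (partial i w) /\ forall x,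
  differentiable w x by [].
elim: pw => [u' v' su' sv'|u' v' _ [pu du] _ [pv dv]].
  split; last by move=> x; apply: differentiableM; exact: smooth_differentiable.
  rewrite partialM//.
  by apply: smooth_products_add; apply: smooth_products_mul => //;
    exact: smooth_partial.
split; last by move=> x; exact: differentiableD.
rewrite (_ : partial i _ = partial i u' \+ partial i v');
  first exact: smooth_products_add.
by apply/funext => x; rewrite /partial deriveD//; exact: diff_derivable.
Qed.

Lemma smoothZ (c : R) u : smooth u -> smooth (fun x => c * u x).
Proof. by move=> su; apply: (smoothM (smooth_cst c)). Qed.

Lemma smooth_sum (I : Type) (r : seq I) (F : I -> 'rV[R]_d -> R) :
  (forall k, smooth (F k)) -> smooth (fun x => \sum_(k <- r) F k x).
Proof.
move=> sF; elim: r => [|k r IH].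
  by rewrite (_ : (fun _ => _) = fun=> 0);
    [exact: smooth_cst|apply/funext => x; rewrite big_nil].
rewrite (_ : (fun _ => _) = F k \+ (fun x => \sum_(k <- r) F k x));
  first exact: smoothD.
by apply/funext => x; rewrite big_cons.
Qed.

Lemma smooth_prod (I : Type) (r : seq I) (F : I -> 'rV[R]_d -> R) :
  (forall k, smooth (F k)) -> smooth (fun x => \prod_(k <- r) F k x).
Proof.
move=> sF; elim: r => [|k r IH].
  by rewrite (_ : (fun _ => _) = fun=> 1);
    [exact: smooth_cst|apply/funext => x; rewrite big_nil].
rewrite (_ : (fun _ => _) = F k \* (fun x => \prod_(k <- r) F k x));
  first exact: smoothM.
by apply/funext => x; rewrite big_cons.
Qed.

Lemma derive_translate u a e x : 'D_e (fun z => u (z + a)) x = 'D_e u (x + a).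
Proof.
rewrite /derive (_ : (fun h : R => _) = fun h :
  R => h^-1 *: ((u \o shift (x + a)) (h *: e) - u (x + a)))//.
by apply/funext => h /=; rewrite addrA.
Qed.

Lemma differentiable_translate u a x :
  differentiable u (x + a) -> differentiable (fun z => u (z + a)) x.
Proof.
move=> du; apply: (@differentiable_comp _ _ _ _ (fun z => z + a) u) => //.
Qed.

Lemma partial_translate i u a :
  partial i (fun z => u (z + a)) = fun z => partial i u (z + a).
Proof. by apply/funext => x; exact: derive_translate. Qed.

Lemma smooth_translate u a : smooth u -> smooth (fun z => u (z + a)).
Proof.
move=> su.
apply: (@smooth_invariant (fun w => exists2 u, smooth u & w = fun z => u (z + a))).
- move=> _ [u' su' ->] x.
  by apply: differentiable_translate; exact: smooth_differentiable.
- move=> _ i [u' su' ->]; rewrite partial_translate.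
  by exists (partial i u') => //; exact: smooth_partial.
- by exists u.
Qed.

Lemma derive_sum_partial u e x : differentiable u x ->
  'D_e u x = \sum_i e 0 i * partial i u x.
Proof.
move=> du; rewrite deriveE// [in LHS](row_sum_delta e) linear_sum/=.
by apply: eq_bigr => i _; rewrite linearZ/= /partial deriveE.
Qed.

Lemma smooth_derive u e : smooth u -> smooth (fun x => 'D_e u x).
Proof.
move=> su; rewrite (_ : (fun _ => _) = fun x => \sum_i e 0 i * partial i u x).
  by apply: smooth_sum => i; apply: smoothZ; exact: smooth_partial.
by apply/funext => x; apply: derive_sum_partial; exact: smooth_differentiable.
Qed.

Lemma is_derive_line u x e (t : R) : smooth u ->
  is_derive t (1 : R) (fun s : R => u (x + s *: e)) ('D_e u (x + t *: e)).
Proof.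
move=> su.
have E : (fun h : R => h^-1 *: (u (x + (h *: (1 : R) + t) *: e) - u (x + t *: e)))
    = fun h => h^-1 *: (u (h *: e + (x + t *: e)) - u (x + t *: e)).
  apply/funext => h; congr (_ *: (u _ - _)).
  by rewrite /GRing.scale/= mulr1 -/(_ *: _) scalerDl addrCA.
apply: DeriveDef; last by rewrite /derive /= E.
by have := @smooth_derivable u (x + t *: e) e su; rewrite /derivable E.
Qed.

Lemma smooth_MVT u x e : smooth u ->
  exists2 t, 0 <= t <= 1 & u (x + e) - u x = 'D_e u (x + t *: e).
Proof.
move=> su.
have dl t := is_derive_line x e t su.
have [|t] := @MVT_segment R (fun s => u (x + s *: e))
  (fun t => 'D_e u (x + t *: e)) 0 1 ler01 (fun t _ => dl t).
  apply: derivable_within_continuous => s _; exact: ex_derive.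
by rewrite in_itv/= scale1r scale0r addr0 subr0 mulr1 => t01 ->; exists t.
Qed.

End smoothness.

(** * Bump functions on boxes *)

Section bump.
Context {R : realType}.
Implicit Types (p : {poly R}) (s t c k : R).

(** Induction on p: one factor s is absorbed by half of the exponential,
    through s <= (2 / a) exp (a s / 2). *)
Lemma poly_expR_bounded p a : 0 < a ->
  exists2 K : R, 0 <= K & forall s, 0 < s -> `|p.[s]| * expR (- (a * s)) <= K.
Proof.
elim/poly_ind: p a => [|p c IH] a a0.
  by exists 0 => // s s0; rewrite horner0 normr0 mul0r.
have a2 : 0 < a / 2 by rewrite divr_gt0.
have [K K0 hK] := IH _ a2; exists (K * (2 / a) + `|c|).
  by rewrite addr_ge0// mulr_ge0// ltW// divr_gt0.
move=> s s0; rewrite hornerMXaddC.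
apply: (@le_trans _ _ ((`|p.[s]| * s + `|c|) * expR (- (a * s)))).
  rewrite ler_wpM2r ?expR_ge0//; apply: le_trans (ler_normD _ _) _.
  by rewrite normrM (gtr0_norm s0).
rewrite mulrDl lerD//; last first.
  rewrite ler_piMr// -expR0 ler_expR oppr_le0 mulr_ge0// ltW//.
have -> : - (a * s) = - (a / 2 * s) + - (a / 2 * s) by field.
rewrite expRD mulrACA ler_pM ?mulr_ge0 ?expR_ge0 ?hK//; first by rewrite ltW.
rewrite expRN ler_pdivrMr ?expR_gt0//.
apply: (@le_trans _ _ (2 / a * (1 + a / 2 * s))).
  have -> : 2 / a * (1 + a / 2 * s) = s + 2 / a by field; rewrite gt_eqF.
  by rewrite lerDl ltW// divr_gt0.
by rewrite ler_wpM2l ?expR_ge1Dx// ltW// divr_gt0.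
Qed.

(** The class of functions p(1/t) exp(-1/t), extended by 0, for all
    polynomials p; unlike the single function exp(-1/t), it is stable under
    derivation. *)
Definition flat p t : R := if 0 < t then p.[t^-1] * expR (- t^-1) else 0.

(** At 0 the quadratic remainder estimate is the boundedness of s^2 p(s)
    exp(-s) for s = 1/t. *)
Lemma is_derive_flat p t :
  is_derive t (1 : R) (flat p) (flat ('X^2 * (p^`() * (-1)%:P + p)) t).
Proof.
have [t0|t0|->] := ltgtP t 0.
- rewrite {2}/flat ltNge (ltW t0)/=.
  apply: (@near_eq_is_derive _ _ _ (cst 0)).
  near=> s; rewrite /flat ltNge; have -> // : s <= 0.
  by apply/ltW; near: s; exact: lt_nbhsl.
- rewrite {2}/flat t0.
  pose f := fun s : R => p.[s^-1] * expR (- s^-1).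
  apply: (@near_eq_is_derive _ _ _ f).
    near=> s; rewrite /flat; have -> // : 0 < s.
    by near: s; exact: lt_nbhsr.
  have tn0 : t != 0 by rewrite gt_eqF.
  have d1 : is_derive t (1 : R) (fun s : R => s^-1) (- t ^- 2).
    by have := @is_deriveV R id t 1 1 tn0 (is_derive_id _ _);
      rewrite /GRing.scale/= mulr1.
  have d2 := is_derive1_comp (is_derive_poly p t^-1) d1.
  have d3 := @is_derive1_comp _ expR (fun s : R => - s^-1) t _ _
    (is_derive_expR (- t^-1)) (is_deriveN d1).
  have dM : is_derive t (1 : R) f _ := is_deriveM d2 d3.
  apply: (is_derive_eq dM).
  rewrite /GRing.scale/= !hornerE/=; by field.
- rewrite {2}/flat ltxx.
  have [K K0 hK] := poly_expR_bounded ('X^2 * p) ltr01.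
  apply: (@is_derive_of_quadratic_remainder _ _ _ _ K) => // s.
  rewrite add0r mul0r subr0 /flat ltxx subr0.
  case: ltP => s0; last by rewrite normr0 mulr_ge0// sqr_ge0.
  have := hK s^-1; rewrite invr_gt0 => /(_ s0).
  rewrite mul1r hornerM hornerXn normrM [`|s^-1 ^+ 2|]ger0_norm ?sqr_ge0//.
  rewrite exprVn -mulrA ler_pdivrMl ?exprn_gt0// => h.
  by rewrite normrM (ger0_norm (expR_ge0 _)) (mulrC K).
Unshelve. all: by end_near.
Qed.

Section coordinate.
Variable d : nat.
Implicit Types (x : 'rV[R]_d) (i j : 'I_d).

Lemma derive_coord (b : R -> R) (b' : R) i j x :
  is_derive (x 0 i) (1 : R) b b' ->
  differentiable (fun z : 'rV[R]_d => b (z 0 i)) x /\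
  partial j (fun z : 'rV[R]_d => b (z 0 i)) x = (i == j)%:R * b'.
Proof.
move=> db; have db1 : derivable b (x 0 i) 1 by exact: ex_derive.
have dc : differentiable (fun z : 'rV[R]_d => z 0 i) x by exact:
  differentiable_coord.
split.
  apply: (@differentiable_comp _ _ _ _ (fun z : 'rV[R]_d => z 0 i) b) => //.
  exact/derivable1_diffP.
rewrite /partial /derive.
case: eqP => [ij|ij]; last first.
  rewrite mul0r (_ : (fun h : R => _) = fun=> 0).
    exact: lim_cst.
  apply/funext => h /=; rewrite !mxE eqxx/=; case: eqP => [ji|_];
    first by exfalso; apply: ij.
  by rewrite mulr0 add0r subrr scaler0.
subst j; rewrite mul1r (_ : (fun h : R => _) = fun h :
  R => h^-1 *: ((b \o shift (x 0 i)) (h *: (1 : R)) - b (x 0 i))).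
  by case: db => _ <-.
apply/funext => h /=.
by rewrite !mxE !eqxx.
Qed.

Lemma smooth_flat_coord p k c i :
  smooth (fun x : 'rV[R]_d => flat p (k * x 0 i + c)).
Proof.
apply: (@smooth_invariant _ _
  (fun u => exists p, u = fun x => flat p (k * x 0 i + c))).
- move=> _ [{}p ->] x.
  have D : is_derive (x 0 i) (1 : R) (fun t => flat p (k * t + c))
    (flat ('X^2 * (p^`() * (-1)%:P + p)) (k * x 0 i + c) * k).
    apply: (@is_derive1_comp _ _ (fun t => k * t + c)); first exact: is_derive_flat.
    by apply: is_derive_eq; rewrite /GRing.scale/= mulr1 addr0.
  by have [] := derive_coord i D.
- move=> _ j [{}p ->].
  exists (((i == j)%:R * k)%:P * ('X^2 * (p^`() * (-1)%:P + p))).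
  apply/funext => x.
  have D : is_derive (x 0 i) (1 : R) (fun t => flat p (k * t + c))
    (flat ('X^2 * (p^`() * (-1)%:P + p)) (k * x 0 i + c) * k).
    apply: (@is_derive1_comp _ _ (fun t => k * t + c)); first exact: is_derive_flat.
    by apply: is_derive_eq; rewrite /GRing.scale/= mulr1 addr0.
  have [_ ->] := derive_coord j D.
  rewrite /flat; case: ifP => _; last by rewrite mul0r mulr0.
  by rewrite [in RHS]hornerM hornerC; ring.
- by exists p.
Qed.

(** In each coordinate, exp(-1/(k t)) for the distances t to the two ends of
    the interval. The bumps are smooth, vanish outside of the box and
    increase to its indicator function as k grows. *)
Definition bump (a b : 'rV[R]_d) (k : nat) (x : 'rV[R]_d) : R :=
  \prod_i (flat 1 (k.+1%:R * x 0 i + - (k.+1%:R * a 0 i)) *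
           flat 1 (- k.+1%:R * x 0 i + k.+1%:R * b 0 i)).

Lemma smooth_bump a b (k : nat) : smooth (bump a b k).
Proof. by apply: smooth_prod => i; apply: smoothM; exact: smooth_flat_coord. Qed.

Lemma flat1_itv t : 0 <= flat 1 t <= 1.
Proof.
rewrite /flat; case: ifP => t0; last by rewrite lexx ler01.
by rewrite hornerC mul1r expR_ge0/= -expR0 ler_expR oppr_le0 invr_ge0 ltW.
Qed.

Lemma bump_itv a b (k : nat) x : 0 <= bump a b k x <= 1.
Proof.
have h (i : 'I_d) := flat1_itv (k.+1%:R * x 0 i + - (k.+1%:R * a 0 i)).
have h' (i : 'I_d) := flat1_itv (- k.+1%:R * x 0 i + k.+1%:R * b 0 i).
apply/andP; split.
  by apply: prodr_ge0 => i _; rewrite mulr_ge0//;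
    [case/andP: (h i)|case/andP: (h' i)].
apply: prodr_ile1 => i _; have /andP[? ?] := h i; have /andP[? ?] := h' i.
by rewrite mulr_ge0//= mulr_ile1.
Qed.

Lemma bump_out a b (k : nat) x : ~ box a b x -> bump a b k x = 0.
Proof.
move=> /existsNP[i /negP]; rewrite negb_and -!leNgt => hi.
rewrite /bump (bigD1 i)//= /flat; case/orP: hi => hi.
  by rewrite -mulrBr pmulr_rgt0// subr_gt0 ltNge hi/= !mul0r.
rewrite [X in _ * (if X then _ else _)](_ : _ = false) ?mulr0 ?mul0r//.
by rewrite mulNr addrC -mulrBr pmulr_rgt0// subr_gt0 ltNge hi.
Qed.

Lemma bump_cvg a b x : box a b x -> bump a b k x @[k --> \oo] --> (1 : R).
Proof.
move=> bx.
have L t : 0 < t -> flat 1 (k.+1%:R * t) @[k --> \oo] --> (1 : R).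
  move=> t0; rewrite (_ : (fun k : nat => _) = fun k :
    nat => expR (- (t^-1 * k.+1%:R^-1))); last first.
    by apply/funext => k; rewrite /flat mulr_gt0// hornerC mul1r invfM mulrC.
  rewrite -[X in _ --> X]expR0.
  apply: continuous_cvg; first exact: continuous_expR.
  rewrite -oppr0; apply: cvgN; rewrite -(mulr0 t^-1);
    apply: (@cvgM _ _ _ _ (fun=> t^-1)); first exact: cvg_cst.
  exact: cvg_harmonic.
rewrite (_ : (1 : R) = \prod_(i < d) (1 * 1)); last by rewrite big1// => i _;
  rewrite mulr1.
apply: cvg_big => [|i _]; first exact: mul_continuous.
apply: cvgM.
  under eq_fun do rewrite -mulrBr.
  by apply: L; rewrite subr_gt0; case/andP: (bx i).
under eq_fun do rewrite mulNr addrC -mulrBr.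
by apply: L; rewrite subr_gt0; case/andP: (bx i).
Qed.

End coordinate.

End bump.

(** * Borel sets and Lebesgue measure *)

Section borel.
Context {R : realType} {d : nat}.
Implicit Types (x y a b e : 'rV[R]_d) (A B : set 'rV[R]_d).

Lemma row_norm_coord x i : `|x 0 i| <= `|x|.
Proof. by rewrite [leRHS]/Num.norm/= mx_normrE; exact: (le_bigmax _ _ (0, i)). Qed.

Lemma row_ballE x (r : R) y : 0 < r ->
  ball x r y <-> forall i, `|x 0 i - y 0 i| < r.
Proof.
move=> r0; split => [[_ h] i|h]; first exact: h.
by split=> // k i; rewrite (ord1 k); exact: h.
Qed.

Lemma box_center x (r : R) : 0 < r ->
  box (x - const_mx r) (x + const_mx r) = ball x r.
Proof.
move=> r0; apply/seteqP; split => y.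
  by move=> h; apply/row_ballE => // i; have := h i; rewrite !mxE ltr_norml; lra.
by move/row_ballE => /(_ r0) h i; have := h i; rewrite !mxE ltr_norml; lra.
Qed.

Lemma open_box a b : open (box a b).
Proof.
rewrite openE => x bx.
suff : nbhs x [set y : 'rV[R]_d | forall i, a 0 i < y 0 i < b 0 i] by [].
apply: (@filter_forall _ _ (fun i (y : 'rV[R]_d) => a 0 i < y 0 i < b 0 i)
  (nbhs x)) => i.
have ci : (fun y : 'rV[R]_d => y 0 i) @ x --> x 0 i by exact: coord_continuous.
have /andP[h1 h2] := bx i.
have A1 : nbhs x [set y : 'rV[R]_d | a 0 i < y 0 i] := ci _ (lt_nbhsr h1).
have A2 : nbhs x [set y : 'rV[R]_d | y 0 i < b 0 i] := ci _ (lt_nbhsl h2).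
by apply: filterS2 A1 A2 => y /= -> ->.
Qed.

Lemma measurable_box a b : measurable (box a b).
Proof.
rewrite (_ : box a b = \bigcap_(i in [set: 'I_d]) ((fun x => x ord0 i) @^-1` `]a
  0 i, b 0 i[)).
  apply: fin_bigcap_measurable => // i _.
  by have := measurable_coord i measurableT (measurable_itv `]a 0 i, b 0 i[);
    rewrite setTI.
apply/seteqP; split=> x h i => [_|]; first by rewrite /= in_itv/=; exact: h.
by have := h i I; rewrite /= in_itv.
Qed.

Definition boxes : set (set 'rV[R]_d) := [set box ab.1 ab.2 | ab in setT].

Lemma boxes_setI : setI_closed boxes.
Proof.
move=> _ _ [[a b] _ <-] [[a' b'] _ <-] /=.
exists (\row_i Num.max (a 0 i) (a' 0 i), \row_i Num.min (b 0 i) (b' 0 i)) => //=.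
apply/seteqP; split=> x /=.
  move=> h; split => i; have := h i; rewrite !mxE gt_max lt_min.
    by move=> /andP[/andP[-> _] /andP[-> _]].
  by move=> /andP[/andP[_ ->] /andP[_ ->]].
by move=> [h h'] i; rewrite !mxE gt_max lt_min; have /andP[-> ->] := h i;
  have /andP[-> ->] := h' i.
Qed.

Lemma cube_cover : \bigcup_k box (- const_mx k%:R) (const_mx k%:R) =
  [set: 'rV[R]_d].
Proof.
apply/seteqP; split => // x _.
pose M := \sum_i `|x 0 i|.
exists (Num.truncn M).+1 => // i; rewrite !mxE -ltr_norml.
apply: (@le_lt_trans _ _ M); last exact: truncnS_gt.
rewrite /M (bigD1 i)//= lerDl; apply: sumr_ge0 => j _; exact: normr_ge0.
Qed.

(** The half-spaces of the coordinates are countable unions of boxes. *)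
Lemma boxes_generate : @measurable _ 'rV[R]_d = <<s boxes >>.
Proof.
apply/seteqP; split; last first.
  apply: smallest_sub; first exact: sigma_algebra_measurable.
  by move=> _ [[a b] _ <-]; exact: measurable_box.
have sb : sigma_algebra setT <<s boxes >> by exact: smallest_sigma_algebra.
apply: smallest_sub => //.
rewrite -bigcup_seq/=; apply: bigcup_sub => i _ _ [Y mY <-]; rewrite setTI.
have : image_set_system setT (fun x : 'rV[R]_d => x ord0 i) <<s boxes >> Y.
  move: Y mY; rewrite (RGenOInfty.measurableE R); apply: smallest_sub.
    exact: sigma_algebra_image.
  move=> _ [r ->]; rewrite /image_set_system/= setTI.
  rewrite (_ : _ @^-1` _ = \bigcup_k box (\row_j (if j == i then r else - k%:R))
    (const_mx k%:R)).
    apply: sigma_algebra_bigcup => k; apply: sub_sigma_algebra.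
    by exists (\row_j (if j == i then r else - k%:R), const_mx k%:R).
  apply/seteqP; split=> x /=; rewrite in_itv/= andbT.
    move=> rx; have [k _ xk] : (\bigcup_k box (- const_mx k%:R) (const_mx k%:R))
      x by rewrite cube_cover.
    exists k => // j; have := xk j; rewrite !mxE; case: eqP => [->|_//].
    by rewrite rx => /andP[_ ->].
  by move=> [k _ h]; have := h i; rewrite !mxE eqxx => /andP[].
by rewrite /image_set_system/= setTI.
Qed.

Definition cbox a b : set 'rV[R]_d := [set x | forall i, a 0 i <= x 0 i <= b 0 i].

(** Boxes with rational corners. Their closures are asked to lie in A so
    that bump functions on them are test functions on A. Codes that do not
    denote such a box give the empty set. *)
Lemma open_cover_boxes A : open A ->
  exists F : nat -> set 'rV[R]_d, A = \bigcup_k F k /\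
    forall k, F k = set0 \/ exists a b, F k = box a b /\ cbox a b `<=` A.
Proof.
move=> oA.
pose rt (p : 'rV[rat]_d) : 'rV[R]_d := \row_i ratr (p 0 i).
pose F k := if unpickle k is Some pq then
   [set x | @box R d (rt pq.1) (rt pq.2) x /\ cbox (rt pq.1) (rt pq.2) `<=` A]
     else set0.
exists F; split; last first.
  move=> k; rewrite /F; case: unpickle => [[p q]|]; last by left.
  have [h|h] := pselect (cbox (rt p) (rt q) `<=` A); last by left; apply/seteqP;
    split => // x [].
  by right; exists (rt p), (rt q); split => //; apply/seteqP; split=> x // [].
apply/seteqP; split=> x; last first.
  move=> [k _]; rewrite /F; case: unpickle => // -[p q] [h]; apply => i.
  by have /andP[? ?] := h i; rewrite !ltW.
move=> Ax; have /nbhs_ballP[/= r r0 rA] : nbhs x A by exact: open_nbhs_nbhs.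
have /choice[p hp] (i : 'I_d) : exists q : rat, x 0 i - r < ratr q < x 0 i.
  have [|q] := @rat_in_itvoo _ (x 0 i - r) (x 0 i); first by lra.
  by rewrite in_itv/= => h; exists q.
have /choice[q hq] (i : 'I_d) : exists q : rat, x 0 i < ratr q < x 0 i + r.
  have [|q'] := @rat_in_itvoo _ (x 0 i) (x 0 i + r); first by lra.
  by rewrite in_itv/= => h; exists q'.
exists (pickle ((\row_i p i, \row_i q i) : 'rV[rat]_d * 'rV[rat]_d)) => //.
rewrite /F pickleK; split => [i|y hy].
  by rewrite !mxE; have /andP[_ ->] := hp i; have /andP[-> _] := hq i.
apply: rA; apply/row_ballE => // i.
by have := hy i; have := hp i; have := hq i; rewrite !mxE ltr_norml; lra.
Qed.

Lemma open_measurable_row A : open A -> measurable A.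
Proof.
move=> /open_cover_boxes[F [-> hF]]; apply: bigcupT_measurable => k.
by case: (hF k) => [->//|[a [b [-> _]]]]; exact: measurable_box.
Qed.

Lemma closed_measurable_row A : closed A -> measurable A.
Proof. by move=> cA; rewrite -[A]setCK; apply: measurableC;
  apply: open_measurable_row; exact: closed_openC. Qed.

Lemma continuous_measurable_row (u : 'rV[R]_d -> R) :
  continuous u -> measurable_fun setT u.
Proof.
move=> cu; apply: (measurability (@RGenOInfty.G R));
  first exact: RGenOInfty.measurableE.
move=> _ [_ [r ->] <-]; rewrite setTI; apply: open_measurable_row.
by apply: open_comp; [move=> x _; exact: cu|rewrite set_itvE; exact: open_gt].
Qed.

Lemma lebesgue_box a b : (forall i, a 0 i <= b 0 i) ->
  lebesgue d (box a b) = (\prod_i (b 0 i - a 0 i))%:E.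
Proof.
move=> ab; rewrite (_ : box a b = [set x | forall i, `]a 0 i,
  b 0 i[%classic (x ord0 i)]); last first.
  by apply/seteqP; split=> x h i; have := h i; rewrite /= in_itv.
rewrite (@lebesgue_prod R d (fun i => `]a 0 i, b 0 i[%classic));
  last by move=> i; exact: measurable_itv.
rewrite -prodEFin; apply: eq_bigr => i _.
rewrite lebesgue_measure_itv/= lte_fin; case: ltP => h; first by rewrite -EFinB.
by congr (_%:E); apply/eqP; rewrite eq_sym subr_eq0 eq_le h ab.
Qed.

Lemma lebesgue_box_lty a b : (lebesgue d (box a b) < +oo)%E.
Proof.
have [h|/existsNP[i hi]] := pselect (forall i, a 0 i <= b 0 i).
  by rewrite lebesgue_box// ltry.
rewrite (_ : box a b = set0) ?measure0// -subset0 => x /(_ i).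
by move: hi => /negP; rewrite -ltNge; lra.
Qed.

Lemma lebesgue_bounded_lty A : bounded_set A -> measurable A ->
  (lebesgue d A < +oo)%E.
Proof.
move=> bA mA.
have [M hM] : exists M : R, forall x, A x -> forall i, `|x 0 i| < M.
  move: bA => [M [_ /(_ (M + 1))]]; rewrite ltrDl => /(_ ltr01) h.
  exists (M + 2) => x Ax i; apply: (@le_lt_trans _ _ (M + 1)); last lra.
  by apply: le_trans (h _ Ax); exact: row_norm_coord.
apply: (@le_lt_trans _ _ (lebesgue d (box (- const_mx M) (const_mx M))));
  last exact: lebesgue_box_lty.
apply: le_measure; rewrite ?inE//; first exact: measurable_box.
by move=> x Ax i; rewrite !mxE -ltr_norml; exact: hM.
Qed.

Lemma lebesgue_open_gt0 A : open A -> A !=set0 -> (0 < lebesgue d A)%E.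
Proof.
move=> oA [x Ax]; have /nbhs_ballP[/= r r0 rA] : nbhs x A by exact: open_nbhs_nbhs.
apply: (@lt_le_trans _ _ (lebesgue d (box (x - const_mx r) (x + const_mx r))));
  last first.
  by apply: le_measure; rewrite ?inE ?box_center//;
    apply: open_measurable_row => //; exact: ball_open.
rewrite lebesgue_box; last by move=> i; rewrite !mxE; lra.
by rewrite lte_fin; apply: prodr_gt0 => i _; rewrite !mxE; lra.
Qed.

Lemma measurable_shift e : measurable_fun [set: 'rV[R]_d] (fun x => x + e).
Proof.
apply: measurable_fun_coordP => i.
rewrite (_ : (fun _ => _) = fun x : 'rV[R]_d => x ord0 i + e ord0 i).
  by apply: measurable_funD => //; exact: measurable_coord.
by apply/funext => x; rewrite mxE.
Qed.

(** Both measures agree on the boxes, which generate the Borel sets and are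
    stable under intersections. *)
Lemma lebesgue_translate e A : measurable A ->
  lebesgue d ((fun x => x + e) @^-1` A) = lebesgue d A.
Proof.
move=> mA.
rewrite -[LHS]/(pushforward (lebesgue d) (fun x => x + e) A).
pose m2 := measure_function_pushforward__canonical__measure_function_Measure
  (lebesgue d) (measurable_shift e).
apply: (@measure_unique _ R _ boxes
  (fun k => box (- const_mx k%:R) (const_mx k%:R)) boxes_generate boxes_setI _
    cube_cover m2) => //.
- by move=> k; exists (- const_mx k%:R, const_mx k%:R).
- move=> _ [[a b] _ <-] /=; rewrite /pushforward/=.
  rewrite (_ : _ @^-1` _ = box (a - e) (b - e)); last first.
    by apply/seteqP; split=> x h i; have := h i; rewrite !mxE; lra.
  have [h|/existsNP[i hi]] := pselect (forall i, a 0 i <= b 0 i).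
    rewrite !lebesgue_box//; last by move=> i; rewrite !mxE lerD2r.
    by congr (_%:E); apply: eq_bigr => i _; rewrite !mxE; ring.
  have hab : b 0 i < a 0 i by rewrite ltNge; apply/negP.
  rewrite (_ : box a b = set0); last first.
    by apply/seteqP; split=> // x /(_ i); lra.
  rewrite (_ : box (a - e) (b - e) = set0)//.
  by apply/seteqP; split=> // x /(_ i); rewrite !mxE; lra.
- move=> k /=; rewrite /pushforward.
  rewrite (_ : _ @^-1` _ = box (- const_mx k%:R - e) (const_mx k%:R - e));
    last first.
    by apply/seteqP; split=> x h i; have := h i; rewrite !mxE; lra.
  exact: lebesgue_box_lty.
Qed.

End borel.

(** * Square-integrable functions *)

Lemma limn_einf_le {R : realType} (f : (\bar R)^nat) (c : \bar R) :
  (forall k, (f k <= c)%E) -> (limn_einf f <= c)%E.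
Proof.
move=> fc; rewrite limn_einf_lim; apply: lime_le; first exact: is_cvg_einfs.
near=> k; apply: le_trans (fc k); by apply: ereal_inf_lbound; exists k => /=.
Unshelve. all: by end_near.
Qed.

Section L2_theory.
Context {R : realType} {d : nat}.
Implicit Types (u v w : 'rV[R]_d -> R).
Variable Omega : set 'rV[R]_d.
Hypothesis mO : measurable Omega.
Local Notation mu := (lebesgue d : {measure set 'rV[R]_d -> \bar R}).
Local Notation L2 := (@L2 R d Omega).
Local Notation inner := (@inner R d Omega).

Lemma L2_integrable_sqr u : L2 u ->
  mu.-integrable Omega (EFin \o (fun x => u x ^+ 2)).
Proof.
move=> [mu_ lt_]; apply/integrableP; split.
  by apply/measurable_EFinP; exact: measurable_funX.
apply: le_lt_trans lt_; rewrite le_eqVlt; apply/orP; left; apply/eqP.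
by apply: eq_integral => x _ /=; rewrite ger0_norm// sqr_ge0.
Qed.

Lemma L2_of_le u (h : 'rV[R]_d -> R) : measurable_fun Omega u ->
  mu.-integrable Omega (EFin \o h) -> (forall x, Omega x -> u x ^+ 2 <= h x) ->
    L2 u.
Proof.
move=> mu_ ih uh; split => //.
have h0 x : Omega x -> 0 <= h x by move=> Ox; apply: le_trans (uh _ Ox);
  exact: sqr_ge0.
have mh := measurable_int _ ih.
apply: (@le_lt_trans _ _ (\int[mu]_(x in Omega) (h x)%:E)%E).
  apply: ge0_le_integral => //.
  - by move=> x _; rewrite lee_fin sqr_ge0.
  - by apply/measurable_EFinP; exact: measurable_funX.
have /integrableP[_ ih2] := ih; apply: le_lt_trans ih2; rewrite le_eqVlt;
  apply/orP; left; apply/eqP.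
by apply: eq_integral => x /[!inE] Ox /=; rewrite ger0_norm// h0.
Qed.

Lemma L2_integrable_mul u v : L2 u -> L2 v ->
  mu.-integrable Omega (EFin \o (fun x => u x * v x)).
Proof.
move=> Lu Lv; have iu := L2_integrable_sqr Lu; have iv := L2_integrable_sqr Lv.
apply: (le_integrable _ _ _ (integrableD mO iu iv)) => //.
  by apply/measurable_EFinP; apply: measurable_funM; [case: Lu|case: Lv].
move=> x Ox; rewrite /= lee_fin.
rewrite [leRHS]ger0_norm ?addr_ge0 ?sqr_ge0//.
have := sqr_ge0 (u x - v x); have := sqr_ge0 (u x + v x).
have := sqr_ge0 (u x); have := sqr_ge0 (v x).
by rewrite ler_norml => *; apply/andP; split; nra.
Qed.

Lemma L2_subspace : subspace L2.
Proof.
split.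
  by apply: (L2_of_le (measurable_cst _) (integrable0 _ _)) => x _; rewrite expr0n.
move=> c u v Lu Lv; have [mu_ _] := Lu; have [mv _] := Lv.
have iu := integrableZl mO (2 * c ^+ 2) (L2_integrable_sqr Lu).
have iv := integrableZl mO 2 (L2_integrable_sqr Lv).
apply: (L2_of_le _ (integrableD mO iu iv)).
  by apply: measurable_funD => //; exact: measurable_funM.
move=> x Ox; change ((c * u x + v x) ^+ 2 <= 2 * c ^+ 2 * u x ^+ 2 + 2 * v x ^+ 2).
by have := sqr_ge0 (c * u x - v x); nra.
Qed.

Lemma inner_form : psd_form L2 inner.
Proof.
split.
- by move=> u v _ _; apply: eq_Rintegral => x _; rewrite mulrC.
- move=> c u v w Lu Lv Lw; rewrite /inner -RintegralZl ?L2_integrable_mul//.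
  rewrite -RintegralD//; last 2 first.
  + by have := integrableZl mO c (L2_integrable_mul Lu Lw).
  + exact: L2_integrable_mul.
  by apply: eq_Rintegral => x _; rewrite mulrA -mulrDl.
- by move=> u _; apply: Rintegral_ge0 => x _; rewrite -expr2 sqr_ge0.
Qed.

Lemma inner_fin u v : L2 u -> L2 v ->
  (\int[mu]_(x in Omega) (u x * v x)%:E)%E = (inner u v)%:E.
Proof.
by move=> Lu Lv; rewrite /inner /Rintegral fineK//;
  apply: integrable_fin_num => //; exact: L2_integrable_mul.
Qed.

Lemma inner_ae u u' v : L2 u -> L2 u' -> L2 v -> ae_eq_on Omega u u' ->
  inner u v = inner u' v.
Proof.
move=> Lu Lu' Lv uu'; congr fine; apply: ae_eq_integral => //.
- exact: measurable_int (L2_integrable_mul Lu Lv).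
- exact: measurable_int (L2_integrable_mul Lu' Lv).
- by apply: filterS uu' => x h Ox; rewrite /= h.
Qed.

Lemma inner_eq0 u : L2 u -> inner u u = 0 -> ae_eq_on Omega u (fun _ => 0).
Proof.
move=> Lu u0; have := inner_fin Lu Lu; rewrite u0 => h0.
have muu := measurable_int _ (L2_integrable_mul Lu Lu).
have : (\int[mu]_(x in Omega) `|(u x * u x)%:E|)%E = 0%E.
  by rewrite -[RHS]h0; apply: eq_integral => x _ /=;
    rewrite ger0_norm// -expr2 sqr_ge0.
move/(ae_eq_integral_abs mu mO muu); apply: filterS => x hx Ox.
by have [/eqP] := hx Ox; rewrite mulf_eq0 orbb => /eqP.
Qed.

Lemma inner_ae0 u v : L2 u -> L2 v -> ae_eq_on Omega u (fun _ => 0) ->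
  inner u v = 0.
Proof.
move=> Lu Lv u0; rewrite (inner_ae Lu L2_subspace.1 Lv u0).
exact: (form0l L2_subspace inner_form).
Qed.

Hypothesis fO : (mu Omega < +oo)%E.

Lemma integrable_cst_finite (c : R) : mu.-integrable Omega (EFin \o (fun _ => c)).
Proof.
apply/integrableP; split; first by apply/measurable_EFinP; exact: measurable_cst.
by rewrite (eq_integral (cst `|c|%:E))// integral_cst// lte_mul_pinfty.
Qed.

Lemma L2_cst (c : R) : L2 (fun _ => c).
Proof. by apply: (L2_of_le _ (integrable_cst_finite (c ^+ 2))). Qed.

(** The Riesz-Fischer theorem. By the inequality of arithmetic and geometric
    means, the increments |u k.+1 - u k| are bounded by functions h k whose
    integrals are summable, so the sequence converges almost everywhere;
    Fatou's lemma identifies the limit in L2. *)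
Lemma L2_complete : complete_form L2 inner.
Proof.
move=> u Lu [C0 hC0].
have [C C00 hC] : exists2 C : R, 0 <= C & forall i j, (i <= j)%N ->
  inner (u j - u i) (u j - u i) <= C / 4 ^+ i.
  exists `|C0| => // i j ij; apply: le_trans (hC0 _ _ ij) _.
  by rewrite ler_wpM2r ?invr_ge0 ?exprn_ge0// ler_norm.
have Luv i j : L2 (u i - u j) := subspaceB L2_subspace (Lu i) (Lu j).
(* 2 |y| <= 2^k y^2 + 2^-k *)
pose h k x : R := 2^-1 * (2 ^+ k * (u k.+1 x - u k x) ^+ 2 + (2 ^+ k)^-1).
have h0 k x : 0 <= h k x.
  apply: mulr_ge0; first by rewrite invr_ge0.
  apply: addr_ge0; last by rewrite invr_ge0 exprn_ge0.
  by apply: mulr_ge0; [rewrite exprn_ge0|exact: sqr_ge0].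
have vh k x : `|u k.+1 x - u k x| <= h k x.
  have p : 0 < 2 ^+ k :> R by rewrite exprn_gt0.
  have -> : h k x = (2 ^+ k)^-1 * 2^-1 * ((2 ^+ k * `|u k.+1 x - u k x|) ^+ 2 + 1).
    by rewrite /h exprMn real_normK ?num_real//; field; rewrite gt_eqF.
  set y := `|_|; rewrite -ler_pdivrMl ?mulr_gt0 ?invr_gt0//.
  rewrite invfM !invrK; have := sqr_ge0 (2 ^+ k * y - 1); nra.
have mh k : measurable_fun Omega (EFin \o h k).
  apply/measurable_EFinP; apply: measurable_funM => //;
    apply: measurable_funD => //.
  apply: measurable_funM => //; apply: measurable_funX;
    apply: measurable_funB => //; exact: (Lu _).1.
pose M0 := inner (fun=> 1) (fun=> 1).
have M00 : 0 <= M0 by case: inner_form => _ _; apply; exact: L2_cst.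
have i1 k : mu.-integrable Omega
  (EFin \o (fun x => 2 ^+ k * ((u k.+1 - u k) x * (u k.+1 - u k) x))).
  by have := integrableZl mO (2 ^+ k) (L2_integrable_mul (Luv k.+1 k) (Luv k.+1 k)).
have i2 k : mu.-integrable Omega (EFin \o (fun x => (2 ^+ k)^-1 * (1 * 1))).
  by have := integrableZl mO (2 ^+ k)^-1 (L2_integrable_mul (L2_cst 1) (L2_cst 1)).
have ih k : (\int[mu]_(x in Omega) (h k x)%:E <=
  ((C + M0) / (2 ^ (k + 1)%N)%:R)%:E)%E.
  have hE : h k = fun x => 2^-1 *
    (2 ^+ k * ((u k.+1 - u k) x * (u k.+1 - u k) x) + (2 ^+ k)^-1 * (1 * 1)).
    by apply/funext => x; rewrite /h !mulr1 -expr2.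
  have i3 : mu.-integrable Omega
    (EFin \o (fun x => 2 ^+ k * ((u k.+1 - u k) x * (u k.+1 - u k) x) +
      (2 ^+ k)^-1 * (1 * 1))).
    by have := integrableD mO (i1 k) (i2 k).
  have i4 : mu.-integrable Omega (EFin \o h k).
    by rewrite hE; have := integrableZl mO 2^-1 i3.
  have Rh : Rintegral mu Omega (h k) =
      2^-1 * (2 ^+ k * inner (u k.+1 - u k) (u k.+1 - u k) + (2 ^+ k)^-1 * M0).
    rewrite hE RintegralZl// RintegralD//; congr (_ * (_ + _)).
      by rewrite RintegralZl//; exact: L2_integrable_mul.
    by rewrite RintegralZl//; apply: L2_integrable_mul; exact: L2_cst.
  rewrite -(fineK (integrable_fin_num mO i4)) lee_fin.
  rewrite (_ : fine _ = Rintegral mu Omega (h k))// Rh.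
  have := hC _ _ (leqnSn k).
  rewrite natrX addn1 exprSr.
  have -> : 4 ^+ k = 2 ^+ k * 2 ^+ k :> R by rewrite -exprMn; congr (_ ^+ _); ring.
  have p : 0 < 2 ^+ k :> R by rewrite exprn_gt0.
  set p2 := 2 ^+ k; set y := inner _ _ => hy.
  rewrite ler_pdivlMr ?mulr_gt0//.
  apply: (@le_trans _ _ (p2 * p2 * y + M0)).
    by rewrite le_eqVlt; apply/orP; left; apply/eqP; field; rewrite gt_eqF.
  by rewrite lerD2r mulrC -ler_pdivlMr ?mulr_gt0.
(* finite almost everywhere, it dominates the telescoping series of u *)
pose G x := (\sum_(k <oo) (h k x)%:E)%E.
have iG : (\int[mu]_(x in Omega) G x < +oo)%E.
  rewrite integral_nneseries//; last by move=> k x _; rewrite lee_fin.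
  apply: (@le_lt_trans _ _ (\sum_(k <oo) ((C + M0) / (2 ^ (k + 1)%N)%:R)%:E)%E).
    apply: lee_nneseries => [k _ _|k _]; last exact: ih.
    by apply: integral_ge0 => x _; rewrite lee_fin.
  have := @cvg_geometric_eseries_half R (C + M0) 0;
    rewrite /eseries/= => /cvg_lim -> //.
  by rewrite ltry.
have mG : measurable_fun Omega G by apply: ge0_emeasurable_sum => [k x _ _|k _];
  [rewrite lee_fin|exact: mh].
have G0 x : (0 <= G x)%E by apply: nneseries_ge0 => k _ _; rewrite lee_fin.
have GE : mu.-integrable Omega G.
  apply/integrableP; split => //; apply: le_lt_trans iG; rewrite le_eqVlt;
    apply/orP; left; apply/eqP.
  by apply: eq_integral => x _; rewrite gee0_abs.
pose E := Omega `&` [set x | (G x < +oo)%E].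
have mE : measurable E by apply: measurable_lte => //; exact: measurable_cst.
have EO : E `<=` Omega by move=> x [].
have aeE : {ae mu, forall x, Omega x -> E x}.
  have := integrable_ae mO GE; apply: filterS => x hx Ox; split => //=.
  by have := hx Ox; rewrite ge0_fin_numE.
have cvE x : E x -> cvgn (fun k => u k x).
  move=> [Ox /= Gx].
  have bnd : cvgn [normed series (fun k => u k.+1 x - u k x)].
    apply: nondecreasing_is_cvgn.
      apply/nondecreasing_seqP => k;
        change (series (fun k => `|u k.+1 x - u k x|) k <=
          series (fun k => `|u k.+1 x - u k x|) k.+1).
      rewrite seriesSr lerDl; exact: normr_ge0.
    exists (fine (G x)) => _ [k _ <-] /=.
    rewrite -lee_fin fineK ?ge0_fin_numE//.
    apply: le_trans (@nneseries_lim_ge _ (fun k => (h k x)%:E) xpredT 0 k _);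
      last by move=> *; rewrite lee_fin.
    by rewrite /series/= sumEFin lee_fin; apply: ler_sum.
  have /normed_cvg cs := bnd.
  have -> : (fun k => u k x) =
    (fun k => u 0%N x + series (fun k => u k.+1 x - u k x) k).
    by apply/funext => k; rewrite /series/= telescope_sumr// addrC subrK.
  by apply: is_cvgD => //; exact: is_cvg_cst.
(* truncated to the set of convergence, so that the limit is measurable *)
pose uu k := (u k) \_ E.
have muu k : measurable_fun Omega (uu k).
  apply: measurable_funTS; apply: (measurable_restrictT _ mE).1.
  exact: (measurable_funS mO EO (Lu k).1).
have cuu x : cvgn (uu ^~ x).
  have [Ex|nEx] := pselect (E x).
    rewrite (_ : uu ^~ x = fun k => u k x); first exact: cvE.
    by apply/funext => k; rewrite /uu patchE mem_set.
  rewrite (_ : uu ^~ x = fun=> 0); first exact: is_cvg_cst.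
  by apply/funext => k; rewrite /uu patchE memNset.
pose ul x := limn (uu ^~ x).
have mul : measurable_fun Omega ul.
  by apply: (@measurable_fun_cvg _ _ _ Omega uu ul) => // x _; exact: cuu.
have key i : (\int[mu]_(x in Omega) ((ul x - u i x) ^+ 2)%:E <= (C / 4 ^+ i)%:E)%E.
  pose f m x := (((uu (i + m)%N x - uu i x) ^+ 2)%:E : \bar R).
  have mf m : measurable_fun Omega (f m).
    by apply/measurable_EFinP; apply: measurable_funX; apply: measurable_funB.
  have fl x : Omega x -> limn_einf (f ^~ x) = ((ul x - uu i x) ^+ 2)%:E.
    move=> Ox; have : (f ^~ x) @ \oo --> (((ul x - uu i x) ^+ 2)%:E : \bar R).
      apply/cvg_EFin; first by near=> m.
      apply: (@cvg_comp _ _ _ _ (fun y => y ^+ 2)); last exact: exprn_continuous.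
      have cm : uu (i + m)%N x @[m --> \oo] --> ul x.
        rewrite (_ : (fun m => uu (i + m)%N x) = fun m => (uu ^~ x) (m + i)%N).
          by rewrite (cvg_shiftn i (uu ^~ x)); exact: cuu.
        by apply/funext => m; rewrite addnC.
      by apply: (cvgB cm); exact: cvg_cst.
    by move=> fc; rewrite is_cvg_limn_einfE;
      [apply/cvg_lim|apply/cvg_ex; eexists; exact: fc].
  apply: (@le_trans _ _ (\int[mu]_(x in Omega) ((ul x - uu i x) ^+ 2)%:E)%E).
    apply: ae_ge0_le_integral => //.
    - by move=> x _; rewrite lee_fin sqr_ge0.
    - by apply/measurable_EFinP; apply: measurable_funX;
        apply: measurable_funB => //; exact: (Lu _).1.
    - by move=> x _; rewrite lee_fin sqr_ge0.
    - by apply/measurable_EFinP; apply: measurable_funX; apply: measurable_funB.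
    - apply: filterS aeE => x Ex Ox; rewrite /uu patchE mem_set//; exact: Ex.
  rewrite (eq_integral (fun x => limn_einf (f ^~ x))); last first.
    by move=> x /[!inE] Ox; rewrite fl.
  apply: (le_trans (fatou mu mO mf _)); first by move=> m x _;
    rewrite lee_fin sqr_ge0.
  apply: limn_einf_le => m.
  apply: (@le_trans _ _
    (\int[mu]_(x in Omega) ((u (i + m)%N - u i) x * (u (i + m)%N - u i) x)%:E)%E).
    apply: ge0_le_integral => //.
    - by move=> x _; rewrite lee_fin sqr_ge0.
    - exact: measurable_int (L2_integrable_mul (Luv _ _) (Luv _ _)).
    - move=> x Ox; rewrite lee_fin -expr2 /uu !patchE; case: ifP => _ //.
      by rewrite subrr expr0n sqr_ge0.
  by rewrite inner_fin// lee_fin hC// leq_addr.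
have Lul : L2 ul.
  rewrite (_ : ul = (ul - u 0%N) + u 0%N); last by rewrite subrK.
  apply: (subspaceD L2_subspace) => //; split.
    by apply: measurable_funB => //; exact: (Lu _).1.
  by apply: le_lt_trans (key 0%N) _; rewrite ltry.
exists ul => // e e0.
have [N hN] := geometric_lt C00 e0.
exists N => k Nk; rewrite -lte_fin -inner_fin; last 2 first.
- exact: (subspaceB L2_subspace).
- exact: (subspaceB L2_subspace).
apply: le_lt_trans (_ : _ <= (C / 4 ^+ k)%:E)%E _; last by rewrite lte_fin;
  exact: hN.
apply: le_trans (key k); rewrite le_eqVlt; apply/orP; left; apply/eqP.
by apply: eq_integral => x _; congr (_%:E); rewrite -expr2 -sqrrN opprB.
Unshelve. all: by end_near.
Qed.

End L2_theory.

(** * Test functions *)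

Section test_functions.
Context {R : realType} {d : nat}.
Implicit Types (u v w : 'rV[R]_d -> R) (e x z a : 'rV[R]_d) (A K Omega :
  set 'rV[R]_d) (i : 'I_d).
Local Notation mu := (lebesgue d : {measure set 'rV[R]_d -> \bar R}).

Lemma row_compact_closed K : compact K -> closed K.
Proof. by apply: compact_closed; exact: norm_hausdorff. Qed.

Lemma test_of_compact Omega w K : smooth w -> compact K -> K `<=` Omega ->
  (forall x, w x != 0 -> K x) -> test_function Omega w.
Proof.
move=> sw cK KO wK.
have sK : closure [set x | w x != 0] `<=` K.
  by rewrite [X in _ `<=` X](closure_id _).1;
    [apply: closure_subset|exact: row_compact_closed].
split=> //; last exact: subset_trans KO.
by apply: (subclosed_compact _ cK) => //; exact: closed_closure.
Qed.

Definition supp w := closure [set x | w x != 0].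

Lemma suppW w x : w x != 0 -> supp w x.
Proof. by move=> wx; apply: (@subset_closure _ [set x | w x != 0]). Qed.

Lemma suppP w x : ~ supp w x -> w x = 0.
Proof. by move=> h; apply/eqP/negPn/negP => /suppW. Qed.

(** The extreme value theorem. *)
Lemma continuous_bounded_on_compact w K : continuous w -> compact K ->
  exists2 C : R, 0 <= C & forall x, K x -> `|w x| <= C.
Proof.
move=> cw cK; have [->|/set0P K0] := eqVneq K set0; first by exists 0.
have [|c cK' hc] := @EVT_max_rV _ _ (fun x => `|w x|) K K0 cK.
  apply: continuous_subspaceT => x; apply: continuous_comp; first exact: cw.
  exact: norm_continuous.
by exists `|w c| => // x Kx; apply: hc; rewrite inE.
Qed.

Lemma test_bounded Omega w : test_function Omega w ->
  exists2 C : R, 0 <= C & forall x, `|w x| <= C.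
Proof.
move=> [sw cw _]; have [C C0 hC] :=
  continuous_bounded_on_compact (smooth_continuous sw) cw.
exists C => // x; have [/hC//|/suppP->] := pselect (supp w x).
by rewrite normr0.
Qed.

Lemma test_subspace Omega : subspace (test_function Omega).
Proof.
split.
  apply: (@test_of_compact _ _ set0) => //; first exact: smooth_cst.
    exact: compact0.
  by move=> x /eqP.
move=> c u v [su cu uO] [sv cv vO].
apply: (@test_of_compact _ _ (supp u `|` supp v)).
- exact: (smoothD (smoothZ c su) sv).
- exact: compactU.
- by move=> x [/uO|/vO].
- move=> x h; have [?|/suppP u0] := pselect (supp u x); first by left.
  have [?|/suppP v0] := pselect (supp v x); first by right.
  move: h; rewrite (_ : (c *: u + v) x = c * u x + v x)// u0 v0 mulr0 addr0.
  by rewrite eqxx.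
Qed.

Lemma testM Omega u w : smooth u -> test_function Omega w ->
  test_function Omega (u \* w).
Proof.
move=> su [sw cw wO]; apply: (@test_of_compact _ _ (supp w)) => //;
  first exact: smoothM.
by move=> x; rewrite mulf_eq0 negb_or => /andP[_ /suppW].
Qed.

Lemma supp_derive w e x : ~ supp w x -> 'D_e w x = 0.
Proof.
move=> nwx.
have nx : nbhs x (~` supp w) by apply: open_nbhs_nbhs; split => //;
  apply: closed_openC; exact: closed_closure.
rewrite (@near_eq_derive _ _ _ _ (cst 0)); first by rewrite derive_cst.
by apply: filterS nx => y /suppP.
Qed.

Lemma test_derive Omega w e : test_function Omega w ->
  test_function Omega (fun x => 'D_e w x).
Proof.
move=> [sw cw wO]; apply: (@test_of_compact _ _ (supp w)) => //;
  first exact: smooth_derive.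
by move=> x; apply: contraPP => /supp_derive ->; rewrite eqxx.
Qed.

Lemma test_translate Omega w e : smooth w -> compact (supp w) ->
  (forall x, supp w x -> Omega (x - e)) -> test_function Omega (fun x => w (x + e)).
Proof.
move=> sw cw wO; apply: (@test_of_compact _ _ [set x - e | x in supp w]).
- exact: smooth_translate.
- apply: continuous_compact => //; apply: continuous_subspaceT => x.
  by apply: (@cvgB _ _ _ (nbhs x) _ id (cst e)); [exact: cvg_id|exact: cvg_cst].
- by move=> _ [x wx <-]; exact: wO.
- by move=> x /suppW wx; exists (x + e) => //; rewrite addrK.
Qed.

Lemma smooth_measurable w A : smooth w -> measurable_fun A w.
Proof.
by move=> sw; apply: measurable_funTS; apply: continuous_measurable_row;
  exact: smooth_continuous.
Qed.

Lemma L2_smooth Omega K w : measurable Omega -> compact K -> Omega `<=` K ->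
  smooth w ->
  L2 Omega w.
Proof.
move=> mO cK OK sw.
have mK : measurable K := closed_measurable_row (row_compact_closed cK).
have fO : (mu Omega < +oo)%E.
  apply: (@le_lt_trans _ _ (mu K)); first by apply: le_measure; rewrite ?inE.
  by apply: lebesgue_bounded_lty => //; exact: compact_bounded.
have [C C0 hC] := continuous_bounded_on_compact (smooth_continuous sw) cK.
apply: (L2_of_le mO _ (integrable_cst_finite mO fO (C ^+ 2)));
  first exact: smooth_measurable.
move=> x Ox; rewrite -(real_normK (num_real (w x))) lerXn2r ?nnegrE//.
by apply: hC; exact: OK.
Qed.

Lemma L2_test Omega A w : measurable Omega -> test_function A w -> L2 Omega w.
Proof.
move=> mO [sw cw _]; split; first exact: smooth_measurable.
have mS : measurable (supp w) by apply: closed_measurable_row;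
  exact: closed_closure.
have [_ h] := L2_smooth (measurableI _ _ mO mS) cw (@subIsetr _ _ _) sw.
apply: le_lt_trans h; rewrite le_eqVlt; apply/orP; left; apply/eqP.
rewrite [RHS]integral_mkcondr; apply: eq_integral => x _.
rewrite patchE; case: ifPn => //; rewrite notin_setE => /suppP ->.
by rewrite expr0n.
Qed.

Lemma scaled_derive w (h : R) e x : smooth w -> 'D_(h *: e) w x = h * 'D_e w x.
Proof.
move=> sw; rewrite !deriveE; [|exact: smooth_differentiable..].
by rewrite linearZ.
Qed.

(** Mean value theorem applied twice; the constant is uniform in z because
    the second derivative of a test function is bounded. *)
Lemma test_taylor Omega w e : test_function Omega w ->
  exists2 C : R, 0 <= C & forall z h, `|w (z + h *: e) - w z - h * 'D_e w z| <=
    C * h ^+ 2.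
Proof.
move=> tw; have [sw _ _] := tw; have sDw := smooth_derive e sw.
have [C C0 hC] := test_bounded (test_derive e (test_derive e tw)).
exists C => // z h.
have [t /andP[t0 t1] ->] := smooth_MVT z (h *: e) sw.
rewrite scaled_derive// -mulrBr scalerA.
have [s s01 ->] := smooth_MVT z ((t * h) *: e) sDw.
rewrite scaled_derive// !normrM -[in leRHS]real_normK ?num_real// (ger0_norm t0).
set Y := `|'D_e _ _|; have hY : Y <= C by exact: hC.
have n0 := normr_ge0 h; have Y0 : 0 <= Y := normr_ge0 _.
rewrite (_ : `|h| * (t * `|h| * Y) = (t * Y) * `|h| ^+ 2); last by ring.
by rewrite ler_wpM2r ?sqr_ge0//; nra.
Qed.

End test_functions.

(** * Integration by parts *)

Section integration_by_parts.
Context {R : realType} {d : nat}.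
Implicit Types (u v w : 'rV[R]_d -> R) (e x z a : 'rV[R]_d) (A K Omega :
  set 'rV[R]_d) (i : 'I_d).
Local Notation mu := (lebesgue d : {measure set 'rV[R]_d -> \bar R}).

Lemma integral_translate (f : 'rV[R]_d -> \bar R) e : measurable_fun setT f ->
  (\int[mu]_x f (x + e)%R = \int[mu]_x f x)%E.
Proof.
move=> mf.
(* nonnegative functions first, as a push-forward of the measure *)
have ge0 (g : 'rV[R]_d -> \bar R) : measurable_fun setT g ->
  (forall x, 0 <= g x)%E ->
    (\int[mu]_x g (x + e)%R = \int[mu]_x g x)%E.
  move=> mg g0.
  have := @ge0_integral_pushforward _ _ _ _ R _ (measurable_shift e) mu setT g
    measurableT mg (fun y _ => g0 y).
  rewrite preimage_setT => <-.
  by apply: eq_measure_integral => [|ms A mA _];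
    [exact: measurable_shift|exact: lebesgue_translate].
rewrite integralE [RHS]integralE; congr (_ - _)%E.
  rewrite -(ge0 (f^\+)%E);
    [|exact: measurable_funepos|by move=> x; exact: funepos_ge0].
  by apply: eq_integral => x _; rewrite (funepos_comp f (fun x => x + e)).
rewrite -(ge0 (f^\-)%E);
  [|exact: measurable_funeneg|by move=> x; exact: funeneg_ge0].
by apply: eq_integral => x _; rewrite (funeneg_comp f (fun x => x + e)).
Qed.

Lemma Rintegral_translate (f : 'rV[R]_d -> R) e : measurable_fun setT f ->
  Rintegral mu setT (fun x => f (x + e)) = Rintegral mu setT f.
Proof.
move=> mf; rewrite /Rintegral; congr fine.
by rewrite -(@integral_translate (EFin \o f) e)//; exact/measurable_EFinP.
Qed.

Lemma Rintegral_supp Omega (f : 'rV[R]_d -> R) : (forall x, ~ Omega x -> f x = 0) ->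
  Rintegral mu Omega f = Rintegral mu setT f.
Proof.
move=> f0; rewrite Rintegral_mkcond; congr Rintegral.
by apply/funext => x; rewrite patchE; case: ifPn => //;
  rewrite notin_setE => /f0 ->.
Qed.

Section on_finite.
Variable Omega : set 'rV[R]_d.
Hypotheses (mO : measurable Omega) (fO : (mu Omega < +oo)%E).
Local Notation inner := (@inner R d Omega).
Let sub := L2_subspace mO.
Let form := inner_form mO.

(** Applied to the Taylor remainder r of a translated test function. *)
Lemma inner_le_bound u r c : 0 <= c -> L2 Omega u -> L2 Omega r ->
  (forall x, Omega x -> `|r x| <= c) ->
  `|inner u r| <= c * inner (fun x => `|u x|) (fun=> 1).
Proof.
move=> c0 Lu Lr rc.
have L1 := L2_cst mO fO 1.
have Lau : L2 Omega (fun x => `|u x|).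
  apply: (L2_of_le mO _ (L2_integrable_sqr Lu)).
    by apply: measurableT_comp => //; exact: Lu.1.
  by move=> x _; rewrite real_normK ?num_real.
apply: le_trans (le_normr_Rintegral mO (L2_integrable_mul mO Lu Lr)) _.
rewrite -(formZl sub form)//.
apply: le_Rintegral => //.
- have := integrable_abse (L2_integrable_mul mO Lu Lr).
  by apply: eq_integrable.
- by apply: (L2_integrable_mul mO _ L1); exact: (subspaceZ sub).
- move=> x Ox; rewrite mulr1 normrM mulrC.
  by change (`|r x| * `|u x| <= c * `|u x|); rewrite ler_wpM2r// rc.
Qed.

Lemma L2_test_translate A w a : test_function A w -> L2 Omega (fun z => w (z + a)).
Proof.
by move=> [sw cw _]; apply: (@L2_test _ _ _ setT) => //; exact: test_translate.
Qed.

(** The pairing of u with the translates of a test function is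
    differentiable along e, with a remainder that is uniform in the base
    point a. This replaces differentiation under the integral sign. *)
Lemma inner_taylor A u w e : L2 Omega u -> test_function A w ->
  exists2 K : R, 0 <= K & forall a (h : R),
    `|inner u (fun z => w (z + (a + h *: e))) - inner u (fun z => w (z + a))
      - h * inner u (fun z => 'D_e w (z + a))| <= K * h ^+ 2.
Proof.
move=> Lu tw; have [C C0 hC] := test_taylor e tw.
have L1 := L2_cst mO fO 1.
have Lau : L2 Omega (fun x => `|u x|).
  apply: (L2_of_le mO _ (L2_integrable_sqr Lu)).
    by apply: measurableT_comp => //; exact: Lu.1.
  by move=> x _; rewrite real_normK ?num_real.
exists (C * inner (fun x => `|u x|) (fun=> 1)).
  by rewrite mulr_ge0//; apply: Rintegral_ge0 => x _; rewrite mulr1.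
move=> a h.
have l1 := L2_test_translate (a + h *: e) tw.
have l2 := L2_test_translate a tw.
have l3 := L2_test_translate a (test_derive e tw).
have l4 := subspaceZ sub h l3.
have l5 := subspaceB sub l1 l2.
rewrite -(formZr sub form)// -!(formBr sub form)//.
rewrite mulrAC; apply: inner_le_bound => //; first by rewrite mulr_ge0// sqr_ge0.
  exact: (subspaceB sub).
by move=> x _; rewrite -[leLHS]/(`|w (x + (a + h *: e)) - w (x + a) - h * 'D_e w
  (x + a)|) addrA.
Qed.

End on_finite.

(** The integral of the translates of w is constant, and its derivative
    along e is the integral of the derivative of w. The box Q contains the
    supports of all the translates by h e for |h| <= 1. *)
Lemma integral_derive_test Omega w e : test_function Omega w ->
  Rintegral mu Omega (fun x => 'D_e w x) = 0.
Proof.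
move=> tw; have [sw cw wO] := tw.
rewrite Rintegral_supp; last by move=> x nOx; apply: supp_derive => /wO.
have [M hM] : exists M : R, forall x, supp w x -> forall i, `|x 0 i| <= M.
  have [M [_ /(_ (M + 1))]] := compact_bounded cw; rewrite ltrDl => /(_ ltr01) h.
  by exists (M + 1) => x /h xM i; exact: le_trans (row_norm_coord _ _) xM.
pose N := M + `|e| + 1.
pose Q : set 'rV[R]_d := box (- const_mx N) (const_mx N).
have mQ : measurable Q := measurable_box _ _.
have fQ : (mu Q < +oo)%E := lebesgue_box_lty _ _.
have L1 := L2_cst mQ fQ 1.
have [K K0 hK] := inner_taylor mQ fQ e L1 tw.
have wQ (h : R) x : `|h| <= 1 -> ~ Q x -> ~ supp w (x + h *: e).
  move=> h1 nQ /hM xM; apply: nQ => i; rewrite !mxE -ltr_norml.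
  have := xM i; rewrite !mxE => xi.
  have he : `|h * e 0 i| <= `|e|.
    rewrite normrM; apply: le_trans (row_norm_coord e i).
    by rewrite ler_piMl.
  have := ler_normB (x 0 i + h * e 0 i) (h * e 0 i); rewrite addrK => hx.
  by rewrite /N; lra.
have mw : measurable_fun setT w by exact: smooth_measurable.
have I0 (h : R) : `|h| <= 1 -> inner Q (fun=> 1) (fun z => w (z + h *: e)) =
  Rintegral mu setT w.
  move=> h1; rewrite -(Rintegral_translate (h *: e) mw) -(@Rintegral_supp Q).
    by apply: eq_Rintegral => x _; rewrite mul1r.
  by move=> x nQ; apply: suppP; exact: wQ.
set J := Rintegral _ _ _.
have JE : inner Q (fun=> 1) (fun z => 'D_e w (z + 0)) = J.
  rewrite /J -(@Rintegral_supp Q); last first.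
    by move=> x nQ; apply: supp_derive; have := wQ 0 x;
      rewrite scale0r addr0 normr0; apply.
  by apply: eq_Rintegral => x _; rewrite mul1r addr0.
have hJ (h : R) : 0 < h <= 1 -> `|J| <= K * h.
  move=> /andP[h0 h1]; have := hK 0 h.
  have h1' : `|h| <= 1 by rewrite gtr0_norm.
  rewrite add0r I0// -[in X in _ - X - _](scale0r e) I0 ?normr0// subrr sub0r
    normrN JE.
  by rewrite normrM (gtr0_norm h0) mulrC expr2 mulrA ler_pM2r.
apply/eqP; rewrite -normr_eq0 eq_le normr_ge0 andbT.
apply: (@le0_of_small _ _ K) => h h0.
have [h1|h1] := leP h 1; first by apply: hJ; rewrite h0.
apply: (@le_trans _ _ (K * 1)); first by apply: hJ; rewrite ltr01 lexx.
by rewrite ler_wpM2l// ltW.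
Qed.

(** The integral of the derivative of u w vanishes. *)
Lemma integration_by_parts Omega K u w e : measurable Omega -> compact K ->
  Omega `<=` K ->
  smooth u -> test_function Omega w ->
  inner Omega u (fun x => 'D_e w x) = - inner Omega (fun x => 'D_e u x) w.
Proof.
move=> mO cK OK su tw; have [sw _ _] := tw.
have Lu := L2_smooth mO cK OK su; have LDu :=
  L2_smooth mO cK OK (smooth_derive e su).
have Lw := L2_test mO tw; have LDw := L2_test mO (test_derive e tw).
apply/eqP; rewrite -addr_eq0 -(integral_derive_test e (testM su tw)); apply/eqP.
rewrite -RintegralD//; try exact: L2_integrable_mul.
apply: eq_Rintegral => x _; rewrite deriveM; [|exact: smooth_derivable..].
by rewrite mulrC [X in _ + X]mulrC addrC /GRing.scale/=; ring.
Qed.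

Lemma compact_cbox (a b : 'rV[R]_d) : compact (cbox a b).
Proof.
rewrite (_ : cbox a b =
  [set x : 'rV[R]_d | forall i, `[a 0 i, b 0 i]%classic (x ord0 i)]).
  by apply: (@rV_compact _ _ (fun i => `[a 0 i, b 0 i]%classic)) => i;
    exact: segment_compact.
by apply/seteqP; split=> x h i; have := h i; rewrite /= in_itv.
Qed.

Lemma bounded_sub_compact Omega : bounded_set Omega ->
  exists2 K, compact K & Omega `<=` K.
Proof.
move=> [M [_ /(_ (M + 1))]]; rewrite ltrDl => /(_ ltr01) h.
exists (cbox (- const_mx (M + 1)) (const_mx (M + 1))); first exact: compact_cbox.
move=> x /h xM i; rewrite !mxE -ler_norml; exact: le_trans (row_norm_coord _ _) xM.
Qed.

Lemma smooth_weak_gradient Omega u : open Omega -> bounded_set Omega -> smooth u ->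
  weak_gradient Omega u (fun i => partial i u).
Proof.
move=> oO bO su i; have [K cK OK] := bounded_sub_compact bO.
have mO := open_measurable_row oO.
split; first by apply: (L2_smooth mO cK OK); exact: smooth_partial.
by move=> w tw; exact: (integration_by_parts (delta_mx 0 i) mO cK OK su tw).
Qed.

End integration_by_parts.

(** * The du Bois-Reymond lemma *)

Section du_bois_reymond.
Context {R : realType} {d : nat}.
Implicit Types (u v w f : 'rV[R]_d -> R) (e x z a b : 'rV[R]_d) (A K Omega :
  set 'rV[R]_d) (i : 'I_d).
Local Notation mu := (lebesgue d : {measure set 'rV[R]_d -> \bar R}).
Variable A : set 'rV[R]_d.
Hypotheses (oA : open A) (fA : (mu A < +oo)%E).
Let mA : measurable A := open_measurable_row oA.
Local Notation inner := (@inner R d A).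

Lemma test_bump a b k : cbox a b `<=` A -> test_function A (bump a b k).
Proof.
move=> abA; apply: (test_of_compact _ (@compact_cbox _ _ a b) abA);
  first exact: smooth_bump.
move=> x bx; have bx' : box a b x.
  by apply: contrapT => /bump_out b0; move: bx; rewrite b0 eqxx.
by move=> i; have /andP[? ?] := bx' i; rewrite !ltW.
Qed.

Lemma L2_integrable f : L2 A f -> mu.-integrable A (EFin \o f).
Proof.
move=> Lf; have := L2_integrable_mul mA Lf (L2_cst mA fA 1).
by apply: eq_integrable => // x _ /=; rewrite mulr1.
Qed.

(** The bump functions of the box converge boundedly to its indicator
    function. *)
Lemma integral_box0 f a b : L2 A f ->
  (forall w, test_function A w -> inner f w = 0) ->
  cbox a b `<=` A -> (\int[mu]_(x in box a b) (f x)%:E = 0)%E.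
Proof.
move=> Lf f0 abA.
have bA : box a b `<=` A.
  by move=> x h; apply: abA => i; have /andP[? ?] := h i; rewrite !ltW.
pose f_ k x := ((f x * bump a b k x)%:E : \bar R).
have mf_ k : measurable_fun A (f_ k).
  by apply/measurable_EFinP; apply: measurable_funM;
    [exact: Lf.1|apply: smooth_measurable; exact: smooth_bump].
have mfl : measurable_fun A ((EFin \o f) \_ (box a b)).
  apply/(measurable_restrict _ (measurable_box a b) mA).
  apply: (measurable_funS mA); first by move=> x [].
  by apply/measurable_EFinP; exact: Lf.1.
have ig := integrable_abse (L2_integrable Lf).
have [|| _ _] := @dominated_convergence _ _ _ mu A mA f_ _ _ mf_ mfl _ ig.
- apply: aeW => x Ax; rewrite patchE; case: ifPn => [/[!inE] xb|].
    apply/cvg_EFin; first by near=> k.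
    rewrite -[X in _ --> X]mulr1; apply: (@cvgM _ _ _ _ (fun=> f x));
      first exact: cvg_cst.
    exact: bump_cvg.
  rewrite notin_setE => xb; rewrite (_ : f_ ^~ x = fun=> 0%E); first exact: cvg_cst.
  by apply/funext => k; rewrite /f_ bump_out// mulr0.
- apply: aeW => x k Ax; rewrite /= lee_fin normrM ler_piMr//.
  by have /andP[b0 b1] := bump_itv a b k x; rewrite ger0_norm.
- rewrite -integral_mkcondr setIidr// => h.
  have {h} : (fun _ : nat => 0%E : \bar R) @ \oo -->
    (\int[mu]_(x in box a b) (f x)%:E)%E.
    rewrite (_ : (fun=> _) = [sequence (\int[mu]_(x in A) f_ n x)%E]_n)//.
    apply/funext => k /=; have tb := test_bump k abA.
    by rewrite /f_ inner_fin// ?f0//; exact: (L2_test mA tb).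
  by move/cvg_lim => <- //; rewrite lim_cst.
Unshelve. all: by end_near.
Qed.

(** The sets on which f has integral zero form a Dynkin system that contains
    the boxes, so f has integral zero on all Borel subsets of the box. *)
Lemma ae_eq0_box f a b : L2 A f ->
  (forall w, test_function A w -> inner f w = 0) ->
  cbox a b `<=` A -> ae_eq_on (box a b) f (fun=> 0).
Proof.
move=> Lf f0 abA.
have bA : box a b `<=` A.
  by move=> x h; apply: abA => i; have /andP[? ?] := h i; rewrite !ltW.
have mb := measurable_box a b.
have ifA : mu.-integrable A (EFin \o f) := L2_integrable Lf.
have ifS S : measurable S -> S `<=` A -> mu.-integrable S (EFin \o f).
  by move=> mS SA; apply: (integrableS mA mS SA).
pose P S := (\int[mu]_(x in S `&` box a b) (f x)%:E = 0)%E.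
have PS S : measurable S -> P S.
  move=> mS; move: (mS); rewrite boxes_generate.
  apply: (@dynkin_induction _ _ boxes P boxes_generate boxes_setI) => {S mS}.
  - by rewrite /P setTI; exact: integral_box0.
  - move=> _ [[a' b'] _ <-]; rewrite /P /=.
    rewrite (_ : box a' b' `&` box a b =
       box (\row_i Num.max (a 0 i) (a' 0 i)) (\row_i Num.min (b 0 i) (b' 0 i))).
      apply: integral_box0 => // x hx; apply: abA => i.
      by have := hx i; rewrite !mxE ge_max le_min => /andP[/andP[-> _] /andP[-> _]].
    apply/seteqP; split=> x /=.
      by move=> [h h'] i; rewrite !mxE gt_max lt_min; have /andP[-> ->] := h i;
        have /andP[-> ->] := h' i.
    move=> h; split => i; have := h i; rewrite !mxE gt_max lt_min.
      by move=> /andP[/andP[_ ->] /andP[_ ->]].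
    by move=> /andP[/andP[-> _] /andP[-> _]].
  - move=> S mS; rewrite /P => S0.
    have : (\int[mu]_(x in box a b) (f x)%:E = 0)%E by exact: integral_box0.
    have BE : box a b = (~` S `&` box a b) `|` (S `&` box a b).
      by rewrite -setIUl setvU setTI.
    have mS1 : measurable (S `&` box a b) by exact: measurableI.
    have mS2 : measurable (~` S `&` box a b) by apply: measurableI => //;
      exact: measurableC.
    rewrite {1}BE integral_setU//.
    + by rewrite S0 adde0.
    + rewrite -setIUl setvU setTI.
      exact: (measurable_int mu (ifS _ mb bA)).
    + by apply/disj_setPS => x [[/= nS _] [S' _]].
  - move=> F mF tF F0; rewrite /P setI_bigcupl integral_bigcup.
    + by apply: eseries0 => k _ _; exact: F0.
    + move: tF => /trivIsetP tF; apply/trivIsetP => i j _ _ ij.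
      by rewrite setIACA tF// set0I.
    + by move=> k; exact: measurableI.
    + apply: ifS; first by apply: bigcupT_measurable => k; exact: measurableI.
      by move=> x [k _ [_ /bA]].
have := @integral_ae_eq _ _ _ mu (box a b) mb (cst 0%E) (EFin \o f)
  (ifS _ mb bA) (measurable_cst _).
move=> /(_ _)H; have : ae_eq mu (box a b) (EFin \o f) (cst 0%E).
  apply: H => S Sb mS; rewrite integral0.
  by have := PS S mS; rewrite /P setIidl.
by apply: filterS => x hx bx; have [] := hx bx.
Qed.

(** An open set is a countable union of boxes whose closures it contains. *)
Lemma du_bois_reymond f : L2 A f ->
  (forall w, test_function A w -> inner f w = 0) -> ae_eq_on A f (fun=> 0).
Proof.
move=> Lf f0; have [F [AF hF]] := open_cover_boxes oA.
have nF k : mu.-negligible [set x | ~ (F k x -> f x = 0)].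
  case: (hF k) => [->|[a [b [-> abA]]]]; last exact: ae_eq0_box.
  by exists set0; split => // x /=; apply.
have := negligible_bigcup nF.
apply: negligibleS => x /= /not_implyP[]; rewrite {1}AF => -[k _ Fk] fx.
by exists k => // /(_ Fk).
Qed.

(** A bound for the functional w |-> inner f w on test functions is a bound
    for f, because the test functions are dense in L2. Density is obtained
    from Hilbert space theory: f has a Riesz representative p in the closure
    of the test functions, and f - p is orthogonal to all of them, so it
    vanishes almost everywhere. *)
Lemma inner_le_of_test f (K : R) : L2 A f -> 0 <= K ->
  (forall w, test_function A w -> inner f w ^+ 2 <= K * inner w w) ->
  inner f f <= K.
Proof.
move=> Lf K0 fK.
have sub := L2_subspace mA; have form := inner_form mA.
have tL w : test_function A w -> L2 A w := @L2_test _ _ A A w mA.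
pose S := form_closure (L2 A) (test_function A) inner.
have testS : forall w, test_function A w -> S w := form_closureW sub form tL.
have subS : subspace S.
  exact: form_closure_subspace sub form (test_subspace A) tL.
have formS : psd_form S inner by apply: psd_form_sub form => p [].
have complS : complete_form S inner.
  move=> u Su cu.
  have [p Lp up] := L2_complete mA fA (fun k => (Su k).1) cu.
  by exists p => //; exact: (form_closure_closed sub form tL Su Lp up).
have [|x [Lx _]|p Sp hp] :=
  @riesz_representation _ _ S inner (fun p => inner f p) (inner f f) subS formS
    complS.
- by move=> c x y [Lx _] [Ly _]; rewrite (formDr sub form) ?(formZr sub form)//;
    exact: (subspaceZ sub).
- exact: (form_cauchy_schwarz sub form).
have [Lp hpw] := Sp.
have fp : ae_eq_on A f p.
  have : ae_eq_on A (f - p) (fun=> 0).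
    apply: du_bois_reymond; first exact: (subspaceB sub).
    move=> w tw; have Lw := L2_test mA tw.
    by rewrite (formBl sub form)// hp ?subrr//; exact: testS.
  by apply: filterS => x h Ax; apply/eqP; rewrite -subr_eq0; apply/eqP; exact: h.
set a := inner f f.
have app : inner p p = a by rewrite hp//; case: form => sym _ _;
  rewrite sym// -(inner_ae mA Lf Lp Lf fp).
have afp : inner f p = a by rewrite -hp.
have a0 : 0 <= a by case: form => _ _; apply.
have : a * a - K * a <= 0.
  apply: (@le0_of_small _ _ (2 * a + 3 * K)) => dl dl0.
  pose e := Num.min dl 1; have e0 : 0 < e by rewrite lt_min dl0 ltr01.
  have [e1 e2] : e <= dl /\ e <= 1 by rewrite /e; split; rewrite ge_min lexx ?orbT.
  have [w tw hw] := hpw (e ^+ 2 / (a + 1))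
    ltac:(by rewrite divr_gt0 ?exprn_gt0//; lra).
  have Lw := L2_test mA tw; have Lpw := subspaceB sub Lp Lw.
  set r := inner (p - w) (p - w) in hw.
  have r0 : 0 <= r by case: form => _ _; apply.
  have rh : r * (a + 1) < e ^+ 2 by rewrite -ltr_pdivlMr//; lra.
  have c1 : inner f (p - w) ^+ 2 <= e ^+ 2.
    by apply: le_trans (form_cauchy_schwarz sub form Lf Lpw) _; rewrite -/a -/r;
      nra.
  have c2 : inner p (p - w) ^+ 2 <= e ^+ 2.
    by apply: le_trans (form_cauchy_schwarz sub form Lp Lpw) _; rewrite app -/r;
      nra.
  have n1 : `|inner f (p - w)| <= e by rewrite -ler_sqr ?nnegrE ?(ltW e0)//
    real_normK ?num_real.
  have n2 : `|inner p (p - w)| <= e by rewrite -ler_sqr ?nnegrE ?(ltW e0)//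
    real_normK ?num_real.
  have re : r <= e by nra.
  have fw : inner f w = a - inner f (p - w).
    by rewrite (formBr sub form)// afp; ring.
  have ww : inner w w = a - 2 * inner p (p - w) + r.
    rewrite /r (formBr sub form)// !(formBl sub form) ?(formBr sub form)// app.
    by case: form => sym _ _; rewrite (sym w p)//; ring.
  have := fK w tw; rewrite fw ww.
  move: n1 n2; rewrite !ler_norml => /andP[? ?] /andP[? ?] h.
  have h2 : K * (a - 2 * inner p (p - w) + r) <= K * (a + 3 * e) by rewrite
    ler_wpM2l//; lra.
  have h3 : a * a - 2 * a * e <= (a - inner f (p - w)) ^+ 2 by nra.
  apply: (@le_trans _ _ ((2 * a + 3 * K) * e)); first by lra.
  by rewrite ler_wpM2l//; lra.
by nra.
Qed.

End du_bois_reymond.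

(** * The translation estimate *)

(** A mean value inequality without differentiability: cut [0, 1] into N
    steps and let N grow. *)
Lemma telescoping_bound {R : realType} (phi : R -> R) (m K : R) : 0 <= K ->
  (forall s h, 0 <= s <= 1 -> 0 <= h -> `|phi (s + h) - phi s| <= m * h +
    K * h ^+ 2) ->
  `|phi 1 - phi 0| <= m.
Proof.
move=> K0 h; rewrite -subr_le0; apply: (@le0_of_small _ _ K) => e e0.
pose N := (Num.truncn e^-1).+1; have N0 : 0 < N%:R :> R by rewrite ltr0n.
have Ne : N%:R^-1 < e.
  by rewrite -[e]invrK ltf_pV2 ?posrE ?invr_gt0// truncnS_gt.
have step k : (k <= N)%N -> `|phi (k%:R / N%:R) - phi 0| <=
  k%:R * (m / N%:R + K / N%:R ^+ 2).
  elim: k => [|k IH] kN; first by rewrite !mul0r subrr normr0.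
  have -> : phi (k.+1%:R / N%:R) - phi 0 =
    (phi (k%:R / N%:R + N%:R^-1) - phi (k%:R / N%:R)) + (phi (k%:R / N%:R) - phi 0).
    by rewrite addrA subrK -natr1 mulrDl mul1r.
  apply: le_trans (ler_normD _ _) _.
  rewrite -natr1 mulrDl mul1r addrC lerD ?IH 1?ltnW//.
  apply: le_trans (h _ _ _ _) _; last by rewrite exprVn.
    by rewrite divr_ge0//= ler_pdivrMr// mul1r ler_nat ltnW.
  by rewrite invr_ge0.
have := step N (leqnn N); rewrite divff ?gt_eqF// => H.
have E : N%:R * (m / N%:R + K / N%:R ^+ 2) = m + K / N%:R.
  by field; rewrite gt_eqF.
rewrite E in H; rewrite lerBlDl; apply: le_trans H _.
by rewrite lerD2l ler_wpM2l// ltW.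
Qed.

Lemma segment_source {R : realType} {X : lmodType R} (A S : set X) (e : X) :
  (forall x (s : R), A x -> 0 <= s <= 1 -> S (x + s *: e)) -> A `<=` S.
Proof.
by move=> AS x Ax; rewrite -[x]addr0 -(scale0r e); apply: AS; rewrite ?lexx ?ler01.
Qed.

Lemma segment_target {R : realType} {X : lmodType R} (A S : set X) (e : X) :
  (forall x (s : R), A x -> 0 <= s <= 1 -> S (x + s *: e)) ->
  forall x, A x -> S (x + e).
Proof.
by move=> AS x Ax; rewrite -(scale1r e); apply: AS; rewrite ?lexx ?ler01.
Qed.

Section translation.
Context {R : realType} {d : nat}.
Implicit Types (u v w f : 'rV[R]_d -> R) (g : 'I_d -> 'rV[R]_d -> R)
  (e x z a b : 'rV[R]_d) (A B K : set 'rV[R]_d) (i : 'I_d).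
Local Notation mu := (lebesgue d : {measure set 'rV[R]_d -> \bar R}).
Variable Omega : set 'rV[R]_d.
Hypotheses (oO : open Omega) (fO : (mu Omega < +oo)%E).
Let mO : measurable Omega := open_measurable_row oO.
Local Notation inner := (@inner R d).
Let sub := L2_subspace mO.
Let form := inner_form mO.

(** The derivative along e computed from the weak gradient g. *)
Definition dirgrad g e : 'rV[R]_d -> R := \sum_i e 0 i *: g i.

Lemma L2_dirgrad g e : (forall i, L2 Omega (g i)) -> L2 Omega (dirgrad g e).
Proof. by move=> Lg; apply: (subspace_sum sub) => i; exact: (subspaceZ sub). Qed.

Lemma weak_gradient_dir u g e w : L2 Omega u -> weak_gradient Omega u g ->
  test_function Omega w ->
  inner Omega u (fun x => 'D_e w x) = - inner Omega (dirgrad g e) w.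
Proof.
move=> Lu ug tw; have [sw _ _] := tw.
have Lw := L2_test mO tw.
have Lp i : L2 Omega (partial i w) := L2_test mO (test_derive (delta_mx 0 i) tw).
have -> : (fun x => 'D_e w x) = \sum_i e 0 i *: partial i w.
  apply/funext => x; rewrite derive_sum_partial; last exact: smooth_differentiable.
  by rewrite fct_sumE; apply: eq_bigr.
rewrite (form_sumr sub form)//; last by move=> i; exact: (subspaceZ sub).
rewrite (form_suml sub form)//; last by move=> i; apply: (subspaceZ sub);
  exact: (ug i).1.
rewrite -sumrN; apply: eq_bigr => i _.
rewrite (formZr sub form)// (formZl sub form)//; last exact: (ug i).1.
by rewrite (ug i).2// mulrN.
Qed.

(** The constant is not sharp: what matters is that it is locally bounded in
    e. *)
Lemma dirgrad_le g e (c : R) : (forall i, L2 Omega (g i)) ->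
  (forall i, `|e 0 i| <= c) ->
  inner Omega (dirgrad g e) (dirgrad g e) <= 2 ^+ d * c ^+ 2 * innerv Omega g g.
Proof.
move=> Lg ec; apply: le_trans (form_sqr_sum_le sub form _ _) _.
  by move=> i; exact: (subspaceZ sub).
rewrite /index_enum -enumT size_enum_ord -mulrA ler_wpM2l ?exprn_ge0//.
rewrite /innerv mulr_sumr enumT; apply: ler_sum => i _.
rewrite (formZl sub form)//; last exact: (subspaceZ sub).
rewrite (formZr sub form)// mulrA -expr2 ler_wpM2r//.
  by case: form => _ _; apply.
rewrite -[e 0 i ^+ 2]real_normK ?num_real// lerXn2r ?nnegrE//.
exact: le_trans (ec i).
Qed.

Lemma restrict_measurable u : measurable_fun Omega u ->
  measurable_fun setT (u \_ Omega).
Proof. by move=> mu_; apply: (measurable_restrictT _ mO).1. Qed.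

Lemma L2_translate A u e : measurable A -> L2 Omega u ->
  (forall x, A x -> Omega (x + e)) -> L2 A (fun x => u (x + e)).
Proof.
move=> mA Lu AO; pose U := u \_ Omega.
have mU : measurable_fun setT U := restrict_measurable Lu.1.
have UE x : A x -> U (x + e) = u (x + e).
  by move=> Ax; rewrite /U patchE mem_set//; exact: AO.
have mUe : measurable_fun setT (fun x => U (x + e)).
  by apply: measurableT_comp => //; exact: measurable_shift.
have mUT : measurable_fun setT (fun x => (U x ^+ 2)%:E : \bar R).
  by apply/measurable_EFinP; exact: measurable_funX.
split.
  apply: (eq_measurable_fun (fun x => U (x + e))); last exact: measurable_funTS.
  by move=> x /[!inE] Ax; rewrite UE.
apply: (@le_lt_trans _ _ (\int[mu]_x (U (x + e)%R ^+ 2)%:E)%E).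
  rewrite (eq_integral (fun x => (U (x + e)%R ^+ 2)%:E)); last first.
    by move=> x /[!inE] Ax; rewrite UE.
  apply: ge0_subset_integral => //.
    by apply/measurable_EFinP; exact: measurable_funX.
  by move=> x _; rewrite lee_fin sqr_ge0.
rewrite (integral_translate e mUT).
apply: le_lt_trans Lu.2; rewrite [leRHS]integral_mkcond le_eqVlt; apply/orP;
  left; apply/eqP.
apply: eq_integral => x _; rewrite /U !patchE; case: ifP => // _.
by rewrite expr0n.
Qed.

(** For a test function w on A, the inner product of u(. + e) - u with w is
    phi 1 - phi 0, where phi s is the integral of u against the translate of
    w by - s e. This translate is a test function on Omega, by the
    assumption on the segments, so that phi has a derivative that is the
    inner product of the weak derivative of u with a function whose norm is
    at most that of w. *)
Lemma translation_estimate A u g e : open A -> L2 Omega u ->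
  weak_gradient Omega u g ->
  (forall x (s : R), A x -> 0 <= s <= 1 -> Omega (x + s *: e)) ->
  inner A ((fun x => u (x + e)) - u) ((fun x => u (x + e)) - u)
  <= inner Omega (dirgrad g (- e)) (dirgrad g (- e)).
Proof.
move=> oA Lu ug AO; have mA := open_measurable_row oA.
have Lg i := (ug i).1.
have AO0 := segment_source AO.
have AO1 := segment_target AO.
have fA : (mu A < +oo)%E by apply: le_lt_trans fO; apply: le_measure; rewrite ?inE.
have LAu : L2 A u.
  have := L2_translate (e := 0) mA Lu.
  rewrite (_ : (fun x => u (x + 0)) = u); last by apply/funext => x; rewrite addr0.
  by apply => x Ax; rewrite addr0; exact: AO0.
have LAue := L2_translate mA Lu AO1.
have subA := L2_subspace mA; have formA := inner_form mA.
set G := inner Omega _ _; have LG := L2_dirgrad (- e) Lg.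
have G0 : 0 <= G by case: form => _ _; apply.
apply: (inner_le_of_test oA fA (subspaceB subA LAue LAu) G0) => w tw.
have [sw cw wA] := tw; have LAw := L2_test mA tw.
have w0 x : ~ A x -> w x = 0 by move=> nAx; apply: suppP => /wA.
pose phi s := inner Omega u (fun z => w (z + s *: (- e))).
have WE : inner A ((fun x => u (x + e)) - u) w = phi 1 - phi 0.
  rewrite (formBl subA formA)//; congr (_ - _).
    rewrite /phi scale1r /inner.
    rewrite (@Rintegral_supp _ _ A); last by move=> x /w0 ->; rewrite mulr0.
    rewrite [RHS]Rintegral_mkcond -[RHS](Rintegral_translate e).
      apply: eq_Rintegral => x _; rewrite patchE addrK.
      have [Ax|/w0 ->] := pselect (A x); last by rewrite !mulr0; case: ifP.
      by rewrite mem_set//; exact: AO1.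
    apply: restrict_measurable; apply: measurable_funM; first exact: Lu.1.
    by apply: smooth_measurable; exact: smooth_translate.
  rewrite /phi scale0r /inner.
  rewrite (@Rintegral_supp _ _ A); last by move=> x /w0 ->; rewrite mulr0.
  rewrite (@Rintegral_supp _ _ Omega); last first.
    by move=> x nO; rewrite addr0 w0 ?mulr0// => /AO0.
  by apply: eq_Rintegral => x _; rewrite addr0.
have twt s : 0 <= s <= 1 -> test_function Omega (fun z => w (z + s *: (- e))).
  move=> s01; apply: test_translate => // x /wA Ax.
  by rewrite -scalerN opprK; exact: AO.
have W0 : 0 <= inner A w w by case: formA => _ _; apply.
pose m := Num.sqrt (G * inner A w w).
have m2 : m ^+ 2 = G * inner A w w by rewrite sqr_sqrtr// mulr_ge0.
have Wt s : 0 <= s <= 1 -> inner Omega (fun z => w (z + s *: (- e)))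
  (fun z => w (z + s *: (- e))) <= inner A w w.
  move=> /twt tws; have tT : test_function setT w by split.
  have LT := L2_test (@measurableT _ _) tT.
  have LTs : L2 setT (fun z => w (z + s *: (- e))).
    by apply: (@L2_test _ _ _ setT) => //; exact: test_translate.
  rewrite [leRHS](@Rintegral_supp _ _ A); last by move=> x /w0 ->; rewrite mulr0.
  rewrite -(@Rintegral_translate _ _ (fun x => w x * w x) (s *: (- e))); last first.
    by apply: measurable_funM; exact: smooth_measurable.
  rewrite {1}/inner Rintegral_mkcond; apply: le_Rintegral => //.
  - rewrite -restrict_EFin; apply: (integrable_mkcond _ mO).1.
    have i1 := L2_integrable_mul mO (L2_test mO tws) (L2_test mO tws). exact: i1.
  - exact: (L2_integrable_mul (@measurableT _ _) LTs LTs).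
  - by move=> x _; rewrite patchE; case: ifP => _ //; rewrite -expr2 sqr_ge0.
have Dphi s : 0 <= s <= 1 ->
  `|inner Omega u (fun z => 'D_(- e) w (z + s *: (- e)))| <= m.
  move=> s01; have tws := twt s s01.
  have -> : (fun z => 'D_(- e) w (z + s *: (- e))) =
    (fun z => 'D_(- e) (fun z => w (z + s *: (- e))) z).
    by apply/funext => z; rewrite derive_translate.
  rewrite (weak_gradient_dir (-e) Lu ug tws) normrN.
  rewrite -ler_sqr ?nnegrE ?sqrtr_ge0// real_normK ?num_real// m2.
  apply: le_trans (form_cauchy_schwarz sub form LG (L2_test mO tws)) _.
  by rewrite ler_wpM2l// Wt.
have [K K0 hK] := inner_taylor mO fO (- e) Lu tw.
rewrite WE -[leLHS]real_normK ?num_real// -m2 lerXn2r ?nnegrE ?sqrtr_ge0//.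
apply: (telescoping_bound K0) => s h s01 h0.
have := hK (s *: (- e)) h; rewrite -scalerDl => H.
have D1 := Dphi s s01; set D := inner Omega u (fun z => 'D_(- e) w _) in H D1.
move: H; rewrite -/(phi (s + h)) -/(phi s) => H.
have -> : phi (s + h) - phi s = (phi (s + h) - phi s - h * D) + h * D by ring.
apply: le_trans (ler_normD _ _) _; rewrite addrC lerD//.
by rewrite normrM (ger0_norm h0) [leRHS]mulrC ler_wpM2l.
Qed.

End translation.

(** * Poincaré's inequality *)

Section poincare_sets.
Context {R : realType} {d : nat}.
Implicit Types (u v w f : 'rV[R]_d -> R) (g : 'I_d -> 'rV[R]_d -> R)
  (e x y z a b : 'rV[R]_d) (A B K : set 'rV[R]_d) (i : 'I_d).
Local Notation mu := (lebesgue d : {measure set 'rV[R]_d -> \bar R}).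
Variable Omega : set 'rV[R]_d.
Hypotheses (oO : open Omega) (fO : (mu Omega < +oo)%E).
Let mO : measurable Omega := open_measurable_row oO.
Let sub := L2_subspace mO.
Let form := inner_form mO.

Definition sqint A f : \bar R := (\int[mu]_(x in A) (f x ^+ 2)%:E)%E.

(** A Poincare inequality for the functions of H1 Omega restricted to A, but
    with the gradient on the whole of Omega on the right: this is what
    survives translations and unions. The constant c is free, since the mean
    over A would be awkward to follow through a union; I is strictly larger
    than the squared norm of the gradient so that c can be chosen among the
    values of u even when the gradient vanishes. *)
Definition poincare_set A : Prop :=
  exists2 C : R, 0 <= C & forall u g (I : R), L2 Omega u ->
    weak_gradient Omega u g ->
    innerv Omega g g < I -> exists c :
      R, (sqint A (fun x => (u x - c)%R) <= (C * I)%:E)%E.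

Lemma innerv_ge0 g : 0 <= innerv Omega g g.
Proof. by apply: sumr_ge0 => i _; apply: Rintegral_ge0 => x _;
  rewrite -expr2 sqr_ge0. Qed.

Lemma measurable_sqr A f : measurable_fun A f ->
  measurable_fun A (fun x => (f x ^+ 2)%:E : \bar R).
Proof. by move=> mf; apply/measurable_EFinP; exact: measurable_funX. Qed.

Lemma sqint_subset A B f : measurable A -> measurable B -> A `<=` B ->
  measurable_fun B f ->
  (sqint A f <= sqint B f)%E.
Proof.
move=> mA mB AB mf; apply: ge0_subset_integral => //; first exact: measurable_sqr.
by move=> x _; rewrite lee_fin sqr_ge0.
Qed.

(** Subadditivity: the integrand is nonnegative. *)
Lemma sqint_setU A B f : measurable A -> measurable B ->
  measurable_fun (A `|` B) f ->
  (sqint (A `|` B) f <= sqint A f + sqint B f)%E.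
Proof.
move=> mA mB mf; rewrite -(setDUK (B := A `|` B) (@subsetUl _ A B)) /sqint.
have mD : measurable ((A `|` B) `\` A) by apply: measurableD => //;
  exact: measurableU.
rewrite ge0_integral_setU//.
- rewrite leeD2l//; apply: (@sqint_subset _ _ f) => //.
    by move=> x [[]].
  by apply: (measurable_funS (measurableU _ _ mA mB)) mf => x; right.
- by rewrite setDUK//; exact: measurable_sqr.
- by move=> x _; rewrite lee_fin sqr_ge0.
- by apply/disj_setPS => x [Ax [_ /(_ Ax)]].
Qed.

Lemma sqintD_le A f h : measurable A -> measurable_fun A f -> measurable_fun A h ->
  (sqint A (fun x => (f x + h x)%R) <= 2%:E * sqint A f + 2%:E * sqint A h)%E.
Proof.
move=> mA mf mh; rewrite /sqint.
have p0 k : forall x, A x -> (0 <= ((k x : R) ^+ 2)%:E)%E by move=> x _;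
  rewrite lee_fin sqr_ge0.
have [mf2 mh2] := (measurable_sqr mf, measurable_sqr mh).
rewrite -!ge0_integralZl// ?lee_fin//.
rewrite -ge0_integralD//; first last.
- exact: measurable_funeM.
- by move=> x _; rewrite mule_ge0// lee_fin sqr_ge0.
- exact: measurable_funeM.
- by move=> x _; rewrite mule_ge0// lee_fin sqr_ge0.
apply: ge0_le_integral => //; first exact: p0.
- by apply: measurable_sqr; exact: measurable_funD.
- by apply: emeasurable_funD; exact: measurable_funeM.
- move=> x _; rewrite -!EFinM -EFinD lee_fin.
  by have := sqr_ge0 (f x - h x); nra.
- exact: p0.
- exact: p0.
Qed.

Lemma sqint_translate_le A B f e : measurable A -> measurable B ->
  measurable_fun B f ->
  (forall x, A x -> B (x + e)) -> (sqint A (fun x => f (x + e)%R) <= sqint B f)%E.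
Proof.
move=> mA mB mf AB; pose F := f \_ B.
have mF : measurable_fun setT F by apply: (measurable_restrictT _ mB).1.
rewrite /sqint (eq_integral (fun x => (F (x + e)%R ^+ 2)%:E)); last first.
  by move=> x /[!inE] Ax; rewrite /F patchE mem_set//; exact: AB.
have mFe : measurable_fun setT (fun x => (F (x + e)%R ^+ 2)%:E : \bar R).
  by apply: measurable_sqr; apply: measurableT_comp => //; exact: measurable_shift.
apply: (@le_trans _ _ (\int[mu]_x (F (x + e)%R ^+ 2)%:E)%E).
  by apply: ge0_subset_integral => // x _; rewrite lee_fin sqr_ge0.
rewrite (integral_translate e (measurable_sqr mF)) [leRHS]integral_mkcond.
rewrite le_eqVlt; apply/orP; left; apply/eqP.
apply: eq_integral => x _; rewrite /F !patchE; case: ifP => // _.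
by rewrite expr0n.
Qed.

Lemma L2_sub A u : measurable A -> A `<=` Omega -> L2 Omega u -> L2 A u.
Proof.
move=> mA AO [mu_ lu]; split; first exact: measurable_funS mu_.
by apply: le_lt_trans lu; exact: (@sqint_subset A Omega u).
Qed.

Lemma sqint_inner A u : measurable A -> L2 A u -> sqint A u = (inner A u u)%:E.
Proof.
by move=> mA Lu; rewrite -inner_fin//; apply: eq_integral => x _; rewrite -expr2.
Qed.

Lemma translation_estimate_sq A u g e (c : R) : open A -> L2 Omega u ->
  weak_gradient Omega u g ->
  (forall x (s : R), A x -> 0 <= s <= 1 -> Omega (x + s *: e)) ->
  (forall i, `|e 0 i| <= c) ->
  (sqint A (fun x => (u (x + e) - u x)%R) <=
    (2 ^+ d * c ^+ 2 * innerv Omega g g)%:E)%E.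
Proof.
move=> oA Lu ug AO ec; have mA := open_measurable_row oA.
have AO0 := segment_source AO.
have AO1 := segment_target AO.
have L1 := L2_translate oO mA Lu AO1; have L0 := L2_sub mA AO0 Lu.
rewrite (@sqint_inner _ ((fun x => u (x + e)) - u))//;
  last exact: (subspaceB (L2_subspace mA)).
rewrite lee_fin; apply: le_trans (translation_estimate oO fO oA Lu ug AO) _.
apply: (dirgrad_le oO); first by move=> i; exact: (ug i).1.
by move=> i; rewrite mxE normrN.
Qed.

(** On A, u - c is the sum of the increment of u from x to x + e, which the
    translation estimate controls, and of u - c at the point x + e of B. *)
Lemma poincare_translate A B e : open A -> open B -> B `<=` Omega ->
  (forall x (s : R), A x -> 0 <= s <= 1 -> Omega (x + s *: e)) ->
  (forall x, A x -> B (x + e)) -> poincare_set B -> poincare_set A.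
Proof.
move=> oA oB BO AO AB [C C0 hC].
have [mA mB] := (open_measurable_row oA, open_measurable_row oB).
exists (2 * (2 ^+ d * `|e| ^+ 2) + 2 * C).
  by rewrite addr_ge0// ?mulr_ge0 ?exprn_ge0.
move=> u g I Lu ug gI; have [c hc] := hC u g I Lu ug gI; exists c.
have AO0 := segment_source AO.
have AO1 := segment_target AO.
have L1 := L2_translate oO mA Lu AO1; have L0 := L2_sub mA AO0 Lu.
have mBu : measurable_fun B (fun x => u x - c).
  by apply: measurable_funB => //; exact: (L2_sub mB BO Lu).1.
have m1 : measurable_fun A (fun x => - (u (x + e) - u x)).
  by apply: measurable_funN; apply: measurable_funB; [exact: L1.1|exact: L0.1].
have m2 : measurable_fun A (fun x => u (x + e) - c).
  by apply: measurable_funB => //; exact: L1.1.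
have := sqintD_le mA m1 m2.
rewrite (_ : (fun x => _) = fun x => u x - c); last first.
  by apply/funext => x; rewrite opprB addrA subrK.
move=> h; apply: (le_trans h).
have -> : ((2 * (2 ^+ d * `|e| ^+ 2) + 2 * C) * I)%:E =
    (2%:E * (2 ^+ d * `|e| ^+ 2 * I)%:E + 2%:E * (C * I)%:E)%E.
  by rewrite -!EFinM -EFinD; congr (_%:E); ring.
apply: leeD.
  rewrite lee_pmul2l//=.
  rewrite /sqint; under eq_integral do rewrite sqrrN.
  apply: le_trans (translation_estimate_sq (c := `|e|) oA Lu ug AO _) _.
    by move=> i; exact: row_norm_coord.
  by rewrite lee_fin ler_wpM2l ?mulr_ge0 ?exprn_ge0// ltW.
rewrite lee_pmul2l//=; apply: le_trans hc.
exact: (@sqint_translate_le A B (fun x => u x - c)).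
Qed.

(** The constants a and b that are good for A and for B differ by a quantity
    that the inequalities control on the intersection, an open set of
    positive measure; so a is good for B as well. *)
Lemma poincare_setU A B : open A -> open B -> A `<=` Omega -> B `<=` Omega ->
  A `&` B !=set0 -> poincare_set A -> poincare_set B -> poincare_set (A `|` B).
Proof.
move=> oA oB AO BO AB0 [CA CA0 hA] [CB CB0 hB].
have [mA mB] := (open_measurable_row oA, open_measurable_row oB).
have oAB : open (A `&` B) by exact: openI.
have mAB := open_measurable_row oAB.
have fS S : measurable S -> S `<=` Omega -> mu S = (fine (mu S))%:E.
  move=> mS SO; rewrite fineK// ge0_fin_numE//; apply: le_lt_trans fO.
  by apply: le_measure; rewrite ?inE.
have ABO : A `&` B `<=` Omega by move=> x [/AO].
pose mab := fine (mu (A `&` B)); pose mb := fine (mu B).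
have mab0 : 0 < mab by rewrite /mab -lte_fin -fS//; exact: lebesgue_open_gt0.
have mb0 : 0 <= mb by rewrite /mb fine_ge0.
pose CAB := (2 * CA + 2 * CB) / mab.
exists (CA + (2 * CB + 2 * (CAB * mb))).
  by rewrite !addr_ge0// ?mulr_ge0 ?addr_ge0 ?mulr_ge0 ?invr_ge0// ltW.
move=> u g I Lu ug gI.
have [a ha] := hA u g I Lu ug gI; have [b hb] := hB u g I Lu ug gI; exists a.
have mu_ S c : measurable S -> S `<=` Omega -> measurable_fun S (fun x => u x - c).
  by move=> mS SO; apply: measurable_funB => //; exact: (L2_sub mS SO Lu).1.
have I0 : 0 < I by apply: le_lt_trans gI; exact: innerv_ge0.
have cst_sq S c : measurable S -> sqint S (fun=> c) = ((c ^+ 2)%:E * mu S)%E.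
  by move=> mS; rewrite /sqint integral_cst.
have hab : (a - b) ^+ 2 <= CAB * I.
  rewrite /CAB mulrAC ler_pdivlMr// -lee_fin EFinM -fS// -cst_sq//.
  have m1 : measurable_fun (A `&` B) (fun x => - (u x - a)) by apply:
    measurable_funN; exact: mu_.
  have := sqintD_le mAB m1 (mu_ _ b mAB ABO).
  rewrite (_ : (fun x => _) = fun=> a - b); last by apply/funext => x; ring.
  move=> h; apply: (le_trans h).
  have -> : ((2 * CA + 2 * CB) * I)%:E =
    (2%:E * (CA * I)%:E + 2%:E * (CB * I)%:E)%E.
    by rewrite -!EFinM -EFinD; congr (_%:E); ring.
  rewrite {1}/sqint; under [X in (2%:E * X + _)%E]eq_integral do rewrite sqrrN.
  rewrite leeD// lee_pmul2l//=.
    by apply: le_trans ha;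
      exact: (@sqint_subset _ _ (fun x => u x - a) mAB mA (@subIsetl _ _ _)
        (mu_ _ a mA AO)).
  by apply: le_trans hb;
    exact: (@sqint_subset _ _ (fun x => u x - b) mAB mB (@subIsetr _ _ _)
      (mu_ _ b mB BO)).
have UO : A `|` B `<=` Omega by move=> x [/AO|/BO].
apply: (le_trans (sqint_setU mA mB (mu_ _ a (measurableU _ _ mA mB) UO))).
have -> : ((CA + (2 * CB + 2 * (CAB * mb))) * I)%:E =
    ((CA * I)%:E + (2%:E * (CB * I)%:E + 2%:E * (CAB * I * mb)%:E))%E.
  by rewrite -!EFinM -!EFinD; congr (_%:E); ring.
apply: leeD; first exact: ha.
have := sqintD_le mB (mu_ _ b mB BO) (@measurable_cst _ _ _ _ _ (b - a)).
rewrite (_ : (fun x => _) = fun x => u x - a); last by apply/funext => x;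
  rewrite /=; ring.
move=> h; apply: (le_trans h).
apply: leeD; rewrite lee_pmul2l//=.
rewrite cst_sq// fS// -EFinM lee_fin -/mb -sqrrN opprB.
by rewrite ler_wpM2r.
Qed.

End poincare_sets.

Section poincare_box.
Context {R : realType} {d : nat}.
Implicit Types (u v w f : 'rV[R]_d -> R) (g : 'I_d -> 'rV[R]_d -> R)
  (e x y z a b : 'rV[R]_d) (A B K : set 'rV[R]_d) (i : 'I_d).
Local Notation mu := (lebesgue d : {measure set 'rV[R]_d -> \bar R}).
Variable Omega : set 'rV[R]_d.
Hypotheses (oO : open Omega) (fO : (mu Omega < +oo)%E).
Let mO : measurable Omega := open_measurable_row oO.

Lemma measurable_addrow :
  measurable_fun setT (fun p : 'rV[R]_d * 'rV[R]_d => p.1 + p.2).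
Proof.
apply: measurable_fun_coordP => i.
rewrite (_ : (fun _ => _) = fun p : 'rV[R]_d * 'rV[R]_d => p.1 ord0 i + p.2 ord0 i).
  by apply: measurable_funD;
    [exact: (measurableT_comp (measurable_coord i) measurable_fst)
    |exact: (measurableT_comp (measurable_coord i) measurable_snd)].
by apply/funext => x; rewrite mxE.
Qed.

Lemma box_convex a b x y (s : R) : box a b x -> box a b (x + y) ->
  0 <= s <= 1 -> box a b (x + s *: y).
Proof.
move=> bx by_ /andP[s0 s1] i; have /andP[x1 x2] := bx i; have := by_ i;
  rewrite !mxE => /andP[y1 y2].
have key (p q : R) : 0 < p -> 0 < q -> 0 < (1 - s) * p + s * q.
  move=> p0 q0; case: (ltrP s 1) => s1'.
    by rewrite ltr_pwDl// ?mulr_gt0 ?mulr_ge0 ?subr_gt0 ?(ltW q0).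
  by rewrite ltr_wpDl// ?mulr_gt0 ?mulr_ge0 ?subr_ge0 ?(ltW p0)//; lra.
have k1 := key (x 0 i - a 0 i) (x 0 i + y 0 i - a 0 i) ltac:(lra) ltac:(lra).
have k2 := key (b 0 i - x 0 i) (b 0 i - (x 0 i + y 0 i)) ltac:(lra) ltac:(lra).
by apply/andP; split; lra.
Qed.

(** If the inequality failed for c = u y for each y in the box Q, then
    integrating over y, substituting x = y + h and exchanging the integrals
    would contradict the translation estimate, as a box is convex and h
    ranges over a bounded set H. *)
Lemma poincare_box a b : (forall i, a 0 i < b 0 i) -> box a b `<=` Omega ->
  poincare_set Omega (box a b).
Proof.
move=> ab bO; set Q := box a b.
have oQ : open Q by exact: open_box.
have mQ := open_measurable_row oQ.
pose c := \sum_i (b 0 i - a 0 i); have c0 : 0 <= c by apply: sumr_ge0 => i _;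
  rewrite subr_ge0 ltW.
have hc i : b 0 i - a 0 i <= c.
  by rewrite /c (bigD1 i)//= lerDl; apply: sumr_ge0 => j _; rewrite subr_ge0 ltW.
pose H : set 'rV[R]_d := box (- const_mx (c + 1)) (const_mx (c + 1)).
have mH : measurable H := measurable_box _ _.
pose mh := fine (mu H); pose mq := fine (mu Q).
have muH : mu H = mh%:E by rewrite /mh fineK// ge0_fin_numE//;
  exact: lebesgue_box_lty.
have muQ : mu Q = mq%:E by rewrite /mq fineK// ge0_fin_numE//;
  exact: lebesgue_box_lty.
have mh0 : 0 <= mh by rewrite -lee_fin -muH.
have mq0 : 0 < mq.
  have hb : mu Q = (\prod_i (b 0 i - a 0 i))%:E :=
    lebesgue_box (fun i => ltW (ab i)).
  rewrite /mq hb/=.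
  by apply: prodr_gt0 => i _; rewrite subr_gt0.
pose C1 := 2 ^+ d * c ^+ 2.
have C10 : 0 <= C1 by rewrite mulr_ge0 ?exprn_ge0.
exists (C1 * mh / mq + 1).
  by rewrite addr_ge0// divr_ge0 ?mulr_ge0// ltW.
move=> u g I Lu ug gI.
have I0 : 0 < I by apply: le_lt_trans gI; exact: innerv_ge0.
apply: contrapT => /forallNP nc.
pose U := u \_ Omega.
have mU : measurable_fun setT U by apply: (measurable_restrictT _ mO).1;
  exact: Lu.1.
have UE x : Q x -> U x = u x by move=> Qx; rewrite /U patchE mem_set//; exact: bO.
pose F (p : 'rV[R]_d * 'rV[R]_d) : \bar R :=
  (\1_Q p.1 * \1_Q (p.1 + p.2) * (U (p.1 + p.2) - U p.1) ^+ 2)%:E.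
have mF : measurable_fun setT F.
  apply/measurable_EFinP; apply: measurable_funM.
    apply: measurable_funM.
      by apply: measurableT_comp; [exact: measurable_indic|exact: measurable_fst].
    have mQ1 : measurable_fun setT (\1_Q : 'rV[R]_d -> R) by exact:
      measurable_indic.
    exact: (measurableT_comp mQ1 measurable_addrow).
  apply: measurable_funX; apply: measurable_funB.
    exact: (measurableT_comp mU measurable_addrow).
  exact: (measurableT_comp mU measurable_fst).
have F0 p : (0 <= F p)%E.
  by rewrite lee_fin mulr_ge0 ?sqr_ge0// mulr_ge0// indicE.
pose T := (C1 * mh / mq + 1) * I.
have T0 : 0 <= T by rewrite mulr_ge0 ?(ltW I0)// addr_ge0// divr_ge0 ?mulr_ge0//
  ltW.
have low : (T%:E * mq%:E <= \int[mu]_y \int[mu]_h F (y, h))%E.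
  rewrite -muQ -(integral_cst _ mQ) integral_mkcond.
  apply: ge0_le_integral => //.
  - by move=> y _; rewrite patchE; case: ifP; rewrite ?lee_fin.
  - by apply: (measurable_restrictT _ mQ).1; exact: measurable_cst.
  - exact: (@measurable_fun_fubini_tonelli_F _ _ _ _ R (lebesgue d) F mF F0).
  move=> y _; rewrite patchE; case: ifPn => [/[!inE] Qy|_];
    last by apply: integral_ge0.
  have /negP := nc (u y); rewrite -ltNge => /ltW h; apply: (le_trans h).
  rewrite /sqint integral_mkcond.
  have mf : measurable_fun setT ((fun x => ((u x - u y) ^+ 2)%:E) \_ Q : _ ->
    \bar R).
    apply: (measurable_restrictT _ mQ).1; apply: measurable_sqr;
      apply: measurable_funB => //.
    exact: (L2_sub oO mQ bO Lu).1.
  rewrite -(integral_translate y mf).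
  rewrite le_eqVlt; apply/orP; left; apply/eqP; apply: eq_integral => x _.
  rewrite /F /= [(y + x)%R]addrC patchE !indicE (mem_set Qy) mul1r.
  case: ifPn => [/[!inE] Qx|_]; last by rewrite mul0r.
  by rewrite mul1r !UE.
have up : (\int[mu]_y \int[mu]_h F (y, h) <= (C1 * I)%:E * mh%:E)%E.
  rewrite (@fubini_tonelli _ _ _ _ R (lebesgue d) (lebesgue d) F mF F0).
  rewrite -muH -(integral_cst _ mH) [leRHS]integral_mkcond.
  apply: ge0_le_integral => //.
  - by move=> h _; apply: integral_ge0.
  - exact: (@measurable_fun_fubini_tonelli_G _ _ _ _ R (lebesgue d) F mF F0).
  - by apply: (measurable_restrictT _ mH).1; exact: measurable_cst.
  move=> h _; pose A := Q `&` (fun y => y + h) @^-1` Q.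
  have oA : open A.
    apply: openI => //; apply: open_comp => // x _.
    by apply: (@cvgD _ _ _ (nbhs x) _ id (cst h)); [exact: cvg_id|exact: cvg_cst].
  have AE : (\int[mu]_y F (y, h) = sqint A (fun x => (u (x + h) - u x)%R))%E.
    rewrite [RHS]integral_mkcond; apply: eq_integral => x _.
    rewrite /F /= patchE !indicE.
    case: ifPn => [/[!inE] -[Qx Qxh]|]; first by rewrite !mem_set// !mul1r !UE.
    rewrite notin_setE => /not_andP[nQ|nQ].
      by rewrite memNset// !mul0r.
    by rewrite (memNset (A := Q) (u := x + h))// mulr0 mul0r.
  rewrite AE; have [A0|A0] := eqVneq A set0.
    by rewrite A0 /sqint integral_set0 patchE; case: ifP => _ //;
      rewrite lee_fin mulr_ge0// ltW.
  have /set0P[x [Qx Qxh]] := A0.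
  have hci i : `|h 0 i| <= c.
    have /andP[x1 x2] := Qx i; have := Qxh i; rewrite !mxE => /andP[y1 y2].
    by rewrite ler_norml; have := hc i => ?; apply/andP; split; lra.
  rewrite patchE mem_set; last first.
    by move=> i; rewrite !mxE -ltr_norml; apply: le_lt_trans (hci i) _; lra.
  apply: le_trans (@translation_estimate_sq _ _ _ oO fO A u g h c oA Lu ug _ hci) _.
    by move=> y s [Qy Qyh] s01; apply: bO; exact: box_convex.
  by rewrite lee_fin ler_wpM2l// ltW.
have := le_trans low up; rewrite -!EFinM lee_fin /T.
have -> : (C1 * mh / mq + 1) * I * mq = C1 * I * mh + I * mq by field;
  rewrite gt_eqF.
by rewrite gerDl leNgt mulr_gt0.
Qed.

End poincare_box.

Section poincare_global.
Context {R : realType} {d : nat}.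
Implicit Types (u v w f : 'rV[R]_d -> R) (g : 'I_d -> 'rV[R]_d -> R)
  (e x y z a b : 'rV[R]_d) (A B S : set 'rV[R]_d) (i : 'I_d).
Local Notation mu := (lebesgue d : {measure set 'rV[R]_d -> \bar R}).
Variable Omega : set 'rV[R]_d.
Hypotheses (oO : open Omega) (fO : (mu Omega < +oo)%E).
Let mO : measurable Omega := open_measurable_row oO.

(** Induction on the number of remaining pieces: either one of them meets S
    and is merged with it, or S and the union of the remaining ones
    disconnect Omega unless S is all of Omega. *)
Lemma poincare_glue (F : 'rV[R]_d -> set 'rV[R]_d) (l : seq 'rV[R]_d) S :
  connected Omega -> open S -> S `<=` Omega -> S !=set0 -> poincare_set Omega S ->
  (forall x, x \in l ->
    [/\ open (F x), F x `<=` Omega & poincare_set Omega (F x)]) ->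
  (forall y, Omega y -> S y \/ exists2 x, x \in l & F x y) ->
  poincare_set Omega Omega.
Proof.
move=> cO; elim: {l}(size l) {-2}l (erefl (size l)) S => [|m IH] l sl S oS SO S0
  pS hF cov.
  suff OE : Omega = S by rewrite {2}OE.
  apply/seteqP; split=> // y /cov[//|[x]].
  by move/eqP: sl; rewrite size_eq0 => /eqP ->.
have [[x xl [y [Sy Fy]]]|nmeet] := pselect (exists2 x, x \in l & S `&` F x !=set0).
  have [oF FO pF] := hF x xl.
  apply: (IH (rem x l) _ (S `|` F x)).
  - by rewrite size_rem// sl.
  - exact: openU.
  - by move=> z [/SO|/FO].
  - by exists y; left.
  - by apply: poincare_setU => //; exists y.
  - by move=> z /mem_rem; exact: hF.
  - move=> z /cov[Sz|[w wl Fw]]; first by left; left.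
    have := perm_mem (perm_to_rem xl) w; rewrite wl inE => /esym/orP[/eqP wx|wr].
      by left; right; rewrite -wx.
    by right; exists w.
suff OE : Omega = S by rewrite {2}OE.
pose W := \bigcup_(x in [set x | x \in l]) F x.
have oW : open W by apply: bigcup_open => x xl; case: (hF x xl).
apply/esym; apply: cO => //.
  by exists S => //; apply/seteqP; split=> [z Sz|z []//]; split => //; exact: SO.
exists (~` W); first exact: open_closedC.
apply/seteqP; split=> z.
  move=> Sz; split; first exact: SO.
  by move=> [x xl Fz]; apply: nmeet; exists x => //; exists z.
move=> [/cov[//|[x xl Fz]] nW]; exfalso; apply: nW; by exists x.
Qed.

Lemma poincare_of_local : connected Omega -> bounded_set Omega -> Omega !=set0 ->
  (forall x, closure Omega x ->
    exists U, [/\ open U, U x & poincare_set Omega (U `&` Omega)]) ->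
  poincare_set Omega Omega.
Proof.
move=> cO bO [x0 Ox0] loc.
have [K cK OK] := bounded_sub_compact bO.
have ccl : compact (closure Omega).
  apply: (subclosed_compact (@closed_closure _ _) cK).
  rewrite [X in _ `<=` X](closure_id _).1; last exact: row_compact_closed.
  exact: closure_subset.
have /choice[U hU] x : exists U : set 'rV[R]_d, closure Omega x ->
    [/\ open U, U x & poincare_set Omega (U `&` Omega)].
  have [cx|nx] := pselect (closure Omega x); last by exists set0 => /nx.
  by have [U hU] := loc x cx; exists U.
move: ccl; rewrite compact_cover => /(_ _ (closure Omega) U)[|x cx|D' sD' cov].
- by move=> x /hU[].
- by exists x => //; case: (hU x cx).
have clO : Omega `<=` closure Omega := @subset_closure _ Omega.
have h0 := hU x0 (clO _ Ox0).
apply: (@poincare_glue (fun x => U x `&` Omega) (finmap.enum_fset D')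
  (U x0 `&` Omega)) => //.
- by apply: openI => //; case: h0.
- by exists x0; split => //; case: h0.
- by case: h0.
- move=> x /sD'; rewrite inE => cx; have [oU Ux pU] := hU x cx.
  by split => //; exact: openI.
- move=> y Oy; right; have [x xD Uy] := cov y (clO _ Oy).
  by exists x.
Qed.

(** Among all constants c, the mean of u minimizes the L2 distance from u to
    c. *)
Lemma poincare_inequality : poincare_set Omega Omega ->
  exists2 C : R, 0 <= C & forall u g, L2 Omega u -> weak_gradient Omega u g ->
    mean_zero Omega u -> inner Omega u u <= C * innerv Omega g g.
Proof.
move=> [C C0 hC]; exists C => // u g Lu ug u0.
have sub := L2_subspace mO; have form := inner_form mO.
rewrite -subr_le0; apply: (@le0_of_small _ _ C) => e e0.
have [|c hc] := hC u g (innerv Omega g g + e) Lu ug; first by rewrite ltrDl.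
have L1 := L2_cst mO fO (- c).
have Luc := subspaceD sub Lu L1.
move: hc; rewrite (sqint_inner mO Luc) lee_fin => hc.
have : inner Omega u u <= inner Omega (u + (fun=> - c)) (u + (fun=> - c)).
  rewrite !(formDl form)// !(formDr sub form)//.
  have i0 : inner Omega u (fun=> - c) = 0.
    have := L2_cst mO fO 1 => L1'.
    rewrite (_ : (fun=> - c) = (- c) *: ((fun=> 1) : 'rV[R]_d -> R)); last first.
      by apply/funext => x; change (- c = - c * 1); rewrite mulr1.
    rewrite (formZr sub form)// /inner.
    rewrite (_ : Rintegral _ _ _ = 0) ?mulr0// -[RHS]u0.
    by apply: eq_Rintegral => x _; rewrite mulr1.
  have i1 : inner Omega (fun=> - c) u = 0 by case: form => sym _ _; rewrite sym.
  have : 0 <= inner Omega (fun=> - c) (fun=> - c) by case: form => _ _; apply.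
  by rewrite i0 i1; lra.
by lra.
Qed.

End poincare_global.

Section lipschitz.
Context {R : realType} {n : nat}.
Local Notation mu := (lebesgue n.+1 : {measure set 'rV[R]_n.+1 -> \bar R}).
Variable Omega : set 'rV[R]_n.+1.
Hypotheses (oO : open Omega) (fO : (mu Omega < +oo)%E).

Lemma row_norm_le m (x : 'rV[R]_m) (M : R) : 0 <= M ->
  (forall i, `|x 0 i| <= M) -> `|x| <= M.
Proof.
move=> M0 h; rewrite [leLHS]/Num.norm/= mx_normrE;
  apply: bigmax_le => // -[i j] _ /=.
by rewrite (ord1 i).
Qed.

Lemma row_mul_le (Q : 'M[R]_n.+1) : exists2 q : R, 0 <= q &
  forall (v : 'rV[R]_n.+1) j, `|(v *m Q) 0 j| <= q * `|v|.
Proof.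
exists (\sum_j \sum_k `|Q k j|).
  by apply: sumr_ge0 => j _; apply: sumr_ge0.
move=> v j; rewrite mxE; apply: le_trans (ler_norm_sum _ _ _) _.
apply: (@le_trans _ _ ((\sum_k `|Q k j|) * `|v|)).
  rewrite mulr_suml; apply: ler_sum => k _; rewrite normrM mulrC ler_wpM2l//.
  exact: row_norm_coord.
rewrite ler_wpM2r// [leRHS](bigD1 j)//= lerDl.
by apply: sumr_ge0 => ? _; apply: sumr_ge0.
Qed.

Lemma ball_shift_sub (x : 'rV[R]_n.+1) (r0 : R) e y (r : R) :
  ball x r y -> r + `|e| <= r0 -> ball x r0 (y + e).
Proof.
rewrite mx_norm_ball /ball_/= => xy re.
rewrite opprD addrA; apply: le_lt_trans (ler_normB _ _) _.
by apply: lt_le_trans re; rewrite ltrD2r.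
Qed.

(** In the coordinates y Q, the set Omega lies above the graph of gamma near
    x. Let e1 be the upward direction. The points of Omega in a small ball
    around x can be moved upward by tau e1 without leaving Omega, and for a
    ball that is small compared with tau, in terms of the Lipschitz constant
    of gamma, they land in a ball around x + tau e1 that lies in Omega. In
    the maximum norm this ball is a box. *)
Lemma poincare_near_boundary x : lipschitz_boundary Omega -> closure Omega x ->
  ~ Omega x ->
  exists U, [/\ open U, U x & poincare_set Omega (U `&` Omega)].
Proof.
move=> lip cx nOx.
have [Q [gam [QQ lg chart]]] : exists (Q : 'M[R]_n.+1) (gamma : 'rV[R]_n -> R),
    [/\ Q *m Q^T = 1%:M, lipschitz gamma
      & \forall y \near x,
          Omega y <-> gamma (col' ord_max (y *m Q)) < (y *m Q) 0 ord_max].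
  by apply: lip; split => // /interior_subset.
have /nbhs_ballP[/= r0 r00 {}chart] := chart.
have [L L0 hL] : exists2 L : R, 0 <= L & forall y z, `|gam y - gam z| <=
  L * `|y - z|.
  move: lg => [M [_ /(_ (`|M| + 1))]].
  have -> : M < `|M| + 1 by have := ler_norm M; lra.
  move=> /(_ isT) h; exists (`|M| + 1); first by have := normr_ge0 M; lra.
  by move=> y z; exact: (h (y, z) (conj I I)).
have [q q0 hq] := row_mul_le Q.
pose e1 : 'rV[R]_n.+1 := delta_mx 0 ord_max *m Q^T.
have e1Q : e1 *m Q = delta_mx 0 ord_max.
  by rewrite /e1 -mulmxA (mulmx1C QQ) mulmx1.
have shiftcol (y : 'rV[R]_n.+1) (s : R) : col' ord_max ((y + s *: e1) *m Q) =
  col' ord_max (y *m Q).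
  apply/rowP => i; rewrite mulmxDl -scalemxAl e1Q !mxE eqxx/=.
  by rewrite eq_sym (negbTE (neq_lift _ _)) mulr0 addr0.
have shiftlast (y : 'rV[R]_n.+1) (s : R) : ((y + s *: e1) *m Q) 0 ord_max =
  (y *m Q) 0 ord_max + s.
  by rewrite mulmxDl -scalemxAl e1Q !mxE !eqxx mulr1.
have colle (v : 'rV[R]_n.+1) : `|col' ord_max (v *m Q)| <= q * `|v|.
  by apply: row_norm_le => [|i]; rewrite ?mulr_ge0// mxE.
pose tau := r0 / (2 * (`|e1| + 1)).
have ne1 := normr_ge0 e1.
have tau0 : 0 < tau by rewrite divr_gt0// mulr_gt0//; lra.
have taue : tau * `|e1| <= r0 / 2.
  rewrite /tau; have -> : r0 / (2 * (`|e1| + 1)) * `|e1| =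
    r0 / 2 * (`|e1| / (`|e1| + 1)).
    by field; rewrite gt_eqF//; lra.
  rewrite ler_piMr//; first by rewrite divr_ge0// ltW.
  by rewrite ler_pdivrMr; lra.
pose k := 2 * ((1 + L) * q) + 1.
have Lq0 : 0 <= (1 + L) * q by rewrite mulr_ge0//; lra.
have k0 : 0 < k by rewrite /k; lra.
(* rho is small compared with tau: two points of the ball around x differ by
   less than 2 rho, which changes their height above the graph by less than
   tau *)
pose rho := Num.min (r0 / 2) (tau / k).
have rho0 : 0 < rho by rewrite lt_min !divr_gt0.
have rho1 : rho <= r0 / 2 by rewrite /rho ge_min lexx.
have rho2 : rho * k <= tau by rewrite -ler_pdivlMr// /rho ge_min lexx orbT.
have [y0 [Oy0 By0]] : (Omega `&` ball x rho) !=set0 by apply: cx;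
  exact: nbhsx_ballx.
(* moving upward increases the last coordinate and keeps the others *)
have up (y : 'rV[R]_n.+1) (s : R) : ball x rho y -> Omega y -> 0 <= s <= 1 ->
  Omega (y + s *: (tau *: e1)).
  move=> By Oy /andP[s0 s1].
  have st : `|s *: (tau *: e1)| <= r0 / 2.
    rewrite normrZ (ger0_norm s0) normrZ (gtr0_norm tau0).
    by apply: le_trans taue; rewrite ler_piMl// mulr_ge0// ltW.
  have Bys : ball x r0 (y + s *: (tau *: e1)) by apply: (ball_shift_sub By); lra.
  apply: (chart _ Bys).2; rewrite scalerA shiftcol shiftlast.
  have Br : ball x r0 y by apply: (le_ball _ By); lra.
  by apply: ltr_wpDr; [rewrite mulr_ge0// ltW|exact: (chart _ Br).1].
(* z is compared with a point y0 of Omega in the ball: the height of z above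
   the graph is that of y0, plus tau, up to an error below tau *)
have target (z : 'rV[R]_n.+1) : ball (x + tau *: e1) rho z -> Omega z.
  move=> Bz; pose v := z - (y0 + tau *: e1).
  have zE : z = (y0 + v) + tau *: e1.
    by rewrite addrAC /v [_ + (z - _)]addrC subrK.
  have nv : `|v| < 2 * rho.
    have n1 : `|x + tau *: e1 - z| < rho by move: Bz; rewrite mx_norm_ball.
    have n2 : `|x - y0| < rho by move: By0; rewrite mx_norm_ball.
    have -> : v = (x - y0) - (x + tau *: e1 - z).
      by rewrite /v !opprD !opprK !addrA [x - y0 - x]addrAC subrr add0r
        [RHS]addrC addrA.
    by apply: le_lt_trans (ler_normB _ _) _; lra.
  have nte : `|tau *: e1| <= r0 / 2 by rewrite normrZ (gtr0_norm tau0).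
  have Bz0 : ball x r0 z.
    have n1 : `|x + tau *: e1 - z| < rho by move: Bz; rewrite mx_norm_ball.
    rewrite mx_norm_ball /ball_/= (_ : x - z = (x + tau *: e1 - z) - tau *: e1);
      last first.
      by rewrite addrAC addrK.
    by apply: le_lt_trans (ler_normB _ _) _; lra.
  apply: (chart _ Bz0).2; rewrite zE -[tau *: e1]scale1r scale1r shiftcol
    shiftlast mulmxDl.
  have Br : ball x r0 y0 by apply: (le_ball _ By0); lra.
  have gy0 := (chart _ Br).1 Oy0.
  have h1 : gam (col' ord_max (y0 *m Q + v *m Q)) - gam (col' ord_max (y0 *m Q))
    <= L * (q * `|v|).
    apply: le_trans (ler_norm _) _; apply: le_trans (hL _ _) _; rewrite ler_wpM2l//.
    rewrite (_ : col' ord_max (y0 *m Q + v *m Q) - _ = col' ord_max (v *m Q))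
      ?colle//.
    by apply/rowP => i; rewrite !mxE addrC addKr.
  have h2 : - (q * `|v|) <= (v *m Q) 0 ord_max.
    by have := hq v ord_max; rewrite ler_norml => /andP[].
  have h3 : (1 + L) * q * `|v| < tau.
    apply: (@le_lt_trans _ _ ((1 + L) * q * (2 * rho)));
      first by rewrite ler_wpM2l// ltW.
    by apply: lt_le_trans rho2; rewrite /k; nra.
  rewrite [X in _ < X + _]mxE; move: h3; rewrite -mulrA mulrDl mul1r => h3.
  by lra.
exists (ball x rho); split; [exact: ball_open|exact: ballxx|].
pose B := ball (x + tau *: e1) rho.
have BE : B = box (x + tau *: e1 - const_mx rho) (x + tau *: e1 + const_mx rho)
  by rewrite box_center.
apply: (@poincare_translate _ _ _ oO fO _ B (tau *: e1)).
- by apply: openI => //; exact: ball_open.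
- exact: ball_open.
- by move=> z /target.
- by move=> y s [By Oy]; exact: up.
- move=> y [By _]; move: By; rewrite /B mx_norm_ball /ball_/=.
  by rewrite opprD addrACA subrr addr0.
- rewrite BE; apply: poincare_box => //; first by move=> i; rewrite !mxE; lra.
  by rewrite -BE => z /target.
Qed.

Lemma poincare_near_interior x : Omega x ->
  exists U, [/\ open U, U x & poincare_set Omega (U `&` Omega)].
Proof.
move=> Ox; have /nbhs_ballP[/= r r0 rO] : nbhs x Omega by exact: open_nbhs_nbhs.
exists (ball x r); split; [exact: ball_open|exact: ballxx|].
rewrite (setIidl rO) -box_center//; apply: poincare_box => //.
  by move=> i; rewrite !mxE; lra.
by rewrite box_center.
Qed.

End lipschitz.

(** * H1 and weighted gradient forms *)

Section H1_theory.
Context {R : realType} {d : nat}.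
Implicit Types (u v w chi : 'rV[R]_d -> R) (g h : 'I_d -> 'rV[R]_d -> R)
  (m : 'rV[R]_d -> R) (i : 'I_d).
Local Notation mu := (lebesgue d : {measure set 'rV[R]_d -> \bar R}).
Variable Omega : set 'rV[R]_d.
Hypotheses (oO : open Omega) (bO : bounded_set Omega).
Let mO : measurable Omega := open_measurable_row oO.
Let fO : (mu Omega < +oo)%E := lebesgue_bounded_lty bO mO.
Let sub := L2_subspace mO.
Let form := inner_form mO.
Local Notation L2 := (L2 Omega).
Local Notation H1 := (H1 Omega).
Local Notation inner := (inner Omega).
Local Notation grad := (grad Omega).

Lemma H1_L2 u : H1 u -> L2 u. Proof. by case. Qed.

Lemma gradP u : H1 u -> weak_gradient Omega u (grad u).
Proof. by move=> [_ [g ug]]; rewrite /Defs.grad;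
  apply: (xgetPex (fun _ _ => 0)); exists g. Qed.

Lemma L2_grad u i : H1 u -> L2 (grad u i).
Proof. by move=> /gradP /(_ i)[]. Qed.

Lemma ae_eq_sub u v : ae_eq_on Omega (u - v) (fun=> 0) -> ae_eq_on Omega u v.
Proof. by apply: filterS => x h Ox; apply/eqP; rewrite -subr_eq0; apply/eqP;
  exact: h. Qed.

(** The fundamental lemma applied to the difference. *)
Lemma weak_gradient_unique u g h i : weak_gradient Omega u g ->
  weak_gradient Omega u h ->
  ae_eq_on Omega (g i) (h i).
Proof.
move=> ug uh; have [Lg gi] := ug i; have [Lh hi] := uh i.
apply: ae_eq_sub; apply: (du_bois_reymond oO fO (subspaceB sub Lg Lh)) => w tw.
have Lw := L2_test mO tw.
rewrite (formBl sub form)//; apply/eqP; rewrite subr_eq0 -eqr_opp.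
by rewrite -gi// -hi.
Qed.

Lemma weak_gradient_lin (c : R) u v g h : L2 u -> L2 v ->
  weak_gradient Omega u g -> weak_gradient Omega v h ->
  weak_gradient Omega (c *: u + v) (fun i => c *: g i + h i).
Proof.
move=> Lu Lv ug vh i; have [Lg gi] := ug i; have [Lh hi] := vh i.
split; first exact: sub.2.
move=> w tw; have Lw := L2_test mO tw.
have Lp : L2 (partial i w) := L2_test mO (test_derive (delta_mx 0 i) tw).
case: form => _ lin _; rewrite !lin// gi// hi//; ring.
Qed.

Lemma H1_subspace : subspace H1.
Proof.
split.
  split; first exact: sub.1.
  exists (fun=> 0) => i; split; first exact: sub.1.
  move=> w tw; have Lw := L2_test mO tw.
  have Lp : L2 (partial i w) := L2_test mO (test_derive (delta_mx 0 i) tw).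
  by rewrite !(form0l sub form)// oppr0.
move=> c u v Hu Hv; split; first by apply: sub.2; exact: H1_L2.
exists (fun i => c *: grad u i + grad v i).
by apply: weak_gradient_lin; [exact: H1_L2|exact: H1_L2|exact: gradP|exact: gradP].
Qed.

Lemma grad_lin (c : R) u v i : H1 u -> H1 v ->
  ae_eq_on Omega (grad (c *: u + v) i) (c *: grad u i + grad v i).
Proof.
move=> Hu Hv; apply: (@weak_gradient_unique (c *: u + v) _
  (fun i => c *: grad u i + grad v i)).
  by apply: gradP; exact: H1_subspace.2.
by apply: weak_gradient_lin; [exact: H1_L2|exact: H1_L2|exact: gradP|exact: gradP].
Qed.

Lemma smooth_H1 u : smooth u -> H1 u.
Proof.
move=> su; have [K cK OK] := bounded_sub_compact bO.
split; first exact: (L2_smooth mO cK OK).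
by exists (fun i => partial i u); exact: smooth_weak_gradient.
Qed.

Definition weight m (M : R) := measurable_fun Omega m /\ forall x, Omega x ->
  `|m x| <= M.

Lemma L2_weight m M u : weight m M -> L2 u -> L2 (fun x => m x * u x).
Proof.
move=> [mm hM] Lu.
have iM := integrableZl mO (M ^+ 2) (L2_integrable_sqr Lu).
apply: (L2_of_le mO (h := fun x => M ^+ 2 * u x ^+ 2) _ iM).
  by apply: measurable_funM => //; exact: Lu.1.
move=> x Ox; rewrite exprMn ler_wpM2r ?sqr_ge0// -[m x ^+ 2]real_normK ?num_real//.
by rewrite lerXn2r ?nnegrE ?hM//; apply: le_trans (hM _ Ox).
Qed.

(** The weight is on one side only, as in the weak form of div (m grad u). *)
Lemma weighted_inner_form m M : weight m M -> (forall x, Omega x -> 0 <= m x) ->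
  psd_form L2 (fun u v => inner (fun x => m x * u x) v).
Proof.
move=> wm m0; split.
- by move=> u v _ _; apply: eq_Rintegral => x _; ring.
- move=> c u v w Lu Lv Lw; case: form => _ lin _.
  rewrite -lin//; try exact: (L2_weight wm).
  by apply: eq_Rintegral => x _; rewrite mulrDr mulrCA.
- move=> u Lu; apply: Rintegral_ge0 => x Ox.
  by rewrite -mulrA mulr_ge0 ?m0// -expr2 sqr_ge0.
Qed.

(** The form (m grad u, grad v) with a scalar weight m. The weight 1 gives
    gform, and gform plus the L2 inner product, nform, gives the H1 norm. *)
Definition wform m u v : R := innerv Omega (fun i x => m x * grad u i x) (grad v).
Definition gform u v : R := innerv Omega (grad u) (grad v).

Lemma wform_form m M : weight m M -> (forall x, Omega x -> 0 <= m x) ->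
  psd_form H1 (wform m).
Proof.
move=> wm m0; have [ws wl wp] := weighted_inner_form wm m0; split.
- by move=> u v Hu Hv; apply: eq_bigr => i _; rewrite ws//; exact: L2_grad.
- move=> c u v w Hu Hv Hw.
  rewrite /wform /innerv mulr_sumr -big_split/=; apply: eq_bigr => i _.
  have Hc := H1_subspace.2 c _ _ Hu Hv.
  have [Lu Lv Lw Lc] : [/\ L2 (grad u i), L2 (grad v i), L2 (grad w i) & L2
    (grad (c *: u + v) i)].
    by split; exact: L2_grad.
  rewrite -(wl c _ _ _ Lu Lv Lw).
  apply: (inner_ae mO (L2_weight wm Lc) (L2_weight wm (sub.2 c _ _ Lu Lv)) Lw).
  by have := grad_lin c i Hu Hv; apply: filterS => x h Ox; rewrite h.
- by move=> u Hu; apply: sumr_ge0 => i _; apply: wp; exact: L2_grad.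
Qed.

Lemma weight1 : weight (fun=> 1) 1.
Proof. by split => // x _; rewrite normr1. Qed.

Lemma gform_wform1 : gform = wform (fun=> 1).
Proof.
apply/funext => u; apply/funext => v; apply: eq_bigr => i _.
by apply: eq_Rintegral => x _; rewrite mul1r.
Qed.

Lemma gform_form : psd_form H1 gform.
Proof. by rewrite gform_wform1; exact: (wform_form weight1). Qed.

Lemma weighted_inner_le m m' M M' u : weight m M -> weight m' M' -> L2 u ->
  (forall x, Omega x -> m x <= m' x) ->
  inner (fun x => m x * u x) u <= inner (fun x => m' x * u x) u.
Proof.
move=> wm wm' Lu mm'; apply: le_Rintegral => //.
- exact: (L2_integrable_mul mO (L2_weight wm Lu) Lu).
- exact: (L2_integrable_mul mO (L2_weight wm' Lu) Lu).
- by move=> x Ox; rewrite -!mulrA ler_wpM2r ?mm'// -expr2 sqr_ge0.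
Qed.

Lemma weight_cst (c : R) : weight (fun=> c) `|c|.
Proof. by split. Qed.

Lemma inner_cst_weight (c : R) u : L2 u -> inner (fun x => c * u x) u =
  c * inner u u.
Proof. by move=> Lu; have := formZl sub form c Lu Lu; exact. Qed.

Lemma wform_ge m M (m0 : R) u : weight m M ->
  (forall x, Omega x -> m0 <= m x) -> H1 u ->
  m0 * gform u u <= wform m u u.
Proof.
move=> wm hm Hu; rewrite /gform /innerv mulr_sumr; apply: ler_sum => i _.
rewrite -inner_cst_weight; last exact: L2_grad.
by apply: (weighted_inner_le (weight_cst m0) wm) => //; exact: L2_grad.
Qed.

Lemma wform_le m M u : weight m M -> H1 u -> wform m u u <= M * gform u u.
Proof.
move=> wm Hu; rewrite /gform /innerv mulr_sumr; apply: ler_sum => i _.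
rewrite -inner_cst_weight; last exact: L2_grad.
apply: (weighted_inner_le wm (weight_cst M)) => [|x Ox]; first exact: L2_grad.
by apply: le_trans (ler_norm _) _; exact: wm.2.
Qed.

Definition nform u v : R := inner u v + gform u v.

Lemma nform_form : psd_form H1 nform.
Proof. by apply: psd_formD;
  [apply: psd_form_sub form; exact: H1_L2|exact: gform_form]. Qed.

Lemma inner_ge0 u : 0 <= inner u u.
Proof. by apply: Rintegral_ge0 => x _; rewrite -expr2 sqr_ge0. Qed.

Lemma gform_ge0 u : 0 <= gform u u.
Proof. by apply: sumr_ge0 => i _; exact: inner_ge0. Qed.

Lemma inner_le_nform u : inner u u <= nform u u.
Proof. by rewrite lerDl gform_ge0. Qed.

Lemma grad_le_nform u i : inner (grad u i) (grad u i) <= nform u u.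
Proof.
rewrite /nform /gform /innerv (bigD1 i)//= addrCA lerDl addr_ge0 ?inner_ge0//.
by apply: sumr_ge0 => j _; exact: inner_ge0.
Qed.

Lemma gradB u v i : H1 u -> H1 v ->
  ae_eq_on Omega (grad (u - v) i) (grad u i - grad v i).
Proof.
move=> Hu Hv; have := grad_lin (-1) i Hv Hu; rewrite !scaleN1r addrC.
by rewrite [X in ae_eq_on _ _ X]addrC.
Qed.

Lemma inner_ae_sqr u v : L2 u -> L2 v -> ae_eq_on Omega u v ->
  inner u u = inner v v.
Proof.
move=> Lu Lv uv; rewrite (inner_ae mO Lu Lv Lu uv).
by case: form => sym _ _; rewrite sym// (inner_ae mO Lu Lv Lv uv).
Qed.

(** The functions and the components of their gradients converge in L2, and
    the defining identity of the weak gradient passes to the limit. *)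
Lemma H1_complete : complete_form H1 nform.
Proof.
move=> u Hu [C hC].
have HB (k j : nat) := subspaceB H1_subspace (Hu k) (Hu j).
have Lu k : L2 (u k) := H1_L2 (Hu k).
have [v Lv uv] : exists2 v, L2 v & converges inner u v.
  apply: (L2_complete mO fO Lu); exists C => i j ij.
  exact: le_trans (inner_le_nform _) (hC _ _ ij).
have /choice[g hg] i :
  exists gi, L2 gi /\ converges inner (fun k => grad (u k) i) gi.
  have [||gi Lgi cgi] := @L2_complete _ _ _ mO fO (fun k => grad (u k) i);
    last by exists gi.
    by move=> k; exact: L2_grad.
  exists C => j k jk; apply: le_trans (hC _ _ jk).
  apply: le_trans (grad_le_nform _ i).
  have E : inner (grad (u k - u j) i) (grad (u k - u j) i)
      = inner (grad (u k) i - grad (u j) i) (grad (u k) i - grad (u j) i).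
    apply: inner_ae_sqr; [by apply: L2_grad; exact: (HB k j)| |exact: gradB].
    by apply: (subspaceB sub); exact: L2_grad.
  by rewrite E.
have vg : weak_gradient Omega v g.
  move=> i; have [Lgi cgi] := hg i; split => // w tw.
  have Lw := L2_test mO tw.
  have Lp : L2 (partial i w) := L2_test mO (test_derive (delta_mx 0 i) tw).
  apply/eqP; rewrite -addr_eq0 -sqrf_eq0 eq_le sqr_ge0 andbT.
  apply: (@le0_of_small _ _ (2 * inner (partial i w) (partial i w) +
    2 * inner w w)) => e e0.
  have [N hN] := uv _ e0; have [N' hN'] := cgi _ e0.
  pose k := maxn N N'.
  have h1 := hN k (leq_maxl _ _); have h2 := hN' k (leq_maxr _ _).
  have [Lgk gk] := gradP (Hu k) i.
  have L1 := subspaceB sub (Lu k) Lv; have L2' := subspaceB sub Lgk Lgi.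
  have -> : inner v (partial i w) + inner (g i) w =
    - (inner (u k - v) (partial i w) + inner (grad (u k) i - g i) w).
    by rewrite !(formBl sub form)// gk//; ring.
  rewrite sqrrN.
  have c1 := form_cauchy_schwarz sub form L1 Lp.
  have c2 := form_cauchy_schwarz sub form L2' Lw.
  have p1 := inner_ge0 (partial i w); have p2 := inner_ge0 w.
  set X := inner _ _ in c1 *; set Y := inner _ _ in c2 *.
  have : 0 <= (X - Y) ^+ 2 by exact: sqr_ge0.
  have : X ^+ 2 <= e * inner (partial i w) (partial i w) by apply: le_trans c1
    _; rewrite ler_wpM2r// ltW.
  have : Y ^+ 2 <= e * inner w w by apply: le_trans c2 _; rewrite ler_wpM2r// ltW.
  by move=> *; nra.
have Hv : H1 v by split => //; exists g.
exists v => // e e0.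
have e1 : 0 < e / (d.+1)%:R by rewrite divr_gt0.
have /choice[N hN] i := (hg i).2 _ e1.
have [N0 hN0] := uv _ e1.
exists (maxn N0 (\max_i N i))%N => k; rewrite geq_max => /andP[kN0 kN].
have -> : e = e / d.+1%:R + \sum_(i < d) e / d.+1%:R.
  rewrite sumr_const card_ord -[X in _ + X]mulr_natr -natr1; field.
  by rewrite natr1 pnatr_eq0.
apply: ltr_leD; first exact: hN0.
apply: ler_sum => i _; apply/ltW.
rewrite (@inner_ae_sqr _ (grad (u k) i - g i)).
- by apply: hN; apply: leq_trans kN; exact: leq_bigmax.
- by apply: L2_grad; exact: (subspaceB H1_subspace).
- by apply: (subspaceB sub); [exact: L2_grad|case: (hg i)].
- have := gradB i (Hu k) Hv; have := weak_gradient_unique i (gradP Hv) vg.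
  by apply: filterS2 => x hv huk Ox; rewrite huk//;
    change (grad (u k) i x - grad v i x = grad (u k) i x - g i x); rewrite hv.
Qed.

(** The representative of the gradient depends on the function only up to
    almost everywhere equality. *)
Lemma gform_ae0 u v : H1 u -> H1 v -> ae_eq_on Omega u (fun=> 0) -> gform u v = 0.
Proof.
move=> Hu Hv u0; rewrite /gform /innerv big1// => i _.
apply: (inner_ae0 mO); [exact: L2_grad|exact: L2_grad|].
have wz : weak_gradient Omega u (fun=> 0).
  move=> j; split; first exact: sub.1.
  move=> w tw; have Lw := L2_test mO tw.
  have Lp : L2 (partial j w) := L2_test mO (test_derive (delta_mx 0 j) tw).
  by rewrite (inner_ae0 mO (H1_L2 Hu) Lp u0) (form0l sub form)// oppr0.
exact: (weak_gradient_unique i (gradP Hu) wz).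
Qed.

Lemma grad_cst_ae (c : R) i : ae_eq_on Omega (grad (fun=> c) i) (fun=> 0).
Proof.
have sc := @smooth_cst R d c.
have := weak_gradient_unique i (gradP (smooth_H1 sc))
  (smooth_weak_gradient oO bO sc).
by rewrite partial_cst.
Qed.

Lemma wform_cst m M (c : R) u : weight m M -> H1 u -> wform m u (fun=> c) = 0.
Proof.
move=> wm Hu; rewrite /wform /innerv big1// => i _.
have Lc : L2 (grad (fun=> c) i) by apply: L2_grad; apply: smooth_H1;
  exact: smooth_cst.
have Lmu := L2_weight wm (L2_grad i Hu).
case: form => sym _ _; rewrite sym//.
by apply: (inner_ae0 mO) => //; exact: grad_cst_ae.
Qed.

End H1_theory.

(** * The spaces V and V0 *)

Section domains.
Context {R : realType} {n : nat} (D : bc_domain R n).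
Hypothesis hD : admissible D.
Local Notation Omega := (dom D).
Local Notation mu := (lebesgue n.+1 : {measure set 'rV[R]_n.+1 -> \bar R}).
Implicit Types (u v w chi : 'rV[R]_n.+1 -> R).

Lemma dom_open : open Omega.
Proof. by case: D hD => [W [_ oO _ _ _]|a b ab] /=; [exact: oO|exact: open_box].
  Qed.

Lemma dom_bounded : bounded_set Omega.
Proof.
case: D hD => [W [_ _ _ bO _]|a b ab] //=.
have cc : compact (cbox a b) by exact: compact_cbox.
have [M [rM hM]] := compact_bounded cc.
exists M; split => // x Mx y h; apply: (hM x Mx) => i.
by have /andP[? ?] := h i; rewrite !ltW.
Qed.

Lemma dom_nonempty : Omega !=set0.
Proof.
case: D hD => [W [W0 _ _ _ _]|a b ab] //=.
exists (2^-1 *: (a + b)) => i; rewrite !mxE; have := ab i => h.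
by apply/andP; split; lra.
Qed.

Lemma dom_finite : (mu Omega < +oo)%E.
Proof. exact: lebesgue_bounded_lty dom_bounded (open_measurable_row dom_open). Qed.

(** A periodic cell is a box; for a Lipschitz domain the inequality holds
    locally, in the interior and at the boundary, and the local statements
    are glued. *)
Lemma dom_poincare : poincare_set Omega Omega.
Proof.
have oO := dom_open; have bO := dom_bounded; have fO := dom_finite; have O0 :=
  dom_nonempty.
case: D hD oO bO fO O0 => [W [_ _ cO _ lip]|a b ab] /= oO bO fO O0;
  last exact: poincare_box.
apply: (poincare_of_local oO fO cO bO O0) => x cx.
have [Ox|nOx] := pselect (W x); first exact: poincare_near_interior.
exact: poincare_near_boundary.
Qed.

Let oO := dom_open.
Let bO := dom_bounded.
Let mO := open_measurable_row dom_open.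
Let fO := dom_finite.
Let sub := L2_subspace mO.
Let form := inner_form mO.

(** In the periodic case V is a closure in the sense of forms, whence its
    linear structure and its closedness. *)
Lemma V_closure u : V D u <->
  match D with Neumann _ => H1 Omega u
  | Periodic a b => form_closure (H1 Omega)
    (fun w => smooth w /\ Defs.periodic a b w) (nform Omega) u
  end.
Proof.
case: (D) => //= a b; split=> -[Hu hu]; split => // e e0.
  by have [w [sw pw hw]] := hu e e0; exists w.
by have [w [sw pw] hw] := hu e e0; exists w.
Qed.

Lemma periodic_subspace a b :
  subspace (fun w => @smooth R n.+1 w /\ Defs.periodic a b w).
Proof.
split; first by split => //; exact: smooth_cst.
move=> c u v [su pu] [sv pv]; split.
  exact: (smoothD (smoothZ c su) sv).
move=> i x; change (c * u (x + (b 0 i - a 0 i) *: delta_mx 0 i) +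
  v (x + (b 0 i - a 0 i) *: delta_mx 0 i) = c * u x + v x).
by rewrite pu pv.
Qed.

Lemma V_H1 u : V D u -> H1 Omega u.
Proof. by move/V_closure; case: (D) => //= a b []. Qed.

Lemma V_subspace : subspace (V D).
Proof.
have H1s := H1_subspace oO; have nf := nform_form oO bO.
split.
  apply/V_closure; move: oO bO H1s nf; case: (D) => [W|a b] oO' bO' H1s nf /=;
    first exact: H1s.1.
  apply: (form_closure_subspace H1s nf (periodic_subspace a b) _).1.
  by move=> w [sw _]; exact: smooth_H1.
move=> c u v /V_closure Hu /V_closure Hv; apply/V_closure; move: oO bO H1s nf Hu Hv.
case: (D) => [W|a b] oO' bO' H1s nf Hu Hv /=; first exact: H1s.2.
apply: (form_closure_subspace H1s nf (periodic_subspace a b) _).2 => //.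
by move=> w [sw _]; exact: smooth_H1.
Qed.

Lemma V_closed (u : nat -> 'rV[R]_n.+1 -> R) x : (forall k, V D (u k)) ->
  H1 Omega x ->
  converges (nform Omega) u x -> V D x.
Proof.
have H1s := H1_subspace oO; have nf := nform_form oO bO.
move=> Vu Hx ux; apply/V_closure.
have {}Vu k := (V_closure (u k)).1 (Vu k).
move: oO bO H1s nf Vu Hx ux; case: (D) => [W|a b] oO' bO' H1s nf Vu Hx ux //=.
apply: (form_closure_closed H1s nf _ Vu Hx ux).
by move=> w [sw _]; exact: smooth_H1.
Qed.

Lemma V_cst (c : R) : V D (fun=> c).
Proof.
have H1s := H1_subspace oO; have nf := nform_form oO bO.
apply/V_closure; move: oO bO H1s nf.
case: (D) => [W|a b] oO' bO' H1s nf /=; first by apply: smooth_H1 => //;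
  exact: smooth_cst.
apply: (form_closureW H1s nf); last by split => //; exact: smooth_cst.
by move=> w [sw _]; exact: smooth_H1.
Qed.

Local Notation one := (fun=> 1 : R).

Lemma inner_one u : inner Omega u one = \int[mu]_(x in Omega) u x.
Proof. by apply: eq_Rintegral => x _; rewrite mulr1. Qed.

Lemma mean_zeroE u : mean_zero Omega u <-> inner Omega u one = 0.
Proof. by rewrite inner_one. Qed.

Lemma V0_subspace : subspace (V0 D).
Proof.
have L1 := L2_cst mO fO 1.
split.
  split; first exact: V_subspace.1.
  by apply/mean_zeroE; exact: (form0l sub form).
move=> c u v [Vu mu0] [Vv mv0]; split; first exact: V_subspace.2.
apply/mean_zeroE; case: form => _ lin _; rewrite lin//; try exact/H1_L2/V_H1.
by move/mean_zeroE: mu0 => ->; move/mean_zeroE: mv0 => ->; rewrite mulr0 addr0.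
Qed.

(** Taking the mean is continuous in L2. *)
Lemma V0_closed (u : nat -> 'rV[R]_n.+1 -> R) x : (forall k, V0 D (u k)) ->
  H1 Omega x ->
  converges (nform Omega) u x -> V0 D x.
Proof.
move=> Vu Hx ux; split; first by apply: V_closed Hx ux => k; case: (Vu k).
have L1 := L2_cst mO fO 1; have Lx := H1_L2 Hx.
apply/mean_zeroE/eqP; rewrite -sqrf_eq0 eq_le sqr_ge0 andbT.
apply: (@le0_of_small _ _ (inner Omega one one)) => e e0.
have [N /(_ N (leqnn N)) hN] := ux _ e0.
have [VN mN] := Vu N; have LN := H1_L2 (V_H1 VN).
have -> : inner Omega x one = - inner Omega (u N - x) one.
  by move/mean_zeroE: mN => mN; rewrite (formBl sub form)// mN sub0r opprK.
rewrite sqrrN; apply: le_trans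
  (form_cauchy_schwarz sub form (subspaceB sub LN Lx) L1) _.
rewrite mulrC ler_wpM2l ?inner_ge0//; apply: le_trans (inner_le_nform _ _) _;
  exact: ltW.
Qed.

Lemma measure_one_gt0 : 0 < inner Omega one one.
Proof.
rewrite lt_def inner_ge0 andbT; apply/negP => /eqP h0.
have L1 := L2_cst mO fO 1.
have [N [mN muN sN]] := inner_eq0 mO L1 h0.
have : (mu Omega <= mu N)%E.
  apply: le_measure; rewrite ?inE// => x Ox; apply: sN => /= /(_ Ox) /eqP.
  by rewrite oner_eq0.
have muN' : mu N = 0%E := muN.
rewrite muN' leNgt => /negP; apply; apply: lebesgue_open_gt0 => //;
  exact: dom_nonempty.
Qed.

(** The constant is the mean of u. *)
Lemma V_decompose u : V D u -> exists c : R, V0 D (u - fun=> c).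
Proof.
move=> Vu; have L1 := L2_cst mO fO 1; have Lu := H1_L2 (V_H1 Vu).
exists (inner Omega u one / inner Omega one one); set c := _ / _.
split; first exact: (subspaceB V_subspace Vu (V_cst c)).
apply/mean_zeroE; rewrite (formBl sub form)//; last exact: L2_cst.
rewrite (_ : inner Omega (fun=> c) one = c * inner Omega one one); last first.
  by rewrite -(formZl sub form c L1 L1); apply: eq_Rintegral => x _;
    rewrite !mulr1; change (c = c * 1); rewrite mulr1.
by rewrite /c divfK ?subrr// gt_eqF// measure_one_gt0.
Qed.

Lemma V0_poincare : exists2 C : R, 0 <= C & forall u, V0 D u ->
  inner Omega u u <= C * gform Omega u u.
Proof.
have [C C0 hC] := poincare_inequality oO fO dom_poincare.
exists C => // u [Vu mu0]; have Hu := V_H1 Vu.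
exact: hC (H1_L2 Hu) (gradP Hu) mu0.
Qed.

(** On V0, Poincare's inequality makes gform equivalent to the H1 norm, so
    each form between multiples of these two is complete. *)
Lemma V0_complete (b : ('rV[R]_n.+1 -> R) -> ('rV[R]_n.+1 -> R) -> R)
  (c0 c2 : R) : 0 < c0 -> 0 <= c2 ->
  (forall u, V0 D u -> c0 * gform Omega u u <= b u u) ->
  (forall u, V0 D u -> b u u <= c2 * nform Omega u u) ->
  complete_form (V0 D) b.
Proof.
move=> c00 c20 lo up; have [C C0 hC] := V0_poincare.
apply: (complete_of_equiv (c1 := (C + 1) / c0) (c2 := c2) V0_subspace _
  (nform_form oO bO) (H1_complete oO bO) V0_closed) => //.
- by move=> u [/V_H1].
- by rewrite divr_ge0 ?addr_ge0// ltW.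
- move=> u Vu; rewrite /nform.
  apply: (@le_trans _ _ ((C + 1) * gform Omega u u)).
    by rewrite mulrDl mul1r lerD2r hC.
  rewrite mulrAC -mulrA ler_wpM2l//; first by rewrite addr_ge0.
  by rewrite ler_pdivlMr// mulrC lo.
Qed.

End domains.

(** * The inverse Laplacian, the operator A and the scheme *)

Section scheme_theory.
Context {R : realType} {n : nat} (D : bc_domain R n).
Variables (eps theta sigma B dt : R) (phin Un : 'rV[R]_n.+1 -> R).
Hypotheses (hD : admissible D) (heps : 0 < eps) (htheta : 0 < theta)
  (hsigma : 0 < sigma < 2^-1) (hB : forall x : R, 0 < potential theta sigma x + B)
  (hdt : 0 < dt) (hphin : V D phin) (hUn : L2 (dom D) Un).
Local Notation Omega := (dom D).
Local Notation mu := (lebesgue n.+1 : {measure set 'rV[R]_n.+1 -> \bar R}).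
Implicit Types (u v w chi psi : 'rV[R]_n.+1 -> R).
Local Notation one := (fun=> 1 : R).

Let oO := dom_open hD.
Let bO := dom_bounded hD.
Let mO := open_measurable_row oO.
Let fO := dom_finite hD.
Let sub := L2_subspace mO.
Let form := inner_form mO.
Let H1s := H1_subspace oO.
Let Vs := V_subspace hD.
Let V0s := V0_subspace hD.
Local Notation inner := (inner Omega).
Local Notation gform := (gform Omega).
Local Notation nform := (nform Omega).
Local Notation L2 := (L2 Omega).
Local Notation H1 := (H1 Omega).
Local Notation Hn := (Hn theta sigma B phin).
Local Notation P1 := (P1_form D eps theta sigma B phin).
Local Notation inv := (inv_laplacian D sigma phin).
Local Notation A := (opA D eps theta sigma B dt phin).

Let VH1 u : V D u -> H1 u. Proof. exact: V_H1. Qed.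
Let VL2 u : V D u -> L2 u. Proof. by move=> /VH1 /H1_L2. Qed.
Let V0V u : V0 D u -> V D u. Proof. by case. Qed.
Let L1 : L2 one := L2_cst mO fO 1.

Definition mob (x : 'rV[R]_n.+1) : R := mobility sigma (phin x).

Let mob_weight : weight Omega mob 2^-1.
Proof.
have /andP[s0 _] := hsigma; split.
  apply: (measurableT_comp (measurable_mobility sigma)); exact: (VL2 hphin).1.
move=> x _; have /andP[h1 h2] := mobility_bounds (phin x) hsigma.
by rewrite ger0_norm//; apply: le_trans h1; rewrite divr_ge0// ltW.
Qed.

Let m0 := sigma / 8.
Let m00 : 0 < m0. Proof. by have /andP[s0 _] := hsigma; rewrite divr_gt0. Qed.

Let mob_ge x : Omega x -> m0 <= mob x.
Proof. by move=> _; have /andP[] := mobility_bounds (phin x) hsigma. Qed.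

Local Notation aM := (wform Omega mob).

Let aM_form : psd_form H1 aM.
Proof.
by apply: (wform_form oO bO mob_weight) => x Ox; apply: le_trans (mob_ge Ox);
  exact: ltW.
Qed.

Let aM_ge u : H1 u -> m0 * gform u u <= aM u u.
Proof. exact: (wform_ge oO mob_weight mob_ge). Qed.

Let aM_le u : H1 u -> aM u u <= 2^-1 * gform u u.
Proof. exact: (wform_le oO mob_weight). Qed.

Let g_le_n u : gform u u <= nform u u.
Proof. by rewrite lerDr inner_ge0. Qed.

Let CH : R := 8 / sigma + 1.

Let Hn_weight : weight Omega Hn CH.
Proof.
have /andP[s0 _] := hsigma; split.
  apply: (measurableT_comp (measurable_Hfun B hsigma htheta)); exact: (VL2 hphin).1.
move=> x _; have := Hfun_bounded (phin x) hsigma htheta hB.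
rewrite -/(Hn x) /CH -[Hn x ^+ 2]real_normK ?num_real//.
by have := sqr_ge0 (`|Hn x| - 1); have := normr_ge0 (Hn x); move=> *; nra.
Qed.

Let LH u : L2 u -> L2 (Hn \* u).
Proof. exact: (L2_weight oO Hn_weight). Qed.

Let hform_form : psd_form L2 (fun u v => inner (Hn \* u) (Hn \* v)).
Proof.
case: form => sym lin pos; split.
- by move=> u v Lu Lv; apply: sym; exact: LH.
- move=> c u v w Lu Lv Lw; rewrite -lin; try exact: LH.
  by congr inner; apply/funext => x; rewrite /= mulrDr mulrCA.
- by move=> u Lu; apply: pos; exact: LH.
Qed.

Let hform_le u : L2 u -> inner (Hn \* u) (Hn \* u) <= CH ^+ 2 * inner u u.
Proof.
move=> Lu; rewrite -(inner_cst_weight oO (CH ^+ 2) Lu).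
apply: le_Rintegral => //.
- exact: (L2_integrable_mul mO (LH Lu) (LH Lu)).
- exact: (L2_integrable_mul mO (subspaceZ sub (CH ^+ 2) Lu) Lu).
- move=> x Ox; have h := Hn_weight.2 x Ox.
  have h2 : Hn x ^+ 2 <= CH ^+ 2.
    rewrite -[Hn x ^+ 2]real_normK ?num_real// lerXn2r ?nnegrE//.
    exact: le_trans h.
  have -> : (Hn \* u) x * (Hn \* u) x = Hn x ^+ 2 * u x ^+ 2 by rewrite /=; ring.
  by rewrite -mulrA -expr2 ler_wpM2r ?sqr_ge0.
Qed.

Let P1_psd : psd_form H1 P1.
Proof.
have e0 : 0 <= eps ^+ 2 by exact: sqr_ge0.
have h0 : 0 <= 2^-1 :> R by rewrite invr_ge0.
have fg := gform_form oO bO.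
have fh : psd_form H1 (fun u v => inner (Hn \* u) (Hn \* v)).
  by apply: psd_form_sub hform_form; exact: H1_L2.
exact: (psd_formD (psd_formZ e0 fg) (psd_formZ h0 fh)).
Qed.

Let P1_ge u : H1 u -> eps ^+ 2 * gform u u <= P1 u u.
Proof. by move=> Hu; rewrite /P1_form lerDl mulr_ge0 ?invr_ge0// inner_ge0. Qed.

Let P1_le u : H1 u -> P1 u u <= (eps ^+ 2 + 2^-1 * CH ^+ 2) * nform u u.
Proof.
move=> Hu; rewrite mulrDl; apply: lerD.
  by rewrite ler_wpM2l ?sqr_ge0//; exact: g_le_n.
rewrite -mulrA ler_wpM2l ?invr_ge0//; apply: le_trans (hform_le (H1_L2 Hu)) _.
by rewrite ler_wpM2l ?sqr_ge0// inner_le_nform.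
Qed.

Let aM_cst v c : H1 v -> aM v (fun=> c) = 0.
Proof. exact: (wform_cst oO bO c mob_weight). Qed.

Let aM_V0_psd : psd_form (V0 D) aM.
Proof. by apply: psd_form_sub aM_form => u /V0V /VH1. Qed.

Lemma V0_ae0 u : V0 D u -> gform u u <= 0 -> ae_eq_on Omega u (fun=> 0).
Proof.
move=> Vu gu; have [C C0 hC] := V0_poincare hD.
apply: (inner_eq0 mO); first exact: VL2 (V0V Vu).
apply/eqP; rewrite eq_le inner_ge0 andbT; apply: le_trans (hC _ Vu) _.
by rewrite mulr_ge0_le0.
Qed.

Lemma is_inv_laplacian_unique u v v' : is_inv_laplacian D sigma phin u v ->
  is_inv_laplacian D sigma phin u v' -> ae_eq_on Omega v v'.
Proof.
move=> [Vv hv] [Vv' hv']; have VB := subspaceB V0s Vv Vv'.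
apply: ae_eq_sub; apply: (V0_ae0 VB).
have [HB Hv Hv'] : [/\ H1 (v - v'), H1 v & H1 v'] by split; exact/VH1/V0V.
rewrite -(pmulr_rle0 _ m00); apply: le_trans (aM_ge HB) _.
rewrite (formBl H1s aM_form)// [aM v _](hv _ (V0V VB)) [aM v' _](hv' _ (V0V VB)).
by rewrite subrr.
Qed.

(** The Riesz representative of chi |-> - (u, chi) on V0; the equation
    extends from V0 to V because both sides vanish on constants, the right
    side since u has mean zero. *)
Lemma inv_laplacian_exists u : L2 u -> mean_zero Omega u ->
  exists v, is_inv_laplacian D sigma phin u v.
Proof.
move=> Lu u0; have [C C0 hC] := V0_poincare hD.
have compl : complete_form (V0 D) aM.
  apply: (V0_complete hD m00 (c2 := 2^-1)) => // [w /V0V/VH1|w /V0V/VH1 Hw];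
    first exact: aM_ge.
  by apply: le_trans (aM_le Hw) _; rewrite ler_wpM2l.
have [||v Vv hv] := @riesz_representation _ _ (V0 D) aM
  (fun chi => - inner u chi) (inner u u * (C / m0)) V0s aM_V0_psd compl.
- move=> c x y /V0V/VL2 Lx /V0V/VL2 Ly.
  by rewrite (formDr sub form) ?(formZr sub form)//; [ring|exact: (subspaceZ sub)].
- move=> x Vx; have Lx := VL2 (V0V Vx); rewrite sqrrN.
  apply: le_trans (form_cauchy_schwarz sub form Lu Lx) _.
  rewrite -!mulrA ler_wpM2l ?inner_ge0//; apply: le_trans (hC _ Vx) _.
  by rewrite ler_wpM2l// ler_pdivlMl// aM_ge//; exact/VH1/V0V.
exists v; split => // chi Vchi; have [c Vc] := V_decompose hD Vchi.
have chiE : chi = (chi - fun=> c) + (fun=> c) by rewrite subrK.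
have Hv := VH1 (V0V Vv); have Hc := VH1 (V_cst hD c).
rewrite chiE -/(aM v _) (formDr H1s aM_form) ?aM_cst//; last exact/VH1/V0V.
have Lc := H1_L2 Hc; have Ld := VL2 (V0V Vc).
rewrite (formDr sub form Ld Lc Lu) hv//.
rewrite (_ : inner u (fun=> c) = 0) ?addr0//.
have -> : (fun=> c) = c *: (one : 'rV[R]_n.+1 -> R).
  by apply/funext => x; change (c = c * 1); rewrite mulr1.
by rewrite (formZr sub form)// inner_one u0 mulr0.
Qed.

Lemma inv_laplacianP u : L2 u -> mean_zero Omega u ->
  is_inv_laplacian D sigma phin u (inv u).
Proof.
move=> Lu u0; have [v hv] := inv_laplacian_exists Lu u0.
by rewrite /inv_laplacian; apply: (xgetPex (fun=> 0)); exists v.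
Qed.

(** Both sides are - (M grad (inv u), grad (inv v)). *)
Lemma inv_laplacian_sym u v : L2 u -> mean_zero Omega u -> L2 v ->
  mean_zero Omega v ->
  inner (inv u) v = inner u (inv v).
Proof.
move=> Lu u0 Lv v0.
have [Vu hu] := inv_laplacianP Lu u0; have [Vv hv] := inv_laplacianP Lv v0.
have Hu := VH1 (V0V Vu); have Hv := VH1 (V0V Vv).
have e1 : aM (inv u) (inv v) = - inner u (inv v) := hu _ (V0V Vv).
have e2 : aM (inv v) (inv u) = - inner v (inv u) := hv _ (V0V Vu).
have [sym _ _] := form; have [symM _ _] := aM_form.
have := symM _ _ Hu Hv; rewrite e1 e2 => /oppr_inj ->.
exact: (sym _ _ (H1_L2 Hu) Lv).
Qed.

(** Makes the first term of A nonnegative on the diagonal. *)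
Lemma inv_laplacian_le0 u : L2 u -> mean_zero Omega u ->
  inner (inv u) u = - aM (inv u) (inv u).
Proof.
move=> Lu u0; have [Vu hu] := inv_laplacianP Lu u0.
rewrite [aM _ _](hu _ (V0V Vu)) opprK.
by case: form => sym _ _; rewrite sym//; exact/VL2/V0V.
Qed.

Lemma opA_sym psi chi : V0 D psi -> V0 D chi -> A psi chi = A chi psi.
Proof.
move=> [Vp p0] [Vc c0]; rewrite /opA; congr (- (_ * _) + _).
  have Lp := VL2 Vp; have Lc := VL2 Vc.
  rewrite inv_laplacian_sym//; case: form => sym _ _; apply: sym => //.
  by have [Vi _] := inv_laplacianP Lc c0; exact/VL2/V0V.
by case: P1_psd => s _ _; apply: s; exact: VH1.
Qed.

Let P1_le_opA psi : V0 D psi -> P1 psi psi <= A psi psi.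
Proof.
move=> [Vp p0]; rewrite /opA (inv_laplacian_le0 (VL2 Vp) p0) mulrN opprK.
rewrite -[leLHS]add0r lerD2r.
rewrite mulr_ge0 ?invr_ge0 ?(ltW hdt)//; case: aM_form => _ _; apply.
by have [Vi _] := inv_laplacianP (VL2 Vp) p0; exact/VH1/V0V.
Qed.

Lemma opA_ge psi : V0 D psi -> eps ^+ 2 * gform psi psi <= A psi psi.
Proof.
by move=> Vp; apply: le_trans (P1_le_opA Vp); exact/P1_ge/VH1/V0V.
Qed.

(** By symmetry, linearity in the second argument is enough; this avoids the
    question in which sense the chosen representative inv_laplacian is
    linear. *)
Lemma opA_psd : psd_form (V0 D) A.
Proof.
(* the inverse Laplacian of the first argument only enters as a fixed
   function *)
have linr c x y z : V0 D x -> V0 D y -> V0 D z -> A z (c *: x + y) = c * A z x +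
  A z y.
  move=> [Vx x0] [Vy y0] [Vz z0].
  have [Lx Ly Lz] := And3 (VL2 Vx) (VL2 Vy) (VL2 Vz).
  have [Hx Hy Hz] := And3 (VH1 Vx) (VH1 Vy) (VH1 Vz).
  have Li : L2 (inv z) by have [Vi _] := inv_laplacianP Lz z0; exact/VL2/V0V.
  rewrite /opA (formDr sub form (subspaceZ sub c Lx) Ly Li)
    (formZr sub form c Lx Li).
  rewrite (formDr H1s P1_psd (subspaceZ H1s c Hx) Hy Hz)
    (formZr H1s P1_psd c Hx Hz).
  by ring.
split.
- by move=> x y; exact: opA_sym.
- move=> c x y z Vx Vy Vz.
  by rewrite (opA_sym (V0s.2 c _ _ Vx Vy) Vz) (linr _ _ _ _ Vx Vy Vz)
    (opA_sym Vx Vz) (opA_sym Vy Vz).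
- move=> x Vx; apply: le_trans (opA_ge Vx).
  by rewrite mulr_ge0 ?sqr_ge0// gform_ge0.
Qed.

(** With v the inverse Laplacian of psi, the equation tested with v and
    Poincare's inequality bound (M grad v, grad v) by the squared norm of
    psi. *)
Lemma opA_le : exists2 C : R, 0 <= C & forall psi, V0 D psi ->
  A psi psi <= C * nform psi psi.
Proof.
have [C C0 hC] := V0_poincare hD.
exists (dt^-1 * (C / m0) + (eps ^+ 2 + 2^-1 * CH ^+ 2)).
  apply: addr_ge0; last first.
    by apply: addr_ge0; [exact: sqr_ge0|apply: mulr_ge0;
      [rewrite invr_ge0|exact: sqr_ge0]].
  by apply: mulr_ge0; [rewrite invr_ge0 ltW|rewrite divr_ge0// ltW].
move=> psi [Vp p0]; have Lp := VL2 Vp; have Hp := VH1 Vp.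
rewrite /opA (inv_laplacian_le0 Lp p0) mulrN opprK mulrDl lerD ?P1_le//.
rewrite -mulrA ler_wpM2l ?invr_ge0 ?(ltW hdt)//.
have [Vi hi] := inv_laplacianP Lp p0; set v := inv psi in Vi hi *.
have Hv := VH1 (V0V Vi); have Lv := VL2 (V0V Vi).
have t0 : 0 <= aM v v by case: aM_form => _ _; apply.
apply: (@le_trans _ _ (C / m0 * inner psi psi)); last first.
  by rewrite ler_wpM2l ?inner_le_nform// divr_ge0// ltW.
have key : aM v v ^+ 2 <= inner psi psi * (C / m0) * aM v v.
  rewrite {1}[aM v v](hi _ (V0V Vi)) sqrrN.
  apply: le_trans (form_cauchy_schwarz sub form Lp Lv) _.
  rewrite -!mulrA ler_wpM2l ?inner_ge0//; apply: le_trans (hC _ Vi) _.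
  by rewrite ler_wpM2l// ler_pdivlMl// aM_ge.
have [t1|t1] := eqVneq (aM v v) 0.
  by rewrite t1 mulr_ge0 ?inner_ge0// divr_ge0// ltW.
have t2 : 0 < aM v v by rewrite lt_def t1.
by rewrite mulrC -(ler_pM2r t2) -expr2.
Qed.

Lemma opA_complete : complete_form (V0 D) A.
Proof.
have [C C0 hC] := opA_le.
by apply: (V0_complete hD (c0 := eps ^+ 2) (c2 := C)) => //;
  [rewrite exprn_gt0|exact: opA_ge].
Qed.

(** If psi vanishes almost everywhere then so does its gradient, and the
    upper bound for A gives 0; conversely the gradient vanishes by
    coercivity. *)
Lemma opA_eq0 psi : V0 D psi -> A psi psi = 0 <-> ae_eq_on Omega psi (fun _ => 0).
Proof.
move=> Vp; split=> [h|p0].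
  apply: (V0_ae0 Vp); have := opA_ge Vp; rewrite h pmulr_rle0// exprn_gt0//.
have [C C0 hC] := opA_le; have := hC _ Vp.
have [_ _ pos] := opA_psd; have := pos _ Vp.
have Hp := VH1 (V0V Vp); have Lp := H1_L2 Hp.
rewrite /nform (inner_ae0 mO Lp Lp p0) (gform_ae0 oO bO Hp Hp p0) addr0 mulr0.
by move=> h1 h2; apply/eqP; rewrite eq_le h1 h2.
Qed.

Let Lg1n : L2 (g1n theta sigma B phin Un).
Proof.
have e : g1n theta sigma B phin Un = (Hn \* Un) - 2^-1 *: (Hn \* (Hn \* phin)).
  apply/funext => x; rewrite /g1n.
  by change (Hn x * Un x - 2^-1 * (Hn x * Hn x * phin x) = Hn x * Un x - 2^-1 *
    (Hn x * (Hn x * phin x))); ring.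
rewrite e; apply: (subspaceB sub); first exact: LH.
by apply: (subspaceZ sub); apply: LH; apply: LH; exact: VL2.
Qed.

Let V1 : V D one. Proof. exact: (V_cst hD). Qed.

Let V_split chi : V D chi -> exists (c : R) chi0, V0 D chi0 /\ chi =
  c *: (one : 'rV[R]_n.+1 -> R) + chi0.
Proof.
move=> Vc; have [c V0c] := V_decompose hD Vc.
exists c, (chi - fun=> c); split => //; apply/funext => x.
by change (chi x = c * 1 + (chi x - c)); ring.
Qed.

(** Write phin = m + w with w of mean zero. The unknown psi is the Riesz
    representative for A of chi |-> - dt^-1 (inv w, chi) - P_1(m, chi) -
    (g1n, chi), the parts of the equation for phi = m + psi that do not
    involve psi. Then phi - phin = psi - w. *)
Lemma weak_solution_exists : exists phi mu : 'rV[R]_n.+1 -> R,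
  weak_solution D eps theta sigma B dt phin Un phi mu.
Proof.
have [C C0 hC] := V0_poincare hD.
have [m [w [Vw phinE]]] := V_split hphin.
pose g := g1n theta sigma B phin Un; have Lg : L2 g := Lg1n.
have Lw := VL2 (V0V Vw); have [Vi _] := inv_laplacianP Lw Vw.2.
have Li := VL2 (V0V Vi).
pose z := (- dt^-1) *: inv w - g.
have Lz : L2 z by apply: (subspaceB sub) => //; exact: (subspaceZ sub).
pose cm := m *: (one : 'rV[R]_n.+1 -> R).
have Vm : V D cm by exact: (subspaceZ Vs).
have Hm := VH1 Vm.
have [||psi Vpsi hpsi] := @riesz_representation _ _ (V0 D) A
  (fun chi => inner z chi - P1 cm chi)
  (2 * (inner z z * (C / eps ^+ 2)) + 2 * P1 cm cm) V0s opA_psd opA_complete.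
- move=> c x y Vx Vy; have Lx := VL2 (V0V Vx); have Ly := VL2 (V0V Vy).
  have Hx := VH1 (V0V Vx); have Hy := VH1 (V0V Vy).
  rewrite (formDr sub form (subspaceZ sub c Lx) Ly Lz) (formZr sub form c Lx Lz).
  rewrite (formDr H1s P1_psd (subspaceZ H1s c Hx) Hy Hm)
    (formZr H1s P1_psd c Hx Hm).
  by ring.
- move=> x Vx; have Lx := VL2 (V0V Vx); have Hx := VH1 (V0V Vx).
  have e2 : 0 < eps ^+ 2 by rewrite exprn_gt0.
  have a1 : inner z x ^+ 2 <= inner z z * (C / eps ^+ 2) * A x x.
    apply: le_trans (form_cauchy_schwarz sub form Lz Lx) _.
    rewrite -!mulrA ler_wpM2l ?inner_ge0//; apply: le_trans (hC _ Vx) _.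
    by rewrite ler_wpM2l// ler_pdivlMl// opA_ge.
  have a2 : P1 cm x ^+ 2 <= P1 cm cm * A x x.
    apply: le_trans (form_cauchy_schwarz H1s P1_psd Hm Hx) _.
    by rewrite ler_wpM2l ?P1_le_opA//; case: P1_psd => _ _; exact.
  rewrite mulrDl -!mulrA; move: a1 a2; rewrite -!mulrA.
  set X := inner z x; set Y := P1 cm x => a1 a2.
  have : 0 <= (X + Y) ^+ 2 by exact: sqr_ge0.
  by move=> ?; nra.
pose u := psi - w; have Vu : V0 D u := subspaceB V0s Vpsi Vw.
have Lu := VL2 (V0V Vu); have [Vv hv] := inv_laplacianP Lu Vu.2.
pose phi := cm + psi; have Vphi : V D phi := subspaceD Vs Vm (V0V Vpsi).
have Hphi := VH1 Vphi; have Hpsi := VH1 (V0V Vpsi); have Lpsi := H1_L2 Hpsi.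
pose c := (P1 phi one + inner g one) / inner one one.
pose cc := c *: (one : 'rV[R]_n.+1 -> R).
have Vcc : V D cc by exact: (subspaceZ Vs).
have Hcc := VH1 Vcc; have Lcc := H1_L2 Hcc.
have Hv := VH1 (V0V Vv); have Lv := H1_L2 Hv.
pose nu := dt^-1 *: inv u + cc.
have Vdv : V D (dt^-1 *: inv u) by apply: (subspaceZ Vs); exact: V0V.
have Hdv := VH1 Vdv; have Ldv := H1_L2 Hdv.
have Vnu : V D nu by exact: (subspaceD Vs).
have Lnu := VL2 Vnu; have H1one := VH1 V1.
exists phi, nu; split => // chi Vchi.
  have Hchi := VH1 Vchi; have Lchi := H1_L2 Hchi.
  have -> : phi \- phin = u.
    apply/funext => x; rewrite phinE.
    by change (m * 1 + psi x - (m * 1 + w x) = psi x - w x); ring.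
  rewrite -/(aM nu chi) (formDl aM_form)// (formZl H1s aM_form)//.
  case: aM_form => sym _ _; rewrite (sym cc)// (_ : cc = fun=> c); last first.
    by apply/funext => x; exact: mulr1.
  by rewrite aM_cst// addr0 [aM _ _](hv _ Vchi) mulrN opprK.
have [k [x [Vx ->]]] := V_split Vchi.
have Hx := VH1 (V0V Vx); have Lx := H1_L2 Hx.
have Hk : H1 (k *: (one : 'rV[R]_n.+1 -> R)) by exact: (subspaceZ H1s).
have Lk := H1_L2 Hk.
rewrite (formDr sub form Lk Lx Lnu) (formDr H1s P1_psd Hk Hx Hphi)
  (formDr sub form Lk Lx Lg).
rewrite (formZr sub form k L1 Lnu) (formZr H1s P1_psd k H1one Hphi)
  (formZr sub form k L1 Lg).
have -> : inner nu one = P1 phi one + inner g one.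
  rewrite (formDl form Ldv Lcc L1) (formZl sub form _ Lv L1)
    (formZl sub form _ L1 L1).
  rewrite inner_one Vv.2 mulr0 add0r divfK// gt_eqF//; exact: measure_one_gt0.
suff -> : inner nu x = P1 phi x + inner g x by ring.
have := hpsi _ Vx; rewrite /opA.
rewrite (formDl form Ldv Lcc Lx) (formZl sub form _ Lv Lx)
  (formZl sub form _ L1 Lx).
case: form => sym _ _; rewrite (sym one)// inner_one Vx.2 mulr0 addr0.
rewrite (inv_laplacian_sym Lu Vu.2 Lx Vx.2) (inv_laplacian_sym Lpsi Vpsi.2 Lx Vx.2).
have Lix : L2 (inv x) by have [Vix _] := inv_laplacianP Lx Vx.2; exact/VL2/V0V.
rewrite (formBl sub form Lpsi Lw Lix).
have -> : inner z x = - dt^-1 * inner w (inv x) - inner g x.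
  rewrite (formBl sub form _ Lg Lx); last exact: (subspaceZ sub).
  by rewrite (formZl sub form _ Li Lx) (inv_laplacian_sym Lw Vw.2 Lx Vx.2).
by rewrite (formDl P1_psd Hm Hpsi Hx) => h; lra.
Qed.

(** For the differences p of phi and q of mu: testing the first equation
    with 1 shows that p has mean zero; testing the first with q and the
    second with p, and eliminating (p, q), gives P_1(p, p) = - dt (M grad q,
    grad q). Both are zero, so p = 0, and (q, q) = P_1(p, q) = 0 by
    Cauchy-Schwarz. *)
Lemma weak_solution_unique phi nu phi' nu' :
  weak_solution D eps theta sigma B dt phin Un phi nu ->
  weak_solution D eps theta sigma B dt phin Un phi' nu' ->
  ae_eq_on Omega phi' phi /\ ae_eq_on Omega nu' nu.
Proof.
move=> [Vphi Vnu h1 h2] [Vphi' Vnu' h1' h2'].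
pose p := phi' - phi; pose q := nu' - nu.
have Vp : V D p := subspaceB Vs Vphi' Vphi.
have Vq : V D q := subspaceB Vs Vnu' Vnu.
have [Hp Hq] : H1 p /\ H1 q by split; exact: VH1.
have [Lp Lq] : L2 p /\ L2 q by split; exact: VL2.
have [Lphi Lphi' Lphin] := And3 (VL2 Vphi) (VL2 Vphi') (VL2 hphin).
have Lnu := VL2 Vnu; have Lnu' := VL2 Vnu'.
have E1 chi : V D chi -> dt^-1 * inner p chi = - aM q chi.
  move=> Vchi; have Lchi := VL2 Vchi; have Hchi := VH1 Vchi.
  have e : dt^-1 * inner (phi - phin) chi = - aM nu chi := h1 _ Vchi.
  have e' : dt^-1 * inner (phi' - phin) chi = - aM nu' chi := h1' _ Vchi.
  rewrite (formBl sub form Lphi' Lphi Lchi)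
    (formBl H1s aM_form (VH1 Vnu') (VH1 Vnu) Hchi).
  move: e e'; rewrite (formBl sub form Lphi Lphin Lchi)
    (formBl sub form Lphi' Lphin Lchi).
  move: (inner phi chi) (inner phi' chi) (inner phin chi) (aM nu chi) (aM nu' chi).
  by move=> a b c f g e e'; nra.
have E2 chi : V D chi -> inner q chi = P1 p chi.
  move=> Vchi; have Lchi := VL2 Vchi; have Hchi := VH1 Vchi.
  have e := h2 _ Vchi; have e' := h2' _ Vchi.
  rewrite (formBl sub form Lnu' Lnu Lchi)
    (formBl H1s P1_psd (VH1 Vphi') (VH1 Vphi) Hchi).
  by rewrite e e'; ring.
have V0p : V0 D p.
  split => //; apply/mean_zeroE; have := E1 _ V1.
  by rewrite aM_cst// oppr0 => /eqP; rewrite mulf_eq0 invr_eq0 gt_eqF// => /eqP.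
have Ppp : P1 p p = 0.
  have e1 := E1 _ Vq; have e2 := E2 _ Vp.
  have [sym _ _] := form; have [_ _ pos] := P1_psd; have [_ _ pos'] := aM_form.
  move: e1; rewrite (sym p q)// e2 => e1.
  apply/eqP; rewrite eq_le pos// andbT -(pmulr_rle0 _ (_ : 0 < dt^-1)) ?invr_gt0//.
  by rewrite e1 oppr_le0 pos'.
split; apply: ae_eq_sub.
  apply: (V0_ae0 V0p); have := P1_ge Hp; rewrite Ppp pmulr_rle0// exprn_gt0//.
apply: (inner_eq0 mO Lq); rewrite E2//; apply/eqP.
rewrite -sqrf_eq0 eq_le sqr_ge0 andbT.
by apply: le_trans (form_cauchy_schwarz H1s P1_psd Hp Hq) _; rewrite Ppp mul0r.
Qed.

End scheme_theory.



Theorem theorem3p1 (R : realType) (n : nat) (D : bc_domain R n)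
  (eps theta sigma B dt : R) (phin Un : 'rV[R]_n.+1 -> R)
  (hD : admissible D)
  (heps : 0 < eps) (htheta : 1 < theta) (hsigma : 0 < sigma < 2^-1)
  (hbelow : exists m : R, forall x : R, m <= potential theta sigma x)
  (hB : forall x : R, 0 < potential theta sigma x + B)
  (hdt : 0 < dt) (hphin : V D phin) (hUn : L2 (dom D) Un) :
  (exists phi mu : 'rV[R]_n.+1 -> R,
     weak_solution D eps theta sigma B dt phin Un phi mu /\
     forall phi' mu' : 'rV[R]_n.+1 -> R,
       weak_solution D eps theta sigma B dt phin Un phi' mu' ->
       ae_eq_on (dom D) phi' phi /\ ae_eq_on (dom D) mu' mu) /\
  (* the inverse Laplacian entering the operator A is well defined *)
  (forall u : 'rV[R]_n.+1 -> R, L2 (dom D) u -> mean_zero (dom D) u ->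
     is_inv_laplacian D sigma phin u (inv_laplacian D sigma phin u) /\
     forall v : 'rV[R]_n.+1 -> R, is_inv_laplacian D sigma phin u v ->
       ae_eq_on (dom D) v (inv_laplacian D sigma phin u)) /\
  (forall psi chi : 'rV[R]_n.+1 -> R, V0 D psi -> V0 D chi ->
     opA D eps theta sigma B dt phin psi chi
     = opA D eps theta sigma B dt phin chi psi) /\
  (forall psi : 'rV[R]_n.+1 -> R, V0 D psi ->
     0 <= opA D eps theta sigma B dt phin psi psi /\
     (opA D eps theta sigma B dt phin psi psi = 0 <->
      ae_eq_on (dom D) psi (fun _ => 0))).
Proof.
have t0 : 0 < theta by exact: lt_trans ltr01 htheta.
split.
  have [phi [nu hw]] := weak_solution_exists hD heps t0 hsigma hB hdt hphin hUn.
  exists phi, nu; split => // phi' nu' hw'.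
  exact: (weak_solution_unique hD heps t0 hsigma hB hdt hphin hw hw').
split.
  move=> u Lu u0; have hi := inv_laplacianP hD hsigma hphin Lu u0; split => // v hv.
  exact: (is_inv_laplacian_unique hD hsigma hphin hv hi).
split; first by move=> psi chi; exact: (opA_sym eps dt hD t0 hsigma hB hphin).
move=> psi Vpsi; split; last exact: (opA_eq0 hD heps t0 hsigma hB hdt hphin Vpsi).
by have [_ _ pos] := opA_psd eps hD t0 hsigma hB hdt hphin; exact: pos.
Qed.
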